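(* Fix $z_0>0$, a small $\kappa>0$ and $\delta\in(0,1)$. Let $\alpha$ and $\beta$ be complex, i.i.d. Gaussian random variables with zero mean and variance $\mathbb{E}|\alpha|^2=\mathbb{E}|\beta|^2=\sigma^2$. Let $u$ be the solution to $$ i\,\partial_t u+\partial_x^2 u=2\cos(2x)\,|u|^2u,\quad x\in\mathbb{T},\qquad u(0,x)=\varepsilon\,(\alpha e^{ix}+\beta e^{-ix}). $$ Then for times $t=t(\varepsilon)\lesssim\varepsilon^{-\frac52(1-\delta)+\kappa}$ we have $$\lim_{\varepsilon\to0^+}\varepsilon^{2\delta}\log\mathbb{P}\Big(\sup_{x\in\mathbb{T}}|u(t,x)|\ge z_0\,\varepsilon^{1-\delta}\Big)=-\frac{z_0^2}{2\sigma^2}.$$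
   Context: $\mathbb{T}=[0,2\pi]$ with periodic boundary conditions. The equation is globally well-posed for initial data in $L^2(\mathbb{T})$, so $u$ is almost surely defined for all times; times are nonnegative. A complex Gaussian random variable $\eta$ with zero mean and variance $\mathbb{E}|\eta|^2=\sigma^2>0$ is circularly symmetric; in particular $|\eta|$ is Rayleigh distributed with density $\frac{2a}{\sigma^2}e^{-a^2/\sigma^2}$, $a\ge0$. The notation $a\lesssim b$ means $a\le C\,b$ for some constant $C>0$ independent of $\varepsilon$. *)

(* Defs.v *)
From HB Require Import structures.
From mathcomp Require Export all_boot all_order all_algebra.
From mathcomp Require Export complex.
From mathcomp Require Export all_classical all_reals all_analysis.

Set Implicit Arguments.
Unset Strict Implicit.
Unset Printing Implicit Defensive.

Export Order.TTheory GRing.Theory Num.Theory.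
Export numFieldNormedType.Exports.

Global Open Scope classical_set_scope.
Global Open Scope complex_scope.
Global Open Scope ring_scope.

(** ** Complex-valued functions of a real variable

The libraries give [R[i]] no normed space structure over [R], so continuity and
derivatives are taken on real and imaginary parts. *)

Definition continuous_onC (R : realType) (T : topologicalType) (D : set T)
    (f : T -> R[i]) : Prop :=
  {within D, continuous (fun p => complex.Re (f p))} /\
  {within D, continuous (fun p => complex.Im (f p))}.

Definition derivableC (R : realType) (f : R -> R[i]) (s : R) : Prop :=
  derivable (fun r => complex.Re (f r)) s 1 /\
  derivable (fun r => complex.Im (f r)) s 1.

Definition deriveC (R : realType) (f : R -> R[i]) (s : R) : R[i] :=
  derive1 (fun r => complex.Re (f r)) s +i*
  derive1 (fun r => complex.Im (f r)) s.

Definition expi (R : realType) (x : R) : R[i] := cos x +i* sin x.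

(** ** The equation [i u_t + u_xx = 2 cos(2x) |u|^2 u] on [T = [0, 2pi]]

[is_solution u0 u] says that [u] is the global (for [t >= 0]) classical
solution with initial datum [u0].  Functions on the torus are
[2pi]-periodic functions on [R].  Space derivatives are continuous up to
[t = 0]; the equation is imposed for [t > 0], where it forces the time
derivative to be continuous, with a continuous extension to [t = 0]. *)

Record is_solution (R : realType) (u0 : R -> R[i]) (u : R -> R -> R[i])
    : Prop := IsSolution {
  sol_periodic : forall t x : R, 0 <= t -> u t (x + 2 * pi) = u t x ;
  sol_initial : forall x, u 0 x = u0 x ;
  sol_cont :
    continuous_onC [set p : R * R | 0 <= p.1] (fun p => u p.1 p.2) ;
  sol_derx : forall t x : R, 0 <= t -> derivableC (u t) x ;
  sol_cont_derx :
    continuous_onC [set p : R * R | 0 <= p.1] (fun p => deriveC (u p.1) p.2) ;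
  sol_derxx : forall t x : R, 0 <= t -> derivableC (deriveC (u t)) x ;
  sol_cont_derxx :
    continuous_onC [set p : R * R | 0 <= p.1]
      (fun p => deriveC (deriveC (u p.1)) p.2) ;
  sol_dert : forall t x : R, 0 < t -> derivableC (fun s => u s x) t ;
  sol_eq : forall t x : R, 0 < t ->
    'i%C * deriveC (fun s => u s x) t + deriveC (deriveC (u t)) x
    = (2 * cos (2 * x))%:C * `|u t x| ^+ 2 * u t x
}.

Definition sup_torus (R : realType) (v : R -> R[i]) : R :=
  sup [set complex.Re `|v x| | x in `[0, 2 * pi]].

(** ** Complex Gaussian random variables *)

Definition coords (R : realType) (z : R[i]) : R * R :=
  (complex.Re z, complex.Im z).

(** Real and imaginary parts are independent [N(0, sigma^2 / 2)]: this is the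
circularly symmetric law with [E |eta|^2 = sigma^2].  The second argument of
[normal_prob] is a standard deviation. *)
Definition complex_gaussian (d : measure_display) (Omega : measurableType d)
    (R : realType) (P : probability Omega R) (sigma : R)
    (eta : Omega -> R[i]) : Prop :=
  let s := Num.sqrt (sigma ^+ 2 / 2) in
  measurable_fun setT (fun w => coords (eta w)) /\
  forall A : set (R * R), measurable A ->
    P [set w | A (coords (eta w))] =
      (normal_prob 0 s \x normal_prob 0 s)%E A.

Definition independent_rvC (d : measure_display) (Omega : measurableType d)
    (R : realType) (P : probability Omega R) (eta xi : Omega -> R[i]) : Prop :=
  forall A B : set (R * R), measurable A -> measurable B ->
    P [set w | A (coords (eta w)) /\ B (coords (xi w))] =
    (P [set w | A (coords (eta w))] * P [set w | B (coords (xi w))])%E.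

(* Main.v *)
Require Import Defs.
From mathcomp Require Import ring lra measurable_realfun.

(** The limit follows from conservation laws.  Write [u = f + i g] and let the
datum be [p cos x + q sin x] with [p = eps (alpha + beta)] and
[q = i eps (alpha - beta)], so that the squared amplitude is
[s^2 = |p|^2 + |q|^2 = 2 eps^2 (|alpha|^2 + |beta|^2)].

The mass [int |u|^2] and the energy [int |u_x|^2 + int cos(2x) |u|^4] are
conserved ([mass_conserved], [energy_conserved]), and uniqueness propagates the
symmetry [u(t, x + pi) = - u(t, x)] of the datum ([wave_antiperiodic]).  For an
antiperiodic function only odd frequencies occur, so the defect
[D = int |u_x|^2 - int |u|^2] is nonnegative, vanishes on the span of [cos] and
[sin], and bounds the squared uniform distance to the orthogonal projection on
that span ([wirtinger]).  Here [D = 0] initially, and the two conservation laws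
give [D(t) = V(0) - V(t)] for the potential [V = int cos(2x) |u|^4], hence
[D(t) = O(s^4)].  Thus [u(t) = P cos x + Q sin x + O(s^2)] uniformly in [x] and
[t], with [|P|^2 + |Q|^2 <= s^2] ([trig_split]).

Upper bound: [sup |u(t)| <= s + O(s^2)] ([solution_upper]), so the event forces
[|alpha|^2 + |beta|^2] to exceed roughly [z0^2 eps^(- 2 delta) / 2]
([rare_event_amplitude]); this has probability about
[exp (- z0^2 / (2 sigma^2) * eps^(- 2 delta))] ([amplitude_tail]).

Lower bound: the potential of [P cos x + Q sin x] is
[pi / 2 * (|P|^4 - |Q|^4)] ([trig_potential]), so at fixed mass it is smallest
for multiples of [sin x].  As [D >= 0], the potential never exceeds its initial
value, and this traps a solution that starts close to the minimiser:
[|Q|^4 >= |q|^4 - |p|^4 - O(s^5)], so [|u(t, pi / 2)|] stays almost as large as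
the amplitude ([trig_lower]).  Taking [alpha] near
[A = (z0 / 2 + eta) eps^(- delta)] and [beta] near [- A] ([sin_box]) realises
the event at the cost [2 A^2 / sigma^2] in the exponent ([sin_box_prob]), which
is the same rate as [eta] tends to [0].

The event is defined through the solution, so its measurability has to be
proved: in the [L^2] norm solutions depend on their data in a locally Lipschitz
way ([L2_stability]), hence [sup |u(t)|] depends continuously on
[(alpha, beta)] ([solution_stable]), and a set that is closed in the data is a
countable combination of measurable cells ([measurable_of_approx]). *)

Set Implicit Arguments.
Unset Strict Implicit.
Unset Printing Implicit Defensive.

(** * Continuity and integrals over a segment *)

Section Basics.
Variable R : realType.
Implicit Types (f g h F : R -> R) (a b c : R).

Section ContinuousAt.
Variable T : topologicalType.
Implicit Types (p : T) (k l : T -> R).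

Lemma cont_add p k l : continuous_at p k -> continuous_at p l ->
  continuous_at p (fun x => k x + l x).
Proof. by move=> ck cl; apply: cvgD. Qed.

Lemma cont_mul p k l : continuous_at p k -> continuous_at p l ->
  continuous_at p (fun x => k x * l x).
Proof. by move=> ck cl; apply: cvgM. Qed.

Lemma cont_opp p k : continuous_at p k -> continuous_at p (fun x => - k x).
Proof. by move=> ck; apply: cvgN. Qed.

Lemma cont_pow p n k : continuous_at p k -> continuous_at p (fun x => k x ^+ n).
Proof. by move=> ck; apply: (cvg_comp _ (fun y => y ^+ n) ck); exact: exprn_continuous. Qed.

Lemma cont_cos p k : continuous_at p k -> continuous_at p (fun x => cos (k x)).
Proof. by move=> ck; apply: (cvg_comp _ (@cos R) ck); exact: continuous_cos. Qed.

Lemma cont_sin p k : continuous_at p k -> continuous_at p (fun x => sin (k x)).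
Proof. by move=> ck; apply: (cvg_comp _ (@sin R) ck); exact: continuous_sin. Qed.

Lemma cont_cst p c : continuous_at p (fun=> c).
Proof. exact: cvg_cst. Qed.

End ContinuousAt.

Lemma cont_mull (p : R) c : continuous_at p (fun x : R => c * x).
Proof. by apply: cont_mul; [exact: cont_cst|exact: cvg_id]. Qed.

Lemma cont_snd (p : R * R) : continuous_at p (fun x : R * R => x.2).
Proof. by case: p => a b; exact: cvg_snd. Qed.

End Basics.

(** Continuity by recursion on the shape of the function. *)
Ltac cont_at :=
  lazymatch goal with
  | |- continuous_at _ (fun x => @?f x + @?g x) => apply: cont_add; cont_at
  | |- continuous_at _ (fun x => @?f x * @?g x) => apply: cont_mul; cont_at
  | |- continuous_at _ (fun x => - @?f x) => apply: cont_opp; cont_at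
  | |- continuous_at _ (fun x => @?f x ^+ ?n) => apply: cont_pow; cont_at
  | |- continuous_at _ (fun x => cos (@?f x)) => apply: cont_cos; cont_at
  | |- continuous_at _ (fun x => sin (@?f x)) => apply: cont_sin; cont_at
  | |- continuous_at _ (fun x => x) => exact: cvg_id
  | |- continuous_at _ (fun x => _) => first [exact: cont_cst | solve [auto]]
  | |- continuous_at _ (GRing.mul _) => exact: cont_mull
  | |- continuous_at _ GRing.opp => exact: (cont_opp cvg_id)
  | |- continuous_at _ cos => exact: continuous_cos
  | |- continuous_at _ sin => exact: continuous_sin
  | |- continuous_at _ snd => exact: cont_snd
  | |- continuous_at _ _ => auto
  end.
Ltac cont := let p := fresh "p" in move=> p /=; cont_at.

Section Int.
Variable R : realType.
Implicit Types (f g h F : R -> R) (a b c : R).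

Definition Int a b f : R := \int[@lebesgue_measure R]_(x in `[a, b]) f x.

Lemma Int_integrable a b f : continuous f ->
  (@lebesgue_measure R).-integrable `[a, b] (EFin \o f).
Proof.
move=> cf; apply: continuous_compact_integrable; first exact: segment_compact.
exact: continuous_subspaceT.
Qed.

Lemma Int_D a b f g : continuous f -> continuous g ->
  Int a b (fun x => f x + g x) = Int a b f + Int a b g.
Proof. by move=> cf cg; rewrite /Int RintegralD//; exact: Int_integrable. Qed.

Lemma Int_B a b f g : continuous f -> continuous g ->
  Int a b (fun x => f x - g x) = Int a b f - Int a b g.
Proof. by move=> cf cg; rewrite /Int RintegralB//; exact: Int_integrable. Qed.

Lemma Int_Z a b c f : continuous f -> Int a b (fun x => c * f x) = c * Int a b f.
Proof. by move=> cf; rewrite /Int RintegralZl//; exact: Int_integrable. Qed.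

Lemma Int_ext a b f g : (forall x, a <= x <= b -> f x = g x) -> Int a b f = Int a b g.
Proof. by move=> fg; apply: eq_Rintegral => x; rewrite inE/= in_itv/= => /fg. Qed.

Lemma Int_le a b f g : continuous f -> continuous g ->
  (forall x, a <= x <= b -> f x <= g x) -> Int a b f <= Int a b g.
Proof.
by move=> cf cg fg; apply: le_Rintegral => //; exact: Int_integrable.
Qed.

Lemma Int_ge0 a b f : (forall x, a <= x <= b -> 0 <= f x) -> 0 <= Int a b f.
Proof. by move=> f0; apply: Rintegral_ge0 => x /=; rewrite in_itv/= => /f0. Qed.

Lemma Int_cst a b c : a <= b -> Int a b (fun=> c) = c * (b - a).
Proof.
move=> ab; rewrite /Int Rintegral_cst//= lebesgue_measure_itv/= lte_fin.
case: ltP => //= ba; rewrite (_ : b = a) ?subrr//.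
by apply/eqP; rewrite eq_le ba ab.
Qed.

Lemma FTC2 F f a b : a <= b -> continuous f ->
  (forall x, a <= x <= b -> is_derive x 1 F (f x)) -> Int a b f = F b - F a.
Proof.
rewrite le_eqVlt => /predU1P[<- cf _|ab cf dF].
  by rewrite /Int set_itv1 Rintegral_set1 subrr.
have dF' x : a <= x <= b -> {for x, continuous F}.
  move=> /dF dFx; apply: differentiable_continuous; apply/derivable1_diffP.
  by case: dFx.
rewrite /Int /Rintegral (@continuous_FTC2 _ _ F)//=.
- exact: continuous_subspaceT.
- split.
  + move=> x; rewrite in_itv/= => /andP[ax xb].
    have axb : a <= x <= b by rewrite !ltW.
    by case: (dF x axb).
  + by apply: cvg_at_right_filter; apply: dF'; rewrite lexx ltW.
  + by apply: cvg_at_left_filter; apply: dF'; rewrite lexx ltW.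
- move=> x; rewrite in_itv/= => /andP[ax xb]; rewrite derive1E.
  have axb : a <= x <= b by rewrite !ltW.
  by case: (dF x axb).
Qed.

Lemma Int_eq0 a b f : a <= b -> (forall x, a <= x <= b -> f x = 0) -> Int a b f = 0.
Proof. by move=> ab f0; rewrite (Int_ext f0) Int_cst// mul0r. Qed.

Lemma Int_abs_le a b c f : a <= b -> continuous f ->
  (forall x, a <= x <= b -> `|f x| <= c) -> `|Int a b f| <= c * (b - a).
Proof.
move=> ab cf fc; rewrite -(Int_cst c ab).
rewrite ler_norml; apply/andP; split.
  rewrite -mulN1r -Int_Z; last cont.
  apply: Int_le => //; first cont.
  by move=> x /fc; rewrite mulN1r ler_norml => /andP[].
apply: Int_le => //; first cont.
by move=> x /fc; rewrite ler_norml => /andP[].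
Qed.

(** The quadratic form [int (l f + m g)^2] is nonnegative; evaluate it at
[(l, m) = (- int f g, int f^2)]. *)
Lemma Int_CS a b f g : continuous f -> continuous g ->
  Int a b (fun x => f x * g x) ^+ 2 <=
  Int a b (fun x => f x ^+ 2) * Int a b (fun x => g x ^+ 2).
Proof.
move=> cf cg.
set A := Int a b (fun x => f x ^+ 2); set B := Int a b (fun x => g x ^+ 2).
set C := Int _ _ _.
have A0 : 0 <= A by apply: Int_ge0 => x _; exact: sqr_ge0.
have B0 : 0 <= B by apply: Int_ge0 => x _; exact: sqr_ge0.
have q l m : 0 <= l ^+ 2 * A + (2 * l * m) * C + m ^+ 2 * B.
  have : 0 <= Int a b (fun x => (l * f x + m * g x) ^+ 2).
    by apply: Int_ge0 => x _; exact: sqr_ge0.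
  rewrite (_ : (fun x => (l * f x + m * g x) ^+ 2) =
    (fun x => (l ^+ 2 * f x ^+ 2 + 2 * l * m * (f x * g x)) + m ^+ 2 * g x ^+ 2)).
    rewrite Int_D ?Int_D ?Int_Z//; cont.
  by apply: funext => x; ring.
have [A00|A00] := eqVneq A 0.
  have [B00|B00] := eqVneq B 0.
    have := q 1 1; have := q 1 (-1); rewrite A00 B00 => *; have -> : C = 0 by lra.
    by rewrite expr0n mul0r.
  have := q B (- C); have : 0 < B by rewrite lt0r B00.
  rewrite A00 => Bp; rewrite (_ : _ + _ = B * - C ^+ 2); last by ring.
  by rewrite pmulr_rge0 // mul0r oppr_ge0.
have := q (- C) A; have : 0 < A by rewrite lt0r A00.
move=> Ap; rewrite (_ : _ + _ = A * (A * B - C ^+ 2)); last by ring.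
by rewrite pmulr_rge0 // subr_ge0.
Qed.

(** Compactness of [[a, b]] turns joint continuity along [{t} * [a, b]] into
closeness of [k s] and [k t] that is uniform in [x]. *)
Lemma Int_cvg_param a b (k : R -> R -> R) t :
  (forall s, continuous (k s)) ->
  (forall y, a <= y <= b -> {for (t, y), continuous (fun p : R * R => k p.1 p.2)}) ->
  Int a b (k s) @[s --> t] --> Int a b (k t).
Proof.
move=> ck ct; have [ba|ab] := ltP b a.
  have -> : (fun s => Int a b (k s)) = fun=> Int a b (k t).
    apply: funext => s; apply: Int_ext => x /andP[ax xb].
    by have := le_lt_trans (le_trans ax xb) ba; rewrite ltxx.
  exact: cvg_cst.
apply/cvgrPdist_le => e e0.
set e' := e / (b - a + 1).
have e'0 : 0 < e' by rewrite divr_gt0//; lra.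
have near_k : \forall s \near t, `[a, b] `<=` (fun x => `|k t x - k s x| <= e').
  have /compact_near_coveringP nc := @segment_compact R a b.
  apply: (nc R (nbhs t) (fun s x => `|k t x - k s x| <= e')) => x /=; rewrite in_itv/= => xab.
  have cx := ct x xab.
  have /cvgrPdist_le /(_ (e'/2)) := cx.
  have e2 : 0 < e'/2 by rewrite divr_gt0.
  move=> /(_ e2) /= [[U V]/= [Ut Vx] UV].
  exists (V, U) => //= -[y s]/= [Vy Us].
  have h1 := UV (s, y) (conj Us Vy).
  have h2 := UV (t, y) (conj (nbhs_singleton Ut) Vy).
  move: h1 h2 => /=; rewrite !ler_norml => /andP[h1 h2] /andP[h3 h4].
  apply/andP; split; lra.
near=> s.
have hs : forall x, a <= x <= b -> `|k t x - k s x| <= e'.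
  have hk : `[a, b] `<=` (fun x => `|k t x - k s x| <= e') by near: s.
  by move=> x xab; apply: hk; rewrite /= in_itv.
rewrite -Int_B//.
apply: (le_trans (Int_abs_le ab _ hs)); first cont.
rewrite /e' -mulrAC ler_pdivrMr; last lra.
rewrite ler_wpM2l//; [exact: ltW|lra].
Unshelve. all: by end_near. Qed.

End Int.

(** * Differentiation under the integral sign *)

Section Derive.
Variable R : realType.
Implicit Types (f g h F : R -> R) (x a b c : R).

Lemma der_add x f g a b : is_derive x 1 f a -> is_derive x 1 g b ->
  is_derive x 1 (fun y => f y + g y) (a + b).
Proof. by move=> df dg; exact: is_deriveD. Qed.

Lemma der_opp x f a : is_derive x 1 f a -> is_derive x 1 (fun y => - f y) (- a).
Proof. by move=> df; exact: is_deriveN. Qed.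

Lemma der_mul x f g a b : is_derive x 1 f a -> is_derive x 1 g b ->
  is_derive x 1 (fun y => f y * g y) (f x * b + g x * a).
Proof. by move=> df dg; exact: is_deriveM. Qed.

Lemma der_pow x n f a : is_derive x 1 f a ->
  is_derive x 1 (fun y => f y ^+ n.+1) (n.+1%:R * f x ^+ n * a).
Proof.
move=> df; rewrite (_ : (fun y => _) = f ^+ n.+1); first exact: is_deriveX.
by apply: funext => y; rewrite fctE.
Qed.

Lemma der_cst x c : is_derive x 1 (fun=> c) 0.
Proof. exact: is_derive_cst. Qed.

Lemma der_id x : is_derive x 1 (fun y : R => y) 1.
Proof. exact: is_derive_id. Qed.

Lemma der_mull x c : is_derive x 1 (fun y : R => c * y) c.
Proof. by have := der_mul (der_cst x c) (der_id x); rewrite mulr1 mulr0 addr0. Qed.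

Lemma der_comp x f g a b : is_derive (g x) 1 f a -> is_derive x 1 g b ->
  is_derive x 1 (fun y => f (g y)) (a * b).
Proof. by move=> df dg; exact: is_derive1_comp. Qed.

Lemma der_cos x g b : is_derive x 1 g b ->
  is_derive x 1 (fun y => cos (g y)) (- sin (g x) * b).
Proof. by move=> dg; apply: der_comp dg; exact: is_derive_cos. Qed.

Lemma der_sin x g b : is_derive x 1 g b ->
  is_derive x 1 (fun y => sin (g y)) (cos (g x) * b).
Proof. by move=> dg; apply: der_comp dg; exact: is_derive_sin. Qed.

Lemma der_eq x f a b : is_derive x 1 f a -> a = b -> is_derive x 1 f b.
Proof. by move=> df <-. Qed.

Lemma der_shift x c f a : is_derive (x + c) 1 f a -> is_derive x 1 (fun y => f (y + c)) a.
Proof.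
move=> df; have d1 : is_derive x 1 (fun y => y + c) (1 + 0).
  exact: der_add (der_id x) (der_cst x c).
by have := @der_comp x f (fun y => y + c) _ _ df d1; rewrite addr0 mulr1.
Qed.

Lemma der_continuous x f a : is_derive x 1 f a -> {for x, continuous f}.
Proof. by case=> df _; apply: differentiable_continuous; apply/derivable1_diffP. Qed.

End Derive.

(** The derivative is built from the shape of the function, so that it is a
plain ring expression. *)
Ltac der_at :=
  lazymatch goal with
  | |- is_derive _ _ (fun x => @?f x + @?g x) _ =>
      simple notypeclasses refine (der_add _ _); der_at
  | |- is_derive _ _ (fun x => - @?f x) _ => simple notypeclasses refine (der_opp _); der_at
  | |- is_derive _ _ (fun x => @?f x * @?g x) _ =>
      simple notypeclasses refine (der_mul _ _); der_at
  | |- is_derive _ _ (fun x => @?f x ^+ ?n) _ => simple notypeclasses refine (der_pow _ _); der_at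
  | |- is_derive _ _ (fun x => cos (@?f x)) _ => simple notypeclasses refine (der_cos _); der_at
  | |- is_derive _ _ (fun x => sin (@?f x)) _ => simple notypeclasses refine (der_sin _); der_at
  | |- is_derive _ _ (GRing.mul _) _ => exact: der_mull
  | |- is_derive _ _ GRing.opp _ => exact: (der_opp (der_id _))
  | |- is_derive _ _ cos _ => exact: is_derive_cos
  | |- is_derive _ _ sin _ => exact: is_derive_sin
  | |- is_derive _ _ (fun x => x) _ => exact: der_id
  | |- is_derive _ _ (fun x => _) _ => first [exact: der_cst | solve [eauto]]
  | |- is_derive _ _ _ _ => eauto
  | |- _ => shelve
  end.
Ltac der := simple notypeclasses refine (der_eq _ _); [shelve | der_at | cbv beta].

Section IntPrimitive.
Variable R : realType.
Implicit Types (f g h F : R -> R) (x a b c p : R).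

Lemma Int_primitive a b h : continuous h ->
  forall x, a < x < b -> is_derive x 1 (fun y => Int a y h) (h x).
Proof.
move=> ch x /andP[ax xb].
have [dF eF] := @continuous_FTC1_closed R h a x b xb (Int_integrable _ _ ch) ax (ch x).
by rewrite -eF derive1E; exact: DeriveDef.
Qed.

Lemma FTC2_eq F f a b c : a <= b -> continuous f ->
  (forall x, is_derive x 1 F (f x)) -> F b - F a = c -> Int a b f = c.
Proof. by move=> ab cf dF <-; exact: FTC2. Qed.

Lemma Int_cat a b c h : a <= b <= c -> continuous h ->
  Int a c h = Int a b h + Int b c h.
Proof.
move=> /andP[ab bc] ch; have ac := le_trans ab bc.
pose H y := Int (a - 1) y h.
have dH x : a <= x <= c -> is_derive x 1 H (h x).
  by move=> /andP[ax xc]; apply: (@Int_primitive (a - 1) (c + 1)) => //; lra.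
have -> : Int a c h = H c - H a by exact: FTC2.
have -> : Int a b h = H b - H a by apply: FTC2 => // x ?; apply: dH; lra.
have -> : Int b c h = H c - H b by apply: FTC2 => // x ?; apply: dH; lra.
ring.
Qed.

(** For a primitive [H] of [h], the difference [H (x + p) - H x] has derivative
[h (x + p) - h x = 0]. *)
Lemma Int_periodic x p h : 0 <= x -> 0 <= p -> continuous h -> (forall y, h (y + p) = h y) ->
  Int x (x + p) h = Int 0 p h.
Proof.
move=> x0 p0 ch hp.
pose H y := Int (- 1) y h.
have dH y : 0 <= y <= x + p -> is_derive y 1 H (h y).
  by move=> /andP[y0 yx]; apply: (@Int_primitive (- 1) (x + p + 1)) => //; lra.
have -> : Int x (x + p) h = H (x + p) - H x.
  by apply: FTC2 => // [|y ?]; [lra|apply: dH; lra].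
have -> : Int 0 p h = H p - H 0 by apply: FTC2 => // y ?; apply: dH; lra.
have : Int 0 x (fun=> 0 : R) = (H (x + p) - H x) - (H (0 + p) - H 0).
  apply: (@FTC2 _ (fun y => H (y + p) - H y)) => //; first cont.
  move=> y /andP[y0 yx].
  have d1 : is_derive y 1 (fun y => H (y + p)) (h (y + p)) by apply: der_shift; apply: dH; lra.
  have d2 : is_derive y 1 H (h y) by apply: dH; lra.
  by have := der_add d1 (der_opp d2); rewrite hp subrr.
by rewrite Int_cst// mul0r add0r => /esym/eqP; rewrite subr_eq0 => /eqP.
Qed.

End IntPrimitive.

Section Caratheodory.
Variable R : realType.
Implicit Types (F : R -> R) (t : R).

(** Caratheodory's form of the derivative.  Energies are differentiated this
way because [u] has no mixed derivative in [t] and [x]: after an integration by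
parts only difference quotients of [u] in time are left. *)
Lemma caratheodory F (K : R -> R) t :
  (forall s, F s - F t = (s - t) * K s) -> K s @[s --> t] --> K t ->
  is_derive t 1 F (K t).
Proof.
move=> FK cK.
have lim : h^-1 *: ((F \o shift t) (h *: 1) - F t) @[h --> 0^'] --> K t.
  have : K (h + t) @[h --> 0^'] --> K t.
    apply: cvg_comp cK; have : h + t @[h --> (0:R)^'] --> 0 + t.
      by apply: cvgD; [exact: nbhs_dnbhs|exact: cvg_cst].
    by rewrite add0r.
  apply: cvg_trans; apply: near_eq_cvg; near=> h.
  have h0 : h != 0 by near: h; exact: nbhs_dnbhs_neq.
  have -> : (F \o shift t) (h *: 1) = F (h + t) by rewrite /= [h *: _]mulr1.
  by rewrite FK addrK [RHS]mulrA mulVf// mul1r.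
split; first by apply/cvg_ex; exists (K t).
exact: cvg_lim lim.
Unshelve. all: by end_near. Qed.

Variables (f ft : R -> R -> R).
Hypothesis f_der : forall t x, 0 < t -> is_derive t 1 (f ^~ x) (ft t x).

(** The value at [s = t] is the one that makes the quotient continuous. *)
Definition slope t s x := if s == t then ft t x else (f s x - f t x) / (s - t).

Lemma slopeE t s x : f s x - f t x = (s - t) * slope t s x.
Proof.
rewrite /slope; case: eqVneq => [->|st]; first by rewrite !subrr mul0r.
by rewrite mulrC divfK// subr_eq0.
Qed.

Lemma slopett t x : slope t t x = ft t x. Proof. by rewrite /slope eqxx. Qed.

(** By the mean value theorem the quotient is a value of [ft] at a nearby time,
so it inherits the joint continuity of [ft]. *)
Lemma slope_mean t s x : 0 < t -> 0 < s ->
  exists2 c, `|c - t| <= `|s - t| & slope t s x = ft c x.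
Proof.
move=> t0 s0; case: (ltgtP s t) => [st|ts|->].
- have [||c] := @MVT R (f^~ x) (ft^~ x) s t st.
  + by move=> y; rewrite in_itv/= => /andP[sy _]; apply: f_der; exact: lt_trans sy.
  + apply: derivable_within_continuous => y; rewrite in_itv/= => /andP[sy _].
    by case: (@f_der y x (lt_le_trans s0 sy)).
  rewrite in_itv/= => /andP[sc ct] E; exists c.
    by rewrite !ltr0_norm ?subr_lt0//; lra.
  rewrite /slope lt_eqF//; apply: (@mulIf _ (s - t)); first by rewrite subr_eq0 lt_eqF.
  rewrite divfK ?subr_eq0 ?lt_eqF//; lra.
- have [||c] := @MVT R (f^~ x) (ft^~ x) t s ts.
  + by move=> y; rewrite in_itv/= => /andP[sy _]; apply: f_der; exact: lt_trans sy.
  + apply: derivable_within_continuous => y; rewrite in_itv/= => /andP[sy _].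
    by case: (@f_der y x (lt_le_trans t0 sy)).
  rewrite in_itv/= => /andP[sc ct] E; exists c.
    by rewrite !gtr0_norm ?subr_gt0//; lra.
  rewrite /slope gt_eqF//; apply: (@mulIf _ (s - t)); first by rewrite subr_eq0 gt_eqF.
  rewrite divfK ?subr_eq0 ?gt_eqF//; lra.
- by exists t; rewrite ?subrr// slopett.
Qed.

Lemma slope_continuous t y : 0 < t ->
  continuous_at (t, y) (fun p : R * R => ft p.1 p.2) ->
  continuous_at (t, y) (fun p : R * R => slope t p.1 p.2).
Proof.
move=> t0 ct; rewrite /continuous_at/= slopett.
apply/cvgrPdist_le => e e0; have /cvgrPdist_le /(_ e e0) /= := ct.
move=> [[U V]/= [/nbhs_ballP[r /= r0 rU] Vy] UV].
exists (ball t (Num.min r t), V) => /=.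
  by split => //; apply: nbhsx_ballx; rewrite lt_min r0 t0.
move=> [s x]/= [+ Vx]; rewrite /ball/= lt_min => /andP[sr st].
have s0 : 0 < s by move: st; rewrite ltr_norml; lra.
have [c cs ->] := @slope_mean t s x t0 s0.
apply: (UV (c, x)); split => //=; apply: rU; rewrite /ball/=.
by rewrite distrC (le_lt_trans cs)// distrC.
Qed.

Lemma slope_continuous_x t s : continuous (ft t) -> continuous (f t) -> continuous (f s) ->
  continuous (slope t s).
Proof.
move=> c1 c2 c3; rewrite /slope; case: eqP => _ //.
by cont.
Qed.

End Caratheodory.

(** * Conservation laws of the wave equation *)

Section Evolution.
Variable R : realType.
Local Notation "2pi" := (2 * @pi R).
Local Notation uncurried k := (fun p : R * R => k p.1 p.2).

(** A function of time and space together with its first two space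
derivatives. *)
Record jet := Jet { j0 : R -> R -> R ; j1 : R -> R -> R ; j2 : R -> R -> R }.

Record is_jet (f : jet) : Prop := IsJet {
  jet_c0 : continuous (uncurried (j0 f)) ;
  jet_c1 : continuous (uncurried (j1 f)) ;
  jet_c2 : continuous (uncurried (j2 f)) ;
  jet_d1 : forall t x : R, is_derive x 1 (j0 f t) (j1 f t x) ;
  jet_d2 : forall t x : R, is_derive x 1 (j1 f t) (j2 f t x) ;
  jet_p0 : forall t x : R, j0 f t (x + 2pi) = j0 f t x ;
  jet_p1 : forall t x : R, j1 f t (x + 2pi) = j1 f t x }.

(** Real form of [u_t = i u_xx + (A + i B)] for [u = f + i g]. *)
Record evolution (f g : jet) (A B : R -> R -> R) : Prop := Evolution {
  ev_f : is_jet f ;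
  ev_g : is_jet g ;
  ev_cA : continuous (uncurried A) ;
  ev_cB : continuous (uncurried B) ;
  ev_ft : forall t x : R, 0 < t -> is_derive t 1 (j0 f ^~ x) (- j2 g t x + A t x) ;
  ev_gt : forall t x : R, 0 < t -> is_derive t 1 (j0 g ^~ x) (j2 f t x + B t x) }.

Lemma uncurried_x (k : R -> R -> R) : continuous (uncurried k) -> forall t : R, continuous (k t).
Proof.
move=> ck t x; apply: (@continuous_comp _ _ _ (fun x : R => (t, x)) (uncurried k)).
  have h1 : t @[y --> x] --> t by exact: cvg_cst.
  have h2 : y @[y --> x] --> x by exact: cvg_id.
  exact: (cvg_pair h1 h2).
exact: ck.
Qed.

Lemma Int_continuous_t (k : R -> R -> R) (a b : R) : continuous (uncurried k) ->
  continuous (fun s : R => Int a b (k s)).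
Proof.
move=> ck t; apply: (@Int_cvg_param _ a b k); first exact: uncurried_x.
by move=> y _; exact: ck.
Qed.

Lemma pi2_ge0 : 0 <= 2pi. Proof. by rewrite mulr_ge0// pi_ge0. Qed.
Hint Resolve pi2_ge0 : core.

(** The dispersive part contributes [int (g f_xx - f g_xx)], which is the
integral of a derivative of a periodic function. *)
Lemma evolution_L2 f g A B (t : R) : evolution f g A B -> 0 < t ->
  is_derive t 1 (fun s => Int 0 2pi (fun x => j0 f s x ^+ 2 + j0 g s x ^+ 2))
    (2 * Int 0 2pi (fun x => j0 f t x * A t x + j0 g t x * B t x)).
Proof.
move=> [[cf cf1 cf2 df df1 pf pf1] [cg cg1 cg2 dg dg1 pg pg1] cA cB ft gt] t0.
set ftt := fun t x => - j2 g t x + A t x in ft.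
set gtt := fun t x => j2 f t x + B t x in gt.
pose K s x := slope (j0 f) ftt t s x * (j0 f s x + j0 f t x) +
              slope (j0 g) gtt t s x * (j0 g s x + j0 g t x).
have cx := uncurried_x.
have cft : continuous (uncurried ftt) by rewrite /ftt; cont.
have cgt : continuous (uncurried gtt) by rewrite /gtt; cont.
have ck s : continuous (K s).
  have h1 : continuous (slope (j0 f) ftt t s) by apply: slope_continuous_x; exact: cx.
  have h2 : continuous (slope (j0 g) gtt t s) by apply: slope_continuous_x; exact: cx.
  have := cx _ cf; have := cx _ cg => c1 c2.
  have c3 := c1 s; have c4 := c1 t; have c5 := c2 s; have c6 := c2 t.
  by rewrite /K; cont.
have ckt y : 0 <= y <= 2pi -> continuous_at (t, y) (uncurried K).
  move=> _; have h1 := slope_continuous ft t0 (cft (t, y)).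
  have h2 := slope_continuous gt t0 (cgt (t, y)).
  rewrite /K /=.
  have h3 : continuous_at (t, y) (fun p : R * R => j0 f t p.2).
    by apply: (@continuous_comp _ _ _ (fun p : R * R => p.2) (j0 f t)); [exact: cvg_snd|exact: cx].
  have h4 : continuous_at (t, y) (fun p : R * R => j0 g t p.2).
    by apply: (@continuous_comp _ _ _ (fun p : R * R => p.2) (j0 g t)); [exact: cvg_snd|exact: cx].
  by cont_at.
have -> : 2 * Int 0 2pi (fun x => j0 f t x * A t x + j0 g t x * B t x) = Int 0 2pi (K t).
  have bd : Int 0 2pi (fun x => j0 g t x * j2 f t x - j0 f t x * j2 g t x) = 0.
    apply: (@FTC2_eq _ (fun x => j0 g t x * j1 f t x - j0 f t x * j1 g t x)) => //.
    - by have c1 := cx _ cf t; have c2 := cx _ cg t; have c3 := cx _ cf2 t; have c4 := cx _ cg2 t; cont.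
    - by move=> x; der; ring.
    - by rewrite -[2pi]add0r pf pg pf1 pg1 subrr.
  rewrite -[LHS]addr0 -[X in _ + X](mulr0 2) -[in X in _ + X]bd -mulrDr.
  have c1 := cx _ cf t; have c2 := cx _ cg t; have c3 := cx _ cA t; have c4 := cx _ cB t.
  have c5 := cx _ cf2 t; have c6 := cx _ cg2 t.
  rewrite -Int_D; [|cont|cont].
  rewrite -Int_Z; last cont.
  by apply: Int_ext => x _; rewrite /K !slopett /ftt /gtt; ring.
apply: (@caratheodory _ _ (fun s => Int 0 2pi (K s))) => [s|]; last first.
  exact: Int_cvg_param.
have c1 := cx _ cf t; have c2 := cx _ cg t; have c3 := cx _ cf s; have c4 := cx _ cg s.
rewrite -Int_B; [|cont|cont].
rewrite -Int_Z//.
apply: Int_ext => x _; rewrite /K mulrDr !mulrA -!slopeE; ring.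
Qed.


(** The potential factor [2 cos(2x) |u|^2] multiplying [u]. *)
Definition cubic (f g : jet) (t x : R) := 2 * cos (2 * x) * (j0 f t x ^+ 2 + j0 g t x ^+ 2).

Definition wave (f g : jet) := evolution f g
  (fun t x => cubic f g t x * j0 g t x) (fun t x => - (cubic f g t x * j0 f t x)).

Lemma wave_intro f g : is_jet f -> is_jet g ->
  (forall t x : R, 0 < t -> is_derive t 1 (j0 f ^~ x) (- j2 g t x + cubic f g t x * j0 g t x)) ->
  (forall t x : R, 0 < t -> is_derive t 1 (j0 g ^~ x) (j2 f t x - cubic f g t x * j0 f t x)) ->
  wave f g.
Proof.
move=> jf jg ft gt; have [cf _ _ _ _ _ _] := jf; have [cg _ _ _ _ _ _] := jg.
by split => //; rewrite /cubic; cont.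
Qed.

Definition mass (f g : jet) (t : R) := Int 0 2pi (fun x => j0 f t x ^+ 2 + j0 g t x ^+ 2).

Definition kinetic (f g : jet) (t : R) := Int 0 2pi (fun x => j1 f t x ^+ 2 + j1 g t x ^+ 2).

Definition potential (f g : jet) (t : R) :=
  Int 0 2pi (fun x => cos (2 * x) * (j0 f t x ^+ 2 + j0 g t x ^+ 2) ^+ 2).

(** [int (f_x(s)^2 - f_x(t)^2)] equals [- int (f(s) - f(t)) (f_xx(s) + f_xx(t))]:
the increment of the kinetic energy is expressed by increments of [f]. *)
Lemma Int_ibp f (s t : R) : is_jet f ->
  Int 0 2pi (fun x => (j1 f s x - j1 f t x) * (j1 f s x + j1 f t x)
                    + (j0 f s x - j0 f t x) * (j2 f s x + j2 f t x)) = 0.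
Proof.
move=> [cf cf1 cf2 df df1 pf pf1].
apply: (@FTC2_eq _ (fun x => (j0 f s x - j0 f t x) * (j1 f s x + j1 f t x))) => //.
- have c1 := @uncurried_x _ cf s; have c2 := @uncurried_x _ cf t.
  have c3 := @uncurried_x _ cf1 s; have c4 := @uncurried_x _ cf1 t.
  by have c5 := @uncurried_x _ cf2 s; have c6 := @uncurried_x _ cf2 t; cont.
- by move=> x; der; ring.
- by rewrite -[2pi]add0r !pf !pf1 subrr.
Qed.

(** In the limit the quotient of the energy is
[2 int (f_t (- f_xx + n f) + g_t (- g_xx + n g))] with [n = cubic f g], and the
equation turns the brackets into [- g_t] and [f_t]. *)
Lemma energy_law f g (t : R) : wave f g -> 0 < t ->
  is_derive t 1 (fun s => kinetic f g s + potential f g s) 0.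
Proof.
move=> [jf jg _ _ ft0 gt0] t0.
have [cf cf1 cf2 df df1 pf pf1] := jf; have [cg cg1 cg2 dg dg1 pg pg1] := jg.
pose ftt t x := - j2 g t x + cubic f g t x * j0 g t x.
pose gtt t x := j2 f t x - cubic f g t x * j0 f t x.
have ft (r x : R) : 0 < r -> is_derive r 1 (j0 f ^~ x) (ftt r x) by exact: ft0.
have gt (r x : R) : 0 < r -> is_derive r 1 (j0 g ^~ x) (gtt r x) by exact: gt0.
pose sq t x := j0 f t x ^+ 2 + j0 g t x ^+ 2.
pose V s x := cos (2 * x) * sq s x ^+ 2.
pose K s x := (- (slope (j0 f) ftt t s x * (j2 f s x + j2 f t x)) -
               slope (j0 g) gtt t s x * (j2 g s x + j2 g t x)) +
   cos (2 * x) * (slope (j0 f) ftt t s x * (j0 f s x + j0 f t x) +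
              slope (j0 g) gtt t s x * (j0 g s x + j0 g t x)) * (sq s x + sq t x).
have cx := uncurried_x.
have cft : continuous (uncurried ftt) by rewrite /ftt /cubic; cont.
have cgt : continuous (uncurried gtt) by rewrite /gtt /cubic; cont.
have c1 := cx _ cf; have c2 := cx _ cg.
have c3 := cx _ cf1; have c4 := cx _ cg1.
have c5 := cx _ cf2; have c6 := cx _ cg2.
have ck s : continuous (K s).
  have h1 : continuous (slope (j0 f) ftt t s) by apply: slope_continuous_x; exact: cx.
  have h2 : continuous (slope (j0 g) gtt t s) by apply: slope_continuous_x; exact: cx.
  have c1s := c1 s; have c2s := c2 s; have c1t := c1 t; have c2t := c2 t.
  have c5s := c5 s; have c6s := c6 s; have c5t := c5 t; have c6t := c6 t.
  by rewrite /K /sq; cont.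
have snd_cont (k : R -> R) y : continuous k -> continuous_at (t, y) (fun p : R * R => k p.2).
  move=> kc; apply: (@continuous_comp _ _ _ (fun p : R * R => p.2) k); [exact: cvg_snd|exact: kc].
have ckt y : 0 <= y <= 2pi -> continuous_at (t, y) (uncurried K).
  move=> _; have h1 := slope_continuous ft t0 (cft (t, y)).
  have h2 := slope_continuous gt t0 (cgt (t, y)).
  have h3 := snd_cont _ y (c1 t); have h4 := snd_cont _ y (c2 t).
  have h5 := snd_cont _ y (c5 t); have h6 := snd_cont _ y (c6 t).
  by rewrite /K /sq /=; cont_at.
have K0 : Int 0 2pi (K t) = 0.
  by apply: Int_eq0 => // x _; rewrite /K !slopett /ftt /gtt /cubic /sq; ring.
rewrite -K0; apply: (@caratheodory _ _ (fun s => Int 0 2pi (K s))) => [s|]; last first.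
  exact: Int_cvg_param.
have bf := Int_ibp s t jf; have bg := Int_ibp s t jg.
have c1s := c1 s; have c2s := c2 s; have c1t := c1 t; have c2t := c2 t.
have c3s := c3 s; have c4s := c4 s; have c3t := c3 t; have c4t := c4 t.
have c5s := c5 s; have c6s := c6 s; have c5t := c5 t; have c6t := c6 t.
rewrite /kinetic /potential -Int_D; [|cont|cont].
rewrite -Int_D; [|cont|cont].
rewrite -Int_B; [|cont|cont].
rewrite -[LHS]subr0 -[X in _ - X]addr0 -[in X in _ - (X + _)]bf -[in X in _ - (_ + X)]bg.
rewrite -Int_D; [|cont|cont].
rewrite -Int_B; [|cont|cont].
rewrite -Int_Z//.
apply: Int_ext => x _; rewrite /K /sq.
have := slopeE (j0 f) ftt t s x; have := slopeE (j0 g) gtt t s x.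
set Dg := slope _ _ _ _ _; set Df := slope _ _ _ _ _ => Eg Ef.
transitivity (- ((s - t) * Df * (j2 f s x + j2 f t x)) - (s - t) * Dg * (j2 g s x + j2 g t x) +
   cos (2 * x) * ((s - t) * Df * (j0 f s x + j0 f t x) + (s - t) * Dg * (j0 g s x + j0 g t x))
    * (j0 f s x ^+ 2 + j0 g s x ^+ 2 + (j0 f t x ^+ 2 + j0 g t x ^+ 2))); last by ring.
by rewrite -Ef -Eg; ring.
Qed.

Lemma constant_from_0 (F : R -> R) : continuous F ->
  (forall t : R, 0 < t -> is_derive t 1 F 0) -> forall t, 0 <= t -> F t = F 0.
Proof.
move=> cF dF t t0.
have [||c _] := @MVT_segment R F (fun=> 0) 0 t t0.
- by move=> x; rewrite in_itv/= => /andP[/dF].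
- exact: continuous_subspaceT.
by move=> /eqP; rewrite mul0r subr_eq0 => /eqP.
Qed.

Lemma mass_conserved f g (t : R) : wave f g -> 0 <= t -> mass f g t = mass f g 0.
Proof.
move=> w; have [[cf _ _ _ _ _ _] [cg _ _ _ _ _ _] _ _ _ _] := w.
move: t; apply: constant_from_0.
  by apply: (@Int_continuous_t (fun s x => j0 f s x ^+ 2 + j0 g s x ^+ 2)); cont.
move=> t t0; have := evolution_L2 w t0.
have -> : Int 0 2pi (fun x => j0 f t x * (cubic f g t x * j0 g t x)
                        + j0 g t x * - (cubic f g t x * j0 f t x)) = 0.
  by apply: Int_eq0 => // x _; ring.
by rewrite mulr0.
Qed.

Lemma energy_conserved f g (t : R) : wave f g -> 0 <= t ->
  kinetic f g t + potential f g t = kinetic f g 0 + potential f g 0.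
Proof.
move=> w; have [[cf cf1 _ _ _ _ _] [cg cg1 _ _ _ _ _] _ _ _ _] := w.
move: t; apply: constant_from_0; last by move=> t; exact: energy_law.
have h1 : continuous (kinetic f g).
  by apply: (@Int_continuous_t (fun s x => j1 f s x ^+ 2 + j1 g s x ^+ 2)); cont.
have h2 : continuous (potential f g).
  apply: (@Int_continuous_t (fun s x => cos (2 * x) * (j0 f s x ^+ 2 + j0 g s x ^+ 2) ^+ 2)).
  by cont.
by cont.
Qed.

End Evolution.

(** * A priori bounds and stability *)

Section Apriori.
Variable R : realType.
Local Notation "2pi" := (2 * @pi R).
Local Notation uncurried k := (fun p : R * R => k p.1 p.2).
Implicit Types (t x y s : R).
Hint Resolve pi2_ge0 : core.

Lemma Int_sub_le a b c e (h : R -> R) : a <= b -> b <= c -> c <= e ->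
  continuous h -> (forall x, 0 <= h x) -> Int b c h <= Int a e h.
Proof.
move=> ab bc ce ch h0.
rewrite (@Int_cat _ a b e)// ?ab ?(le_trans bc)// (@Int_cat _ b c e)// ?bc//.
have : 0 <= Int a b h by exact: Int_ge0.
have : 0 <= Int c e h by exact: Int_ge0.
lra.
Qed.

(** The increments of [f^2 + g^2] are bounded by
[int 2 (|f f'| + |g g'|)], to which Young's inequality with weight [l] applies;
average over the starting point of the increment. *)
Lemma sup_interpolation (f g f1 g1 : R -> R) (l : R) : 0 < l ->
  (forall x, is_derive x 1 f (f1 x)) -> (forall x, is_derive x 1 g (g1 x)) ->
  continuous f1 -> continuous g1 ->
  forall x, 0 <= x <= 2pi -> f x ^+ 2 + g x ^+ 2 <=
    (1 + l) * Int 0 2pi (fun x => f x ^+ 2 + g x ^+ 2)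
    + l^-1 * Int 0 2pi (fun x => f1 x ^+ 2 + g1 x ^+ 2).
Proof.
move=> l0 df dg cf1 cg1 x /andP[x0 x2].
have cf : continuous f by move=> y; exact: der_continuous.
have cg : continuous g by move=> y; exact: der_continuous.
pose phi y := f y ^+ 2 + g y ^+ 2.
pose dphi y := 2 * (f y * f1 y + g y * g1 y).
pose psi y := l * (f y ^+ 2 + g y ^+ 2) + l^-1 * (f1 y ^+ 2 + g1 y ^+ 2).
have dphiE y : is_derive y 1 phi (dphi y) by rewrite /phi; der; rewrite /dphi; ring.
have cphi : continuous phi by rewrite /phi; cont.
have cdphi : continuous dphi by rewrite /dphi; cont.
have cpsi : continuous psi by rewrite /psi; cont.
have li0 : 0 < l^-1 by rewrite invr_gt0.
have young a b : 2 * (a * b) <= l * a ^+ 2 + l^-1 * b ^+ 2.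
  rewrite -subr_ge0; rewrite (_ : _ - _ = l * (a - l^-1 * b) ^+ 2).
    by rewrite mulr_ge0// ?sqr_ge0// ltW.
  by field; rewrite gt_eqF.
have psi0 y : 0 <= psi y by rewrite addr_ge0// mulr_ge0// ?addr_ge0// ?sqr_ge0// ltW.
have le1 y : dphi y <= psi y.
  by have := young (f y) (f1 y); have := young (g y) (g1 y); rewrite /dphi /psi; lra.
have le2 y : - psi y <= dphi y.
  have := young (f y) (- f1 y); have := young (g y) (- g1 y); rewrite /dphi /psi !sqrrN !mulrN; lra.
set Psi := Int 0 2pi psi.
have step y : 0 <= y <= 2pi -> phi x <= phi y + Psi.
  move=> /andP[y0 y2]; case: (leP y x) => [yx|/ltW xy].
    have E : Int y x dphi = phi x - phi y by apply: FTC2_eq => //.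
    have : Int y x dphi <= Int y x psi by apply: Int_le.
    have : Int y x psi <= Psi by exact: Int_sub_le.
    rewrite E; lra.
  have E : Int x y dphi = phi y - phi x by apply: FTC2_eq => //.
  have : Int x y (fun y => -1 * psi y) <= Int x y dphi.
    by apply: Int_le => //; [cont|move=> z _; rewrite mulN1r].
  have : Int x y psi <= Psi by exact: Int_sub_le.
  rewrite E Int_Z//; lra.
have tot : phi x * (2pi - 0) <= Int 0 2pi phi + Psi * (2pi - 0).
  rewrite -(Int_cst (phi x) (pi2_ge0 R)) -(Int_cst Psi (pi2_ge0 R)).
  rewrite -Int_D//; last cont.
  by apply: Int_le => //; cont.
have A0 : 0 <= Int 0 2pi phi by apply: Int_ge0 => y _; rewrite addr_ge0// sqr_ge0.
have p2 := @pi_ge2 R.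
have PsiE : Psi = l * Int 0 2pi phi + l^-1 * Int 0 2pi (fun x => f1 x ^+ 2 + g1 x ^+ 2).
  by rewrite -!Int_Z//; [rewrite -Int_D//; cont|cont].
have : phi x <= Int 0 2pi phi + Psi.
  rewrite subr0 in tot; nra.
rewrite PsiE /phi; lra.
Qed.

Lemma jet_bound f g t x l : is_jet f -> is_jet g -> 0 < l -> 0 <= x <= 2pi ->
  j0 f t x ^+ 2 + j0 g t x ^+ 2 <= (1 + l) * mass f g t + l^-1 * kinetic f g t.
Proof.
move=> [cf cf1 _ df _ _ _] [cg cg1 _ dg _ _ _] l0 x02.
by apply: (sup_interpolation l0) => //; exact: uncurried_x.
Qed.

Lemma mass_ge0 f g t : 0 <= mass f g t.
Proof. by apply: Int_ge0 => x _; rewrite addr_ge0// sqr_ge0. Qed.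

Lemma kinetic_ge0 f g t : 0 <= kinetic f g t.
Proof. by apply: Int_ge0 => x _; rewrite addr_ge0// sqr_ge0. Qed.

Lemma potential_le f g t q : is_jet f -> is_jet g ->
  (forall x, 0 <= x <= 2pi -> j0 f t x ^+ 2 + j0 g t x ^+ 2 <= q) ->
  `|potential f g t| <= q * mass f g t.
Proof.
move=> [cf _ _ _ _ _ _] [cg _ _ _ _ _ _] uq.
have cft := @uncurried_x _ _ cf t; have cgt := @uncurried_x _ _ cg t.
pose s x := j0 f t x ^+ 2 + j0 g t x ^+ 2.
have s0 x : 0 <= s x by rewrite addr_ge0// sqr_ge0.
have cs : continuous s by rewrite /s; cont.
have sq x : 0 <= x <= 2pi -> s x ^+ 2 <= q * s x.
  by move=> /uq h; rewrite expr2 ler_wpM2r.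
have cc x : - 1 <= cos (2 * x) <= 1 by rewrite cos_geN1 cos_le1.
rewrite /potential /mass ler_norml -!mulNr -!Int_Z//.
apply/andP; split; apply: Int_le => //.
- by cont.
- by cont.
- move=> x /sq; have := sqr_ge0 (s x); have := cc x; rewrite -/(s x); nra.
- by cont.
- by cont.
- move=> x /sq; have := sqr_ge0 (s x); have := cc x; rewrite -/(s x); nra.
Qed.

(** The nonlinearity is subcritical: the potential is at most the mass times
the squared supremum, so by interpolation half of the kinetic energy absorbs
its kinetic part. *)
Lemma kinetic_bound f g t : wave f g -> 0 <= t ->
  kinetic f g t <= 2 * (kinetic f g 0 + potential f g 0)
                   + 4 * (1 + mass f g 0) * mass f g 0 ^+ 2.
Proof.
move=> w t0; set m := mass f g 0; have [jf jg _ _ _ _] := w.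
have m0 : 0 <= m := mass_ge0 _ _ _.
(* with this weight the kinetic part of the bound on [V] is at most half of [k] *)
have l0 : 0 < 2 * m + 1 by lra.
have := @potential_le f g t _ jf jg (fun x => @jet_bound f g t x _ jf jg l0).
have := energy_conserved w t0; rewrite (mass_conserved w t0) -/m.
have := kinetic_ge0 f g t; set k := kinetic f g t; set V := potential f g t.
move=> k0 <-; rewrite mulrDl ler_norml => /andP[h _].
have : (2 * m + 1)^-1 * k * m <= k / 2.
  rewrite mulrAC mulrC ler_wpM2l// mulrC ler_pdivrMr//; lra.
nra.
Qed.

Lemma wave_bound f g t x : wave f g -> 0 <= t -> 0 <= x <= 2pi ->
  j0 f t x ^+ 2 + j0 g t x ^+ 2 <= 2 * mass f g 0 + kinetic f g t.
Proof.
move=> w t0 x02; have [jf jg _ _ _ _] := w.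
have := @jet_bound f g t x 1 jf jg ltr01 x02; rewrite (mass_conserved w t0) invr1; lra.
Qed.

Definition jet_sub (f g : jet R) := Jet (fun t x => j0 f t x - j0 g t x)
  (fun t x => j1 f t x - j1 g t x) (fun t x => j2 f t x - j2 g t x).

Lemma is_jet_sub f g : is_jet f -> is_jet g -> is_jet (jet_sub f g).
Proof.
move=> [cf cf1 cf2 df df1 pf pf1] [cg cg1 cg2 dg dg1 pg pg1]; split => /=.
- by cont.
- by cont.
- by cont.
- by move=> t x; exact: der_add (df t x) (der_opp (dg t x)).
- by move=> t x; exact: der_add (df1 t x) (der_opp (dg1 t x)).
- by move=> t x; rewrite pf pg.
- by move=> t x; rewrite pf1 pg1.
Qed.

Lemma evolution_sub f g f' g' A A' B B' : evolution f g A B -> evolution f' g' A' B' ->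
  evolution (jet_sub f f') (jet_sub g g') (fun t x => A t x - A' t x) (fun t x => B t x - B' t x).
Proof.
move=> [jf jg cA cB df dg] [jf' jg' cA' cB' df' dg']; split.
- exact: is_jet_sub.
- exact: is_jet_sub.
- by cont.
- by cont.
- move=> t x t0; refine (der_eq (der_add (df t x t0) (der_opp (df' t x t0))) _) => /=; ring.
- move=> t x t0; refine (der_eq (der_add (dg t x t0) (der_opp (dg' t x t0))) _) => /=; ring.
Qed.

(** [expR (- c * s) * N s] is nonincreasing. *)
Lemma gronwall (N N' : R -> R) (c t : R) : continuous N -> 0 <= t ->
  (forall s : R, 0 < s -> is_derive s 1 N (N' s)) ->
  (forall s, 0 < s < t -> N' s <= c * N s) -> N t <= expR (c * t) * N 0.
Proof.
move=> cN t0 dN hN.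
pose G s := expR (- c * s) * N s.
have dexp (s : R) : is_derive s 1 (fun s => expR (- c * s)) (expR (- c * s) * - c).
  exact: (der_comp (is_derive_expR (- c * s)) (der_mull s (- c))).
have dG (s : R) : 0 < s -> is_derive s 1 G (expR (- c * s) * N' s + N s * (expR (- c * s) * - c)).
  by move=> s0; exact: der_mul (dexp s) (dN s s0).
have cG : continuous G.
  have ce : continuous (fun s => expR (- c * s)) by move=> s; exact: der_continuous (dexp s).
  by rewrite /G; cont.
have GG : G t <= G 0.
  apply: (@ler0_derive1_nincr _ G 0 t) => //.
  - by move=> s; rewrite in_itv/= => /andP[s0 _]; case: (dG s s0).
  - move=> s; rewrite in_itv/= => /andP[s0 st].
    rewrite derive1E; have [_ ->] := dG s s0.
    have := hN s; rewrite s0 st => /(_ isT) h.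
    have := expR_ge0 (- c * s); nra.
  - exact: continuous_subspaceT.
move: GG; rewrite /G mulr0 expR0 mul1r => GG.
rewrite -[N t]mul1r -(@expRxMexpNx_1 _ (c * t)) -mulrA ler_wpM2l ?expR_ge0//.
by rewrite -mulNr.
Qed.

(** With [F = f1 - f2], [G = g1 - g2] and [n_i = cubic f_i g_i], the source term
reduces to [(n_1 - n_2) (F g2 - G f2)], since [n_1 F G] cancels.  Each factor is
at most a multiple of [sqrt (F^2 + G^2)], which leaves a linear differential
inequality. *)
Lemma L2_stability f1 g1 f2 g2 q t : wave f1 g1 -> wave f2 g2 -> 0 <= t ->
  (forall s x, 0 <= s -> 0 <= x <= 2pi -> j0 f1 s x ^+ 2 + j0 g1 s x ^+ 2 <= q) ->
  (forall s x, 0 <= s -> 0 <= x <= 2pi -> j0 f2 s x ^+ 2 + j0 g2 s x ^+ 2 <= q) ->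
  mass (jet_sub f1 f2) (jet_sub g1 g2) t <=
  expR (8 * q * t) * mass (jet_sub f1 f2) (jet_sub g1 g2) 0.
Proof.
move=> w1 w2 t0 u1q u2q; have w := evolution_sub w1 w2.
have [jF jG cA cB _ _] := w; have [cF _ _ _ _ _ _] := jF; have [cG _ _ _ _ _ _] := jG.
apply: (@gronwall (mass _ _)) => //.
- apply: (@Int_continuous_t _ (fun t x => j0 (jet_sub f1 f2) t x ^+ 2 + j0 (jet_sub g1 g2) t x ^+ 2)).
  by move=> p; cont_at.
- by move=> s s0; exact: evolution_L2 w s0.
move=> s /andP[s0 _].
pose A s x := cubic f1 g1 s x * j0 g1 s x - cubic f2 g2 s x * j0 g2 s x.
pose B s x := - (cubic f1 g1 s x * j0 f1 s x) - - (cubic f2 g2 s x * j0 f2 s x).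
have cFs := @uncurried_x _ _ cF s; have cGs := @uncurried_x _ _ cG s.
have cAs := @uncurried_x _ A cA s; have cBs := @uncurried_x _ B cB s.
rewrite -/(A _ _) -/(B _ _) /mass.
rewrite -Int_Z; last by change (continuous (fun x => j0 (jet_sub f1 f2) s x * A s x + j0 (jet_sub g1 g2) s x * B s x)); move=> p; cont_at.
rewrite -Int_Z; last by move=> p; cont_at.
apply: Int_le.
- by change (continuous (fun x => 2 * (j0 (jet_sub f1 f2) s x * A s x + j0 (jet_sub g1 g2) s x * B s x))); move=> p; cont_at.
- by move=> p; cont_at.
- rewrite /=.
  move=> x x02; have := u1q s x (ltW s0) x02; have := u2q s x (ltW s0) x02.
  rewrite /cubic; set a1 := j0 f1 s x; set b1 := j0 g1 s x; set a2 := j0 f2 s x; set b2 := j0 g2 s x.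
  have cc : -1 <= cos (2 * x) <= 1 by rewrite cos_geN1 cos_le1.
  set c := cos (2 * x) in cc *.
  move=> h2 h1.
  set X := (a1 - a2) * (a1 + a2) + (b1 - b2) * (b1 + b2).
  set Y := (a1 - a2) * b2 - (b1 - b2) * a2.
  rewrite (_ : 2 * _ = 4 * (c * (X * Y))); last by rewrite /X /Y; ring.
  set d := (a1 - a2) ^+ 2 + (b1 - b2) ^+ 2.
  have d0 : 0 <= d by rewrite addr_ge0// sqr_ge0.
  have hX : X ^+ 2 <= 4 * q * d.
    have -> : X ^+ 2 = d * (2 * (a1 ^+ 2 + b1 ^+ 2) + 2 * (a2 ^+ 2 + b2 ^+ 2)) - d ^+ 2
      - ((a1 - a2) * (b1 + b2) - (b1 - b2) * (a1 + a2)) ^+ 2 by rewrite /X /d; ring.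
    have := sqr_ge0 d; have := sqr_ge0 ((a1 - a2) * (b1 + b2) - (b1 - b2) * (a1 + a2)).
    have : 0 <= d * (2 * (2 * q - (a1 ^+ 2 + b1 ^+ 2) - (a2 ^+ 2 + b2 ^+ 2))).
      by rewrite mulr_ge0//; lra.
    lra.
  have hY : Y ^+ 2 <= q * d.
    have -> : Y ^+ 2 = d * (a2 ^+ 2 + b2 ^+ 2) - ((a1 - a2) * a2 + (b1 - b2) * b2) ^+ 2.
      by rewrite /Y /d; ring.
    have := sqr_ge0 ((a1 - a2) * a2 + (b1 - b2) * b2).
    have : 0 <= d * (q - (a2 ^+ 2 + b2 ^+ 2)) by rewrite mulr_ge0//; lra.
    lra.
  have hXY : `|X * Y| <= 2 * q * d.
    rewrite ler_norml; have := sqr_ge0 (X - 2 * Y); have := sqr_ge0 (X + 2 * Y).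
    have -> : (X - 2 * Y) ^+ 2 = X ^+ 2 - 4 * (X * Y) + 4 * Y ^+ 2 by ring.
    have -> : (X + 2 * Y) ^+ 2 = X ^+ 2 + 4 * (X * Y) + 4 * Y ^+ 2 by ring.
    move: (X ^+ 2) (Y ^+ 2) (X * Y) hX hY => XX YY XY; lra.
  have : `|c * (X * Y)| <= 2 * q * d.
    rewrite normrM (le_trans _ hXY)// ler_piMl// ler_norml cc//.
  rewrite ler_norml => /andP[_]; rewrite -/d; move: (c * (X * Y)) (d) => z e; lra.
Qed.

End Apriori.

(** * A quantitative Wirtinger inequality *)

Section PiBound.
Variable R : realType.
Implicit Types (x y : R).

Lemma ge0_of_derive (F f : R -> R) x : 0 <= x -> F 0 = 0 -> continuous f ->
  (forall y, is_derive y 1 F (f y)) -> (forall y, 0 <= y -> 0 <= f y) -> 0 <= F x.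
Proof.
move=> x0 F0 cf dF f0.
have <- : Int 0 x f = F x by apply: (FTC2_eq _ cf dF) => //; rewrite F0 subr0.
by apply: Int_ge0 => y /andP[y0 _]; exact: f0.
Qed.

(** Integrate [cos <= 1] four times. *)
Lemma cos_le_taylor x : 0 <= x -> cos x <= 1 - x ^+ 2 / 2 + x ^+ 4 / 24.
Proof.
move=> x0; rewrite -subr_ge0.
have s1 y : 0 <= y -> 0 <= y - sin y.
  move=> y0; have d (z : R) : is_derive z 1 (fun y => y - sin y) (1 - cos z) by der; field.
  have c : continuous (fun y : R => 1 - cos y) by cont.
  by apply: (ge0_of_derive y0 _ c d) => [|z z0]; [rewrite sin0; ring|rewrite subr_ge0 cos_le1].
have c1 y : 0 <= y -> 0 <= cos y - 1 + y ^+ 2 / 2.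
  move=> y0; have d (z : R) : is_derive z 1 (fun y => cos y - 1 + y ^+ 2 / 2) (z - sin z) by der; field.
  have c : continuous (fun y : R => y - sin y) by cont.
  by apply: (ge0_of_derive y0 _ c d) => [|z z0]; [rewrite cos0; ring|exact: s1].
have s2 y : 0 <= y -> 0 <= sin y - y + y ^+ 3 / 6.
  move=> y0; have d (z : R) : is_derive z 1 (fun y => sin y - y + y ^+ 3 / 6) (cos z - 1 + z ^+ 2 / 2) by der; field.
  have c : continuous (fun y : R => cos y - 1 + y ^+ 2 / 2) by cont.
  by apply: (ge0_of_derive y0 _ c d) => [|z z0]; [rewrite sin0; ring|exact: c1].
have d (z : R) : is_derive z 1 (fun y => 1 - y ^+ 2 / 2 + y ^+ 4 / 24 - cos y) (sin z - z + z ^+ 3 / 6) by der; field.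
  have c : continuous (fun y : R => sin y - y + y ^+ 3 / 6) by cont.
  by apply: (ge0_of_derive x0 _ c d) => [|z z0]; [rewrite cos0; ring|exact: s2].
Qed.

(** [cos (8 / 5) < 0] by the Taylor bound.  Some numerical bound on [pi] of this
kind is what makes the constant in the Wirtinger inequality below effective. *)
Lemma pi_le : @pi R <= 16 / 5.
Proof.
rewrite leNgt; apply/negP => h.
have : 0 < cos (8 / 5 : R) by apply: cos_gt0_pihalf; apply/andP; split; lra.
have := @cos_le_taylor (8 / 5) ltac:(lra); lra.
Qed.

End PiBound.

Section Wirtinger.
Variable R : realType.
Local Notation "2pi" := (2 * @pi R).
Implicit Types (x y : R) (f h v : R -> R).

Lemma der_unique x f (a b : R) : is_derive x 1 f a -> is_derive x 1 f b -> a = b.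
Proof. by case=> _ <- [_ <-]. Qed.

Lemma cos_pi_shift x : cos (x + pi) = - cos x.
Proof. exact: cosDpi. Qed.

Lemma sin_pi_shift x : sin (x + pi) = - sin x.
Proof. exact: sinDpi. Qed.

Lemma cos_pi2 : cos 2pi = 1. Proof. by rewrite mulrC mulr_natr cos2pi. Qed.
Lemma sin_pi2 : sin 2pi = 0. Proof. by rewrite mulrC mulr_natr sin2pi. Qed.

Lemma Int_cos2 : Int 0 2pi (fun x => cos x ^+ 2) = pi.
Proof.
have d x : is_derive x 1 (fun x => (x + sin x * cos x) / 2) (cos x ^+ 2) by der; have := cos2Dsin2 x; lra.
have c : continuous (fun x : R => cos x ^+ 2) by cont.
by apply: (FTC2_eq (pi2_ge0 R) c d); rewrite sin_pi2 sin0; field.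
Qed.

Lemma Int_sin2 : Int 0 2pi (fun x => sin x ^+ 2) = pi.
Proof.
have d x : is_derive x 1 (fun x => (x - sin x * cos x) / 2) (sin x ^+ 2) by der; have := cos2Dsin2 x; lra.
have c : continuous (fun x : R => sin x ^+ 2) by cont.
by apply: (FTC2_eq (pi2_ge0 R) c d); rewrite sin_pi2 sin0; field.
Qed.

Lemma Int_sincos : Int 0 2pi (fun x => sin x * cos x) = 0.
Proof.
have d x : is_derive x 1 (fun x => sin x ^+ 2 / 2) (sin x * cos x) by der; field.
have c : continuous (fun x : R => sin x * cos x) by cont.
by apply: (FTC2_eq (pi2_ge0 R) c d); rewrite sin_pi2 sin0; field.
Qed.

(** Used for products of two antiperiodic functions. *)
Lemma Int_half_period h : continuous h -> (forall x, h (x + pi) = h x) ->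
  forall x, 0 <= x -> Int x (x + pi) h = Int 0 2pi h / 2.
Proof.
have p0 := @pi_ge0 R.
move=> ch hp x x0; rewrite Int_periodic//.
rewrite (@Int_cat _ 0 pi 2pi)//; last by apply/andP; split; lra.
rewrite (_ : 2pi = pi + pi); last by ring.
by rewrite (@Int_periodic _ pi)//; field.
Qed.

Definition coef_cos f := pi^-1 * Int 0 2pi (fun x => f x * cos x).
Definition coef_sin f := pi^-1 * Int 0 2pi (fun x => f x * sin x).
Definition remainder f x := f x - (coef_cos f * cos x + coef_sin f * sin x).

Lemma Int_lin3 (a b c : R) f g h : continuous f -> continuous g -> continuous h ->
  Int 0 2pi (fun x => a * f x + b * g x + c * h x) =
  a * Int 0 2pi f + b * Int 0 2pi g + c * Int 0 2pi h.
Proof. by move=> cf cg ch; rewrite Int_D ?Int_D ?Int_Z//; cont. Qed.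

Lemma coef_cosK f : Int 0 2pi (fun x => f x * cos x) = pi * coef_cos f.
Proof. by rewrite mulrA divff ?mul1r// gt_eqF// pi_gt0. Qed.

Lemma coef_sinK f : Int 0 2pi (fun x => f x * sin x) = pi * coef_sin f.
Proof. by rewrite mulrA divff ?mul1r// gt_eqF// pi_gt0. Qed.

Lemma remainder_cos f : continuous f -> Int 0 2pi (fun x => remainder f x * cos x) = 0.
Proof.
move=> cf; rewrite (_ : (fun x => _) = (fun x => 1 * (f x * cos x) + - coef_cos f * cos x ^+ 2
   + - coef_sin f * (sin x * cos x))).
  rewrite Int_lin3; [|cont|cont|cont].
  by rewrite Int_cos2 Int_sincos coef_cosK; ring.
by apply: funext => x; rewrite /remainder; ring.
Qed.

Lemma remainder_sin f : continuous f -> Int 0 2pi (fun x => remainder f x * sin x) = 0.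
Proof.
move=> cf; rewrite (_ : (fun x => _) = (fun x => 1 * (f x * sin x) + - coef_cos f * (sin x * cos x)
   + - coef_sin f * sin x ^+ 2)).
  rewrite Int_lin3; [|cont|cont|cont].
  by rewrite Int_sin2 Int_sincos coef_sinK; ring.
by apply: funext => x; rewrite /remainder; ring.
Qed.

Lemma bessel f : continuous f ->
  pi * (coef_cos f ^+ 2 + coef_sin f ^+ 2) <= Int 0 2pi (fun x => f x ^+ 2).
Proof.
move=> cf; have cr : continuous (remainder f) by rewrite /remainder; cont.
have : 0 <= Int 0 2pi (fun x => remainder f x ^+ 2) by apply: Int_ge0 => x _; exact: sqr_ge0.
have -> : Int 0 2pi (fun x => remainder f x ^+ 2) = Int 0 2pi (fun x => 1 * f x ^+ 2 +
   - coef_cos f * (f x * cos x) + - coef_sin f * (f x * sin x))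
   - Int 0 2pi (fun x => coef_cos f * (remainder f x * cos x) + coef_sin f * (remainder f x * sin x) + 0 * 0).
  rewrite -Int_B; [|cont|cont].
  by apply: Int_ext => x _; rewrite /remainder; ring.
rewrite !Int_lin3; try by cont.
rewrite remainder_cos// remainder_sin// coef_cosK coef_sinK.
move: (Int _ _ _) => I; lra.
Qed.

Variables (f f1 : R -> R).
Hypothesis df : forall x, is_derive x 1 f (f1 x).
Hypothesis cf1 : continuous f1.
Hypothesis fpi : forall x, f (x + pi) = - f x.

Let p := coef_cos f.
Let q := coef_sin f.
Let v := remainder f.
Let v1 x := f1 x - (- p * sin x + q * cos x).
Let D := Int 0 2pi (fun x => f1 x ^+ 2) - Int 0 2pi (fun x => f x ^+ 2).

Let cf : continuous f. Proof. by move=> x; exact: der_continuous. Qed.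
Let cv : continuous v. Proof. by rewrite /v /remainder; cont. Qed.
Let cv1 : continuous v1. Proof. by rewrite /v1; cont. Qed.

Let dv x : is_derive x 1 v (v1 x).
Proof. by rewrite /v /remainder; der; rewrite /v1 -/p -/q; ring. Qed.

Let vpi x : v (x + pi) = - v x.
Proof. by rewrite /v /remainder fpi cos_pi_shift sin_pi_shift; ring. Qed.

Let v1pi x : v1 (x + pi) = - v1 x.
Proof.
have d1 : is_derive x 1 (fun y => v (y + pi)) (v1 (x + pi)) by exact: der_shift.
have d2 : is_derive x 1 (fun y => v (y + pi)) (- v1 x).
  by rewrite (_ : (fun y => _) = (fun y => - v y)); [exact: der_opp|apply: funext => y].
exact: der_unique d1 d2.
Qed.

(** The defect [D] does not see the projection [w] on [cos] and [sin]: the cross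
terms are the derivative of [2 w' v + w w']. *)
Let DE : D = Int 0 2pi (fun x => v1 x ^+ 2) - Int 0 2pi (fun x => v x ^+ 2).
Proof.
pose w x := p * cos x + q * sin x; pose w1 x := - p * sin x + q * cos x.
have w0 : Int 0 2pi (fun x => 2 * (w1 x * v1 x - w x * v x) + (w1 x ^+ 2 - w x ^+ 2)) = 0.
  have d x : is_derive x 1 (fun x => 2 * (w1 x * v x) + w x * w1 x)
      (2 * (w1 x * v1 x - w x * v x) + (w1 x ^+ 2 - w x ^+ 2)) by rewrite /w /w1; der; ring.
  apply: (FTC2_eq (pi2_ge0 R) _ d).
  - by rewrite /w /w1; cont.
  - have -> : v 2pi = v 0.
      by rewrite (_ : 2pi = 0 + pi + pi) ?vpi ?opprK//; ring.
    by rewrite /w /w1 cos_pi2 sin_pi2 cos0 sin0; ring.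
rewrite /D -!Int_B; try by cont.
rewrite -[RHS]addr0 -[X in _ = _ + X]w0 -Int_D; [|cont|by rewrite /w /w1; cont].
by apply: Int_ext => x _; rewrite /v1 /v /remainder -/p -/q -/(w x) -/(w1 x); ring.
Qed.

(** Kernel that recovers [v x] from [v1] on [[x, x + pi]].  Any multiple of
[sin (y - x)] may be subtracted from the constant kernel because [v1] is
orthogonal to it; the coefficient [5 / 4] nearly minimises the [L^2] norm, the
minimiser being [4 / pi]. *)
Let kernel x y : R := 1 - 5 / 4 * sin (y - x).

(** [v (x + pi) = - v x], so [- 2 v x] is the integral of [v1]; orthogonality of
[v] to [cos] and [sin] removes the other term. *)
Let v_kernel x : 0 <= x -> - 2 * v x = Int x (x + pi) (fun y => v1 y * kernel x y).
Proof.
move=> x0.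
have xp : x <= x + pi by rewrite lerDl pi_ge0.
have E1 : Int x (x + pi) v1 = - 2 * v x.
  by apply: (FTC2_eq _ cv1 dv) => //; rewrite vpi; ring.
have E2 : Int x (x + pi) (fun y => v1 y * sin (y - x) + v y * cos (y - x)) = 0.
  have d y : is_derive y 1 (fun y => v y * sin (y - x)) (v1 y * sin (y - x) + v y * cos (y - x)).
    by der; ring.
  apply: (FTC2_eq xp _ d).
  - by cont.
  - by rewrite subrr sin0 addrAC subrr add0r sinpi; ring.
have E3 : Int x (x + pi) (fun y => v y * cos (y - x)) = 0.
  rewrite Int_half_period//; last 2 first.
  - by cont.
  - by move=> y; rewrite vpi addrAC cos_pi_shift; ring.
  rewrite (_ : (fun y => _) = (fun y => cos x * (v y * cos y) + sin x * (v y * sin y) + 0 * 0)).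
    rewrite Int_lin3; [|cont|cont|cont].
    by rewrite remainder_cos// remainder_sin//; ring.
  by apply: funext => y; rewrite cosB; ring.
transitivity (Int x (x + pi) v1 - 5 / 4 * (Int x (x + pi) (fun y => v1 y * sin (y - x)
  + v y * cos (y - x)) - Int x (x + pi) (fun y => v y * cos (y - x)))).
  by rewrite E1 E2 E3; ring.
rewrite -Int_B; [|cont|cont].
rewrite -Int_Z; last cont.
rewrite -Int_B; [|cont|cont].
by apply: Int_ext => y _; rewrite /kernel; ring.
Qed.

Let kernel_L2 x : Int x (x + pi) (fun y => kernel x y ^+ 2) = 57 / 32 * pi - 5.
Proof.
have xp : x <= x + pi by rewrite lerDl pi_ge0.
have d y : is_derive y 1
    (fun y => y + 5 / 2 * cos (y - x) + 25 / 32 * (y - sin (y - x) * cos (y - x)))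
    (kernel x y ^+ 2).
  der; rewrite /kernel; have := cos2Dsin2 (y - x); set c := cos _; set s := sin _ => h.
  lra.
apply: (FTC2_eq xp _ d).
- by rewrite /kernel; cont.
- have -> : x + pi - x = pi by ring.
  by rewrite subrr sin0 cos0 sinpi cospi; field.
Qed.

(** Cauchy-Schwarz with the kernel, whose squared norm is at most [7 / 10]. *)
Let v_sup x : 0 <= x -> v x ^+ 2 <= 7 / 80 * Int 0 2pi (fun y => v1 y ^+ 2).
Proof.
move=> x0; have ck : continuous (kernel x) by rewrite /kernel; cont.
have := Int_CS x (x + pi) cv1 ck; rewrite -v_kernel// kernel_L2.
rewrite Int_half_period//; last 2 first.
- by cont.
- by move=> y; rewrite v1pi sqrrN.
have I0 : 0 <= Int 0 2pi (fun y => v1 y ^+ 2) by apply: Int_ge0 => y _; exact: sqr_ge0.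
have := @pi_le R; have -> : (- 2 * v x) ^+ 2 = 4 * v x ^+ 2 by ring.
move: (Int _ _ _) I0 (v x ^+ 2) => I I0 z; nra.
Qed.

(** Integrating [v_sup] gives [int v^2 <= 14 / 25 * int v1^2], so [D] is at least
[11 / 25 * int v1^2], which by [v_sup] again dominates [v x ^+ 2]. *)
Lemma wirtinger x : 0 <= x -> remainder f x ^+ 2 <=
  Int 0 2pi (fun x => f1 x ^+ 2) - Int 0 2pi (fun x => f x ^+ 2).
Proof.
move=> x0; rewrite -/D DE -/v.
set I := Int 0 2pi (fun x => v1 x ^+ 2).
have I0 : 0 <= I by apply: Int_ge0 => y _; exact: sqr_ge0.
have : Int 0 2pi (fun x => v x ^+ 2) <= Int 0 2pi (fun=> 7 / 80 * I).
  apply: Int_le; [cont|cont|].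
  by move=> y /andP[y0 _]; exact: v_sup.
rewrite (Int_cst _ (pi2_ge0 R)) subr0.
have := v_sup x0; rewrite -/I; have := @pi_le R.
nra.
Qed.

End Wirtinger.

(** * Solutions issued from the first harmonics *)

Section TrigWaves.
Variable R : realType.
Local Notation "2pi" := (2 * @pi R).
Local Notation uncurried k := (fun p : R * R => k p.1 p.2).
Implicit Types (t x y s : R) (f g : jet R).

Lemma kinetic_sub_le f1 g1 f2 g2 t :
  is_jet f1 -> is_jet g1 -> is_jet f2 -> is_jet g2 ->
  kinetic (jet_sub f1 f2) (jet_sub g1 g2) t <= 2 * (kinetic f1 g1 t + kinetic f2 g2 t).
Proof.
move=> [_ c1 _ _ _ _ _] [_ c2 _ _ _ _ _] [_ c3 _ _ _ _ _] [_ c4 _ _ _ _ _].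
have d1 := @uncurried_x _ _ c1 t; have d2 := @uncurried_x _ _ c2 t.
have d3 := @uncurried_x _ _ c3 t; have d4 := @uncurried_x _ _ c4 t.
rewrite /kinetic /=.
rewrite -Int_D; [|cont|cont].
rewrite -Int_Z; last cont.
apply: Int_le; [cont|cont|].
move=> x _; have := sqr_ge0 (j1 f1 t x + j1 f2 t x); have := sqr_ge0 (j1 g1 t x + j1 g2 t x).
rewrite !sqrrB !sqrrD; lra.
Qed.

Lemma sup_stability f1 g1 f2 g2 q k t l : wave f1 g1 -> wave f2 g2 -> 0 <= t -> 0 < l ->
  (forall s x, 0 <= s -> 0 <= x <= 2pi -> j0 f1 s x ^+ 2 + j0 g1 s x ^+ 2 <= q) ->
  (forall s x, 0 <= s -> 0 <= x <= 2pi -> j0 f2 s x ^+ 2 + j0 g2 s x ^+ 2 <= q) ->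
  kinetic f1 g1 t <= k -> kinetic f2 g2 t <= k ->
  forall x, 0 <= x <= 2pi -> (j0 f1 t x - j0 f2 t x) ^+ 2 + (j0 g1 t x - j0 g2 t x) ^+ 2 <=
    (1 + l) * (expR (8 * q * t) * mass (jet_sub f1 f2) (jet_sub g1 g2) 0) + l^-1 * (4 * k).
Proof.
move=> w1 w2 t0 l0 b1 b2 k1 k2 x x02.
have [jf1 jg1 _ _ _ _] := w1; have [jf2 jg2 _ _ _ _] := w2.
have := jet_bound t (is_jet_sub jf1 jf2) (is_jet_sub jg1 jg2) l0 x02.
move=> /le_trans; apply; apply: lerD.
  apply: ler_wpM2l; first by rewrite addr_ge0// ltW.
  exact: L2_stability.
apply: ler_wpM2l; first by rewrite invr_ge0 ltW.
have := kinetic_sub_le t jf1 jg1 jf2 jg2; lra.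
Qed.

Definition half_shift f := Jet (fun t x => - j0 f t (x + pi))
  (fun t x => - j1 f t (x + pi)) (fun t x => - j2 f t (x + pi)).

Lemma uncurried_shift (k : R -> R -> R) : continuous (uncurried k) ->
  continuous (fun p : R * R => - k p.1 (p.2 + pi)).
Proof.
move=> ck p; apply: cont_opp.
apply: (@continuous_comp _ _ _ (fun p : R * R => (p.1, p.2 + pi)) (uncurried k)); last exact: ck.
have h1 : z.1 @[z --> p] --> p.1 by case: p => a b; exact: cvg_fst.
have h2 : (z.2 + pi) @[z --> p] --> p.2 + pi by apply: cvgD; [exact: cont_snd|exact: cvg_cst].
exact: (cvg_pair h1 h2).
Qed.

Lemma is_jet_shift f : is_jet f -> is_jet (half_shift f).
Proof.
move=> [cf cf1 cf2 df df1 pf pf1]; split => /=.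
- exact: uncurried_shift.
- exact: uncurried_shift.
- exact: uncurried_shift.
- by move=> t x; exact: der_opp (der_shift (df t (x + pi))).
- by move=> t x; exact: der_opp (der_shift (df1 t (x + pi))).
- by move=> t x; rewrite addrAC pf.
- by move=> t x; rewrite addrAC pf1.
Qed.

Lemma wave_shift f g : wave f g -> wave (half_shift f) (half_shift g).
Proof.
move=> [jf jg cA cB df dg].
have jf' := is_jet_shift jf; have jg' := is_jet_shift jg.
have cubicE t x : cubic (half_shift f) (half_shift g) t x = cubic f g t (x + pi).
  rewrite /cubic /= !sqrrN; congr (_ * _ * _).
  rewrite mulrDr (_ : 2 * x + 2pi = 2 * x + pi + pi); last by ring.
  by rewrite !cos_pi_shift opprK.
apply: wave_intro => //.
- move=> t x t0; refine (der_eq (der_opp (df t (x + pi) t0)) _) => /=; rewrite cubicE; ring.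
- move=> t x t0; refine (der_eq (der_opp (dg t (x + pi) t0)) _) => /=; rewrite cubicE; ring.
Qed.

Lemma periodic_reduce x : exists2 y, 0 <= y <= 2pi &
  forall h : R -> R, (forall z, h (z + 2pi) = h z) -> h x = h y.
Proof.
have p0 : 0 < 2pi by rewrite mulr_gt0// pi_gt0.
have hn (h : R -> R) (n : nat) z : (forall z, h (z + 2pi) = h z) -> h (z + n%:R * 2pi) = h z.
  move=> hp; elim: n => [|n IH]; first by rewrite mul0r addr0.
  by rewrite -addn1 natrD mulrDl mul1r addrA hp.
pose n := Num.floor (x / 2pi).
have /andP[n1 n2] := floor_itv (x / 2pi).
exists (x - n%:~R * 2pi).
  move: n1 n2; rewrite -/n ler_pdivlMr// ltr_pdivrMr// intrD mulrDl mul1r => n1 n2.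
  apply/andP; split; lra.
move=> h hp; case: n {n1 n2} => m.
  by rewrite -[in LHS](subrK (m%:R * 2pi) x) hn.
rewrite NegzE mulrNz mulNr opprK; symmetry; exact: hn.
Qed.

(** Let [l] tend to infinity. *)
Lemma le_of_slack (a b c : R) : 0 <= c -> (forall l : R, 0 < l -> a <= (1 + l) * b + l^-1 * c) ->
  b = 0 -> a <= 0.
Proof.
move=> c0 h b0; rewrite leNgt; apply/negP => a0.
have l0 : 0 < (c + 1) / a by rewrite divr_gt0//; lra.
have := h _ l0; rewrite b0 mulr0 add0r invf_div -mulrAC ler_pdivlMr; last lra.
nra.
Qed.

(** [- u(t, x + pi)] solves the same equation with the same datum, so stability
identifies it with [u]. *)
Lemma wave_antiperiodic f g : wave f g ->
  (forall x, j0 f 0 (x + pi) = - j0 f 0 x) -> (forall x, j0 g 0 (x + pi) = - j0 g 0 x) ->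
  forall t x, 0 <= t -> j0 f t (x + pi) = - j0 f t x /\ j0 g t (x + pi) = - j0 g t x.
Proof.
move=> w af ag t x t0.
pose m := mass f g 0.
pose kb := 2 * (kinetic f g 0 + potential f g 0) + 4 * (1 + m) * m ^+ 2.
have w' := wave_shift w.
pose m' := mass (half_shift f) (half_shift g) 0.
pose kb' := 2 * (kinetic (half_shift f) (half_shift g) 0 +
   potential (half_shift f) (half_shift g) 0) + 4 * (1 + m') * m' ^+ 2.
have hk s : 0 <= s -> kinetic f g s <= kb by move=> s0; exact: kinetic_bound.
have hk' s : 0 <= s -> kinetic (half_shift f) (half_shift g) s <= kb'.
  by move=> s0; exact: kinetic_bound.
have kb0 : 0 <= kb by apply: le_trans (hk 0 _) => //; exact: kinetic_ge0.
have kb'0 : 0 <= kb' by apply: le_trans (hk' 0 _) => //; exact: kinetic_ge0.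
have m0 : 0 <= m := mass_ge0 _ _ _.
have m'0 : 0 <= m' := mass_ge0 _ _ _.
pose q := 2 * m + kb + (2 * m' + kb').
have b1 s y : 0 <= s -> 0 <= y <= 2pi -> j0 f s y ^+ 2 + j0 g s y ^+ 2 <= q.
  by move=> s0 y0; have := wave_bound w s0 y0; have := hk s s0; rewrite -/m /q; lra.
have b2 s y : 0 <= s -> 0 <= y <= 2pi ->
    j0 (half_shift f) s y ^+ 2 + j0 (half_shift g) s y ^+ 2 <= q.
  by move=> s0 y0; have := wave_bound w' s0 y0; have := hk' s s0; rewrite -/m' /q; lra.
have kk : kinetic f g t <= kb + kb' by have := hk t t0; lra.
have kk' : kinetic (half_shift f) (half_shift g) t <= kb + kb' by have := hk' t t0; lra.
have main y : 0 <= y <= 2pi ->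
  (j0 f t y + j0 f t (y + pi)) ^+ 2 + (j0 g t y + j0 g t (y + pi)) ^+ 2 <= 0.
  move=> y0; apply: (@le_of_slack _ (expR (8 * q * t) *
    mass (jet_sub f (half_shift f)) (jet_sub g (half_shift g)) 0) (4 * (kb + kb'))).
  - lra.
  - move=> l l0; have := sup_stability w w' t0 l0 b1 b2 kk kk' y0.
    by rewrite /= !opprK.
  - rewrite (_ : mass _ _ _ = 0) ?mulr0//.
    apply: Int_eq0 => [|z _]; first exact: pi2_ge0.
    by rewrite /= af ag !opprK !subrr expr0n /= addr0.
have [y y0 yx] := periodic_reduce x.
have [[_ _ _ _ _ pf _] [_ _ _ _ _ pg _] _ _ _ _] := w.
have Ef : j0 f t x + j0 f t (x + pi) = j0 f t y + j0 f t (y + pi).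
  by apply: (yx (fun z => j0 f t z + j0 f t (z + pi))) => z; rewrite addrAC !pf.
have Eg : j0 g t x + j0 g t (x + pi) = j0 g t y + j0 g t (y + pi).
  by apply: (yx (fun z => j0 g t z + j0 g t (z + pi))) => z; rewrite addrAC !pg.
have := main y y0; rewrite -Ef -Eg => h.
have : (j0 f t x + j0 f t (x + pi)) ^+ 2 + (j0 g t x + j0 g t (x + pi)) ^+ 2 == 0.
  by rewrite eq_le h addr_ge0// sqr_ge0.
rewrite paddr_eq0 ?sqr_ge0// !sqrf_eq0 => /andP[/eqP h1 /eqP h2].
by split; [move: h1|move: h2] => /eqP; rewrite addrC addr_eq0 => /eqP.
Qed.

Definition trig_data (p q : R) f := forall x, j0 f 0 x = p * cos x + q * sin x.

Lemma trig_L2 (p q p' q' : R) :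
  Int 0 2pi (fun x => (p * cos x + q * sin x) ^+ 2 + (p' * cos x + q' * sin x) ^+ 2) =
  pi * (p ^+ 2 + q ^+ 2 + p' ^+ 2 + q' ^+ 2).
Proof.
rewrite (_ : (fun x => _) = (fun x : R => (p ^+ 2 + p' ^+ 2) * cos x ^+ 2
  + (q ^+ 2 + q' ^+ 2) * sin x ^+ 2 + (2 * (p * q + p' * q')) * (sin x * cos x))).
  rewrite Int_lin3; [|cont|cont|cont].
  by rewrite Int_cos2 Int_sin2 Int_sincos; ring.
by apply: funext => x; ring.
Qed.

Lemma trig_mass_sub f1 g1 f2 g2 (p1 q1 p1' q1' p2 q2 p2' q2' : R) :
  trig_data p1 q1 f1 -> trig_data p1' q1' g1 -> trig_data p2 q2 f2 -> trig_data p2' q2' g2 ->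
  mass (jet_sub f1 f2) (jet_sub g1 g2) 0 =
  pi * ((p1 - p2) ^+ 2 + (q1 - q2) ^+ 2 + (p1' - p2') ^+ 2 + (q1' - q2') ^+ 2).
Proof.
move=> h1 h1' h2 h2'; rewrite -trig_L2; apply: Int_ext => x _ /=.
by rewrite h1 h1' h2 h2'; ring.
Qed.

(** In [y = 2 x] the integrand is [cos y * (m + k cos y + C sin y)^2], where [m]
is the mean of [|w|^2]; only the product [2 m k cos^2 y] has a nonzero
integral. *)
Lemma trig_potential (p q p' q' : R) :
  Int 0 2pi (fun x => cos (2 * x) *
    ((p * cos x + q * sin x) ^+ 2 + (p' * cos x + q' * sin x) ^+ 2) ^+ 2) =
  pi / 2 * ((p ^+ 2 + p' ^+ 2) ^+ 2 - (q ^+ 2 + q' ^+ 2) ^+ 2).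
Proof.
pose A := p ^+ 2 + p' ^+ 2; pose B := q ^+ 2 + q' ^+ 2; pose C := p * q + p' * q'.
pose m := (A + B) / 2; pose k := (A - B) / 2.
pose F x := m ^+ 2 * (sin (2 * x) / 2) + k ^+ 2 * (sin (2 * x) / 2 - sin (2 * x) ^+ 3 / 6)
  + C ^+ 2 * (sin (2 * x) ^+ 3 / 6) + m * k * (x + sin (2 * x) * cos (2 * x) / 2)
  + m * C * (sin (2 * x) ^+ 2 / 2) - k * C * (cos (2 * x) ^+ 3 / 3).
pose G x := cos (2 * x) * (m + k * cos (2 * x) + C * sin (2 * x)) ^+ 2.
have d x : is_derive x 1 F (G x).
  rewrite /F; der; rewrite /G; have := cos2Dsin2 (2 * x).
  set c := cos _; set s := sin _ => h.
  apply/eqP; rewrite -subr_eq0; apply/eqP.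
  transitivity ((1 - (c ^+ 2 + s ^+ 2)) * (k ^+ 2 * c + m * k)); first by field.
  by rewrite h subrr mul0r.
have E : Int 0 2pi G = 2 * pi * (m * k).
  have cG : continuous G by rewrite /G; cont.
  apply: (FTC2_eq (pi2_ge0 R) cG d).
  have s4 : sin (2 * 2pi) = 0 :> R by rewrite mulrDl mul1r sinD sin_pi2 mulr0 mul0r addr0.
  have c4 : cos (2 * 2pi) = 1 :> R by rewrite mulrDl mul1r cosD sin_pi2 cos_pi2; ring.
  by rewrite /F s4 c4 mulr0 sin0 cos0; field.
transitivity (Int 0 2pi G); last by rewrite E /m /k /A /B; field.
apply: Int_ext => x _; rewrite /G.
have c2 : cos (2 * x) = cos x ^+ 2 - sin x ^+ 2.
  by rewrite mulrDl mul1r cosD; ring.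
have s2 : sin (2 * x) = 2 * (sin x * cos x).
  by rewrite mulrDl mul1r sinD; ring.
rewrite c2 s2; congr (_ * _ ^+ 2).
transitivity (m * (cos x ^+ 2 + sin x ^+ 2) + k * (cos x ^+ 2 - sin x ^+ 2)
   + C * (2 * (sin x * cos x))); last by rewrite cos2Dsin2 mulr1.
by rewrite /m /k /A /B /C; field.
Qed.

Lemma dot_le (a b c d u v : R) : 0 <= u -> 0 <= v ->
  a ^+ 2 + b ^+ 2 <= u ^+ 2 -> c ^+ 2 + d ^+ 2 <= v ^+ 2 -> `|a * c + b * d| <= u * v.
Proof.
move=> u0 v0 hu hv; have uv0 : 0 <= u * v by rewrite mulr_ge0.
rewrite -(ger0_norm uv0) -ler_sqr ?nnegrE// !real_normK ?num_real//.
have -> : (a * c + b * d) ^+ 2 = (a ^+ 2 + b ^+ 2) * (c ^+ 2 + d ^+ 2) - (a * d - b * c) ^+ 2.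
  by ring.
have := sqr_ge0 (a * d - b * c).
have : (a ^+ 2 + b ^+ 2) * (c ^+ 2 + d ^+ 2) <= u ^+ 2 * v ^+ 2.
  by apply: ler_pM => //; rewrite addr_ge0// sqr_ge0.
rewrite exprMn; lra.
Qed.

(** Here [z = |w|^2], [d] is the scalar product of [w] and [r], and [r] stands
for [|r|^2] in [|w + r|^2 = |w|^2 + 2 w.r + |r|^2]; the amplitude [s] is below
[9 / 25]. *)
Lemma quartic_close (s z d r : R) : 0 <= s -> s ^+ 2 <= 1 / 8 ->
  0 <= z -> z <= s ^+ 2 -> `|d| <= s * (9 * s ^+ 2) -> 0 <= r -> r <= (9 * s ^+ 2) ^+ 2 ->
  `|(z + (2 * d + r)) ^+ 2 - z ^+ 2| <= 1000 * s ^+ 5.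
Proof.
move=> s0 s8 z0 zs hd r0 hr.
have s38 : s <= 9 / 25 by rewrite -ler_sqr ?nnegrE//; lra.
set e := 2 * d + r.
have he : `|e| <= 48 * s ^+ 3.
  have hr1 : r <= 81 * (s * s ^+ 3) by rewrite -exprS; move: hr; rewrite exprMn -exprM; lra.
  have s33 : 0 <= s ^+ 3 by rewrite exprn_ge0.
  have h4 : s * s ^+ 3 <= 9 / 25 * s ^+ 3 by rewrite ler_wpM2r.
  have : `|d| <= 9 * s ^+ 3 by rewrite (le_trans hd)// exprS mulrCA.
  move: (s * s ^+ 3) (s ^+ 3) hr1 s33 h4 => a b hr1 s33 h4.
  rewrite !ler_norml /e => /andP[d1 d2]; apply/andP; split; lra.
have h2 : `|2 * z + e| <= 20 * s ^+ 2.
  have : s ^+ 3 <= 9 / 25 * s ^+ 2 by rewrite exprS ler_wpM2r// sqr_ge0.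
  move: (e) he => {}e he; move: he; rewrite !ler_norml => /andP[h1 h2] h3.
  move: (s ^+ 2) (s ^+ 3) zs h1 h2 h3 => a b zs h1 h2 h3.
  by apply/andP; split; lra.
rewrite (_ : _ - _ = e * (2 * z + e)); last by ring.
rewrite normrM (le_trans (ler_pM _ _ he h2))//.
have : 0 <= s ^+ 5 by rewrite exprn_ge0.
rewrite mulrACA -exprD; lra.
Qed.

Section Estimates.
Variables (f g : jet R) (p q p' q' s : R).
Hypothesis w : wave f g.
Hypothesis f0 : trig_data p q f.
Hypothesis g0 : trig_data p' q' g.
Hypothesis s0 : 0 <= s.
Hypothesis s2 : s ^+ 2 = p ^+ 2 + q ^+ 2 + p' ^+ 2 + q' ^+ 2.

Lemma trig_data_j1 (h : jet R) (a b : R) : is_jet h -> trig_data a b h ->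
  forall x, j1 h 0 x = - a * sin x + b * cos x.
Proof.
move=> [_ _ _ dh _ _ _] h0 x.
have d1 : is_derive x 1 (fun x => a * cos x + b * sin x) (- a * sin x + b * cos x).
  by der; ring.
have d2 := dh 0 x; rewrite (_ : j0 h 0 = fun x => a * cos x + b * sin x) in d2; last exact: funext.
exact: der_unique d2 d1.
Qed.

Lemma trig_mass : mass f g 0 = pi * s ^+ 2.
Proof.
rewrite s2 -trig_L2; apply: Int_ext => x _; by rewrite f0 g0.
Qed.

Lemma trig_kinetic : kinetic f g 0 = pi * s ^+ 2.
Proof.
have [jf jg _ _ _ _] := w.
rewrite (_ : s ^+ 2 = q ^+ 2 + (- p) ^+ 2 + q' ^+ 2 + (- p') ^+ 2); last by rewrite s2; ring.
rewrite -trig_L2; apply: Int_ext => x _.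
by rewrite (trig_data_j1 jf f0) (trig_data_j1 jg g0); ring.
Qed.

Lemma trig_potential0 :
  potential f g 0 = pi / 2 * ((p ^+ 2 + p' ^+ 2) ^+ 2 - (q ^+ 2 + q' ^+ 2) ^+ 2).
Proof. by rewrite -trig_potential; apply: Int_ext => x _; rewrite f0 g0. Qed.

Lemma trig_antiperiodic t x : 0 <= t ->
  j0 f t (x + pi) = - j0 f t x /\ j0 g t (x + pi) = - j0 g t x.
Proof.
by apply: (wave_antiperiodic w) => {}x; rewrite ?f0 ?g0 cos_pi_shift sin_pi_shift; ring.
Qed.

(** [D = V(0) - V(t)], while [|V(t)| <= (3 m + D) m] by interpolation and
[m = pi s^2 <= 2 / 5] absorbs the term in [D]. *)
Lemma trig_kinetic_bound t : 0 <= t -> s ^+ 2 <= 1 / 8 ->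
  kinetic f g t - mass f g t <= 81 * s ^+ 4.
Proof.
move=> t0 s8; have [jf jg _ _ _ _] := w.
have pl := @pi_le R; have pg := @pi_ge2 R.
have S0 := sqr_ge0 s.
set D := _ - _.
have m2 : mass f g t = pi * s ^+ 2 by rewrite (mass_conserved w)// trig_mass.
have := @potential_le _ f g t _ jf jg (fun x => @jet_bound _ f g t x 1 jf jg ltr01).
rewrite ler_norml => /andP[V1 _].
have := energy_conserved w t0; rewrite trig_kinetic trig_potential0 => E.
have A0 : 0 <= p ^+ 2 + p' ^+ 2 by rewrite addr_ge0// sqr_ge0.
have B0 : 0 <= q ^+ 2 + q' ^+ 2 by rewrite addr_ge0// sqr_ge0.
have AB : s ^+ 2 = (p ^+ 2 + p' ^+ 2) + (q ^+ 2 + q' ^+ 2) by rewrite s2; ring.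
move: E AB A0 B0; move: (p ^+ 2 + p' ^+ 2) (q ^+ 2 + q' ^+ 2) => A B E AB A0 B0.
have AS : A ^+ 2 - B ^+ 2 <= s ^+ 4.
  by have -> : s ^+ 4 = (s ^+ 2) ^+ 2; [rewrite -exprM|rewrite AB; nra].
have kE : kinetic f g t = D + mass f g t by rewrite /D; ring.
have V2 : potential f g t = pi / 2 * (A ^+ 2 - B ^+ 2) - D.
  have : kinetic f g t + potential f g t = pi * s ^+ 2 + pi / 2 * (A ^+ 2 - B ^+ 2) := E.
  rewrite /D m2; lra.
rewrite kE m2 V2 invr1 in V1.
have pS : pi * s ^+ 2 <= 2 / 5 by nra.
have pS0 : 0 <= pi * s ^+ 2 by nra.
have : pi / 2 * (A ^+ 2 - B ^+ 2) <= 8 / 5 * s ^+ 4.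
  have h4 : 0 <= s ^+ 4 by rewrite exprn_ge0.
  have := ler_wpM2l (_ : 0 <= pi / 2) AS; nra.
have : (pi * s ^+ 2) ^+ 2 <= (16 / 5) ^+ 2 * s ^+ 4.
  rewrite exprMn -[(s ^+ 2) ^+ 2]exprM.
  rewrite ler_wpM2r ?exprn_ge0// ler_sqr// ?nnegrE; lra.
have D00 : 0 <= D \/ D < 0 by case: (lerP 0 D); [left|right].
move: V1; move: (pi / 2 * _) => V0.
move: pS pS0; set M := pi * s ^+ 2 => pS pS0 V1 h1 h2.
case: D00 => D0; nra.
Qed.

(** The coefficients are those of the orthogonal projection, so Bessel's
inequality bounds them by the conserved mass and [wirtinger] bounds the
rest. *)
Lemma trig_split t : 0 <= t -> s ^+ 2 <= 1 / 8 -> exists P Q P' Q' : R,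
  P ^+ 2 + Q ^+ 2 + P' ^+ 2 + Q' ^+ 2 <= s ^+ 2 /\
  (forall x, 0 <= x -> (j0 f t x - (P * cos x + Q * sin x)) ^+ 2
                     + (j0 g t x - (P' * cos x + Q' * sin x)) ^+ 2 <= (9 * s ^+ 2) ^+ 2).
Proof.
move=> t0 s8; have [[cf cf1 _ df _ _ _] [cg cg1 _ dg _ _ _] _ _ _ _] := w.
have cft := @uncurried_x _ _ cf t; have cgt := @uncurried_x _ _ cg t.
have cf1t := @uncurried_x _ _ cf1 t; have cg1t := @uncurried_x _ _ cg1 t.
exists (coef_cos (j0 f t)), (coef_sin (j0 f t)), (coef_cos (j0 g t)), (coef_sin (j0 g t)).
split.
  have := bessel cft; have := bessel cgt.
  have : mass f g t = pi * s ^+ 2 by rewrite (mass_conserved w)// trig_mass.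
  rewrite /mass Int_D; [|cont|cont].
  have := @pi_gt0 R => p0 E h1 h2.
  rewrite -(ler_pM2l p0) -E; lra.
move=> x x0.
have h1 := wirtinger (df t) cf1t (fun x => proj1 (trig_antiperiodic x t0)) x0.
have h2 := wirtinger (dg t) cg1t (fun x => proj2 (trig_antiperiodic x t0)) x0.
have := trig_kinetic_bound t0 s8; rewrite /kinetic /mass Int_D; [|cont|cont].
rewrite Int_D; [|cont|cont].
rewrite exprMn -exprM; move: h1 h2; rewrite /remainder; lra.
Qed.

Let w_le (P Q P' Q' x : R) : P ^+ 2 + Q ^+ 2 + P' ^+ 2 + Q' ^+ 2 <= s ^+ 2 ->
  (P * cos x + Q * sin x) ^+ 2 + (P' * cos x + Q' * sin x) ^+ 2 <= s ^+ 2.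
Proof.
have cs (a b : R) : (a * cos x + b * sin x) ^+ 2 <= a ^+ 2 + b ^+ 2.
  rewrite -subr_ge0 -[X in X - _]mulr1 -[X in _ * X - _](cos2Dsin2 x).
  by rewrite (_ : _ - _ = (a * sin x - b * cos x) ^+ 2) ?sqr_ge0//; ring.
have := cs P Q; have := cs P' Q'; lra.
Qed.

Lemma trig_upper t x : 0 <= t -> 0 <= x -> s ^+ 2 <= 1 / 8 ->
  j0 f t x ^+ 2 + j0 g t x ^+ 2 <= (s + 9 * s ^+ 2) ^+ 2.
Proof.
move=> t0 x0 s8; have [P [Q [P' [Q' [hS /(_ x x0) hr]]]]] := trig_split t0 s8.
have hw := w_le x hS; have S0 := sqr_ge0 s.
have n0 : 0 <= 9 * s ^+ 2 by lra.
have := dot_le s0 n0 hw hr; rewrite ler_norml => /andP[_ h].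
move: hw hr h; set w1 := P * _ + _; set w2 := P' * _ + _.
move: (j0 f t x) (j0 g t x) (9 * s ^+ 2) => a b e hw hr h.
have -> : (s + e) ^+ 2 = s ^+ 2 + 2 * (s * e) + e ^+ 2 by ring.
have -> : a ^+ 2 + b ^+ 2 = (w1 ^+ 2 + w2 ^+ 2) + 2 * (w1 * (a - w1) + w2 * (b - w2))
   + ((a - w1) ^+ 2 + (b - w2) ^+ 2) by ring.
lra.
Qed.

(** Comparing potentials: [V(w) <= V(t) + O(s^5) <= V(0) + O(s^5)], because the
kinetic energy at time [t] is at least the mass, which is the initial kinetic
energy.  At [pi / 2] the projection equals [Q + i Q']. *)
Lemma trig_lower t c : 0 <= t -> s ^+ 2 <= 1 / 8 -> 9 * s ^+ 2 <= c ->
  c ^+ 4 <= (q ^+ 2 + q' ^+ 2) ^+ 2 - (p ^+ 2 + p' ^+ 2) ^+ 2 - 4000 * s ^+ 5 ->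
  (c - 9 * s ^+ 2) ^+ 2 <= j0 f t (pi / 2) ^+ 2 + j0 g t (pi / 2) ^+ 2.
Proof.
move=> t0 s8 sc hc; have [P [Q [P' [Q' [hS hr]]]]] := trig_split t0 s8.
have S0 := sqr_ge0 s; have p0 := @pi_gt0 R.
have e0 : 0 <= 9 * s ^+ 2 by lra.
have [[cf cf1 _ df _ _ _] [cg cg1 _ dg _ _ _] _ _ _ _] := w.
have cft := @uncurried_x _ _ cf t; have cgt := @uncurried_x _ _ cg t.
pose W x := (P * cos x + Q * sin x) ^+ 2 + (P' * cos x + Q' * sin x) ^+ 2.
have cW : continuous (fun x => cos (2 * x) * W x ^+ 2) by rewrite /W; cont.
(* the potential of [u] is that of its projection up to a fifth-order error *)
have hV : Int 0 2pi (fun x => cos (2 * x) * W x ^+ 2) <= potential f g t + 1000 * s ^+ 5 * (2pi - 0).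
  rewrite -(Int_cst _ (pi2_ge0 R)) -Int_D; [|cont|cont].
  apply: Int_le; [exact: cW|cont|move=> x /andP[x0 _]].
  have hw := w_le x hS; have hrx := hr x x0.
  have := dot_le s0 e0 hw hrx; rewrite -/(W x) in hw *.
  have W0 : 0 <= W x by rewrite addr_ge0// sqr_ge0.
  have -> : j0 f t x ^+ 2 + j0 g t x ^+ 2 = W x + (2 *
    ((P * cos x + Q * sin x) * (j0 f t x - (P * cos x + Q * sin x)) +
     (P' * cos x + Q' * sin x) * (j0 g t x - (P' * cos x + Q' * sin x))) +
   ((j0 f t x - (P * cos x + Q * sin x)) ^+ 2 + (j0 g t x - (P' * cos x + Q' * sin x)) ^+ 2)).
    by rewrite /W; ring.
  have r0 : 0 <= (j0 f t x - (P * cos x + Q * sin x)) ^+ 2 +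
    (j0 g t x - (P' * cos x + Q' * sin x)) ^+ 2 by rewrite addr_ge0// sqr_ge0.
  move: hrx r0; move: (_ * (j0 f t x - _) + _) ((j0 f t x - _) ^+ 2 + _) (W x) hw W0 => d r z hz z0 hr0 r0 hd.
  have := quartic_close s0 s8 z0 hz hd r0 hr0.
  move: ((z + _) ^+ 2) (z ^+ 2) => X Z hX.
  have : `|cos (2 * x) * (X - Z)| <= 1000 * s ^+ 5.
    by rewrite normrM (le_trans _ hX)// ler_piMl// cos_max.
  rewrite ler_norml mulrBr => /andP[+ _]; move: (_ * X) (_ * Z) (s ^+ 5) => a b e; lra.
have Ep := energy_conserved w t0; rewrite trig_kinetic trig_potential0 in Ep.
have D0 : mass f g t <= kinetic f g t.
  have h1 := wirtinger (df t) (@uncurried_x _ _ cf1 t) (fun x => proj1 (trig_antiperiodic x t0)) (lexx 0).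
  have h2 := wirtinger (dg t) (@uncurried_x _ _ cg1 t) (fun x => proj2 (trig_antiperiodic x t0)) (lexx 0).
  have c1 := @uncurried_x _ _ cf1 t; have c2 := @uncurried_x _ _ cg1 t.
  rewrite /mass /kinetic Int_D; [|cont|cont].
  rewrite Int_D; [|cont|cont].
  have := le_trans (sqr_ge0 _) h1; have := le_trans (sqr_ge0 _) h2; lra.
rewrite (mass_conserved w)// trig_mass in D0.
rewrite trig_potential in hV.
have hB : c ^+ 4 <= (Q ^+ 2 + Q' ^+ 2) ^+ 2.
  apply: (le_trans hc); have := sqr_ge0 (P ^+ 2 + P' ^+ 2) => P0.
  have : 0 <= pi / 2 * (P ^+ 2 + P' ^+ 2) ^+ 2 by rewrite mulr_ge0// ltW// divr_gt0.
  move=> P1; have p20 : 0 < pi / 2 :> R by rewrite divr_gt0.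
  rewrite -(ler_pM2l p20).
  move: hV D0 Ep P1; move: (potential f g t) (kinetic f g t) => V k; lra.
have B0 : 0 <= Q ^+ 2 + Q' ^+ 2 by rewrite addr_ge0// sqr_ge0.
have c0 : 0 <= c by apply: le_trans sc.
have hb : c ^+ 2 <= Q ^+ 2 + Q' ^+ 2.
  by rewrite -ler_sqr ?nnegrE ?sqr_ge0// -exprM.
have ph : 0 <= pi / 2 :> R by rewrite divr_ge0// ltW.
have := hr (pi / 2) ph.
rewrite cos_pihalf sin_pihalf !mulr0 !mulr1 !add0r.
set b := Num.sqrt (Q ^+ 2 + Q' ^+ 2).
have bE : Q ^+ 2 + Q' ^+ 2 = b ^+ 2 by rewrite sqr_sqrtr.
have cb : c <= b by rewrite -ler_sqr ?nnegrE ?sqrtr_ge0// -bE.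
move: (j0 f t _) (j0 g t _) (9 * s ^+ 2) sc e0 => u v e sc e0 hrr.
set r2 := (u - Q) ^+ 2 + (v - Q') ^+ 2.
have r20 : 0 <= r2 by rewrite addr_ge0// sqr_ge0.
pose r := Num.sqrt r2; have rE : r2 = r ^+ 2 by rewrite sqr_sqrtr.
have re : r <= e by rewrite -ler_sqr ?nnegrE ?sqrtr_ge0// -rE.
have r0 : 0 <= r := sqrtr_ge0 _.
have bb0 : 0 <= b := sqrtr_ge0 _.
have bE' : Q ^+ 2 + Q' ^+ 2 <= b ^+ 2 by rewrite bE.
have rE' : (u - Q) ^+ 2 + (v - Q') ^+ 2 <= r ^+ 2 by rewrite -rE.
have := dot_le bb0 r0 bE' rE'; rewrite ler_norml => /andP[hd _].
have -> : u ^+ 2 + v ^+ 2 = Q ^+ 2 + Q' ^+ 2 + 2 * (Q * (u - Q) + Q' * (v - Q')) + r2.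
  by rewrite /r2; ring.
rewrite bE rE.
have ce : 0 <= c - e by rewrite subr_ge0.
have br : c - e <= b - r by exact: lerB.
have : (c - e) ^+ 2 <= (b - r) ^+ 2 by rewrite ler_sqr ?nnegrE// (le_trans ce).
move=> /le_trans; apply.
have -> : (b - r) ^+ 2 = b ^+ 2 - 2 * (b * r) + r ^+ 2 by ring.
by rewrite lerD2r lerD2l -mulrN ler_wpM2l.
Qed.

End Estimates.

End TrigWaves.

(** * From complex solutions to pairs of real functions *)

Section Bridge.
Variable R : realType.
Local Notation "2pi" := (2 * @pi R).
Local Notation uncurried k := (fun p : R * R => k p.1 p.2).
Implicit Types (t x y s : R).

(** Freezing a function at negative times makes continuity up to [t = 0] into
continuity on the whole plane. *)
Lemma continuous_clamp (h : R -> R -> R) :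
  {within [set p : R * R | 0 <= p.1], continuous (uncurried h)} ->
  continuous (fun p : R * R => h (Num.max p.1 0) p.2).
Proof.
move=> /subspace_continuousP hc p.
pose c (p : R * R) := (Num.max p.1 0, p.2).
have D0 z : 0 <= (c z).1 by rewrite /= le_max lexx orbT.
have := hc (c p) (D0 p); apply: cvg_trans.
have cc : c z @[z --> p] --> c p.
  have h0 : continuous_at p (fun z : R * R => z.1) by case: p => a b; exact: cvg_fst.
  have h1 : Num.max z.1 0 @[z --> p] --> Num.max p.1 0.
    by apply: (@continuous_max R _ (fun z : R * R => z.1) (fun=> 0)) => //; exact: cvg_cst.
  have h2 : z.2 @[z --> p] --> p.2 by exact: cont_snd.
  exact: (cvg_pair h1 h2).
move=> A A1.
have A2 : nbhs (c p) (fun z => 0 <= z.1 -> A (h z.1 z.2)) := A1.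
have A3 : \forall z \near p, 0 <= (c z).1 -> A (h (c z).1 (c z).2) := cc _ A2.
have : \forall z \near p, A (h (Num.max z.1 0) z.2).
  by apply: filterS A3 => z Az; exact: (Az (D0 z)).
exact.
Qed.

Variables (u0 : R -> R[i]) (u : R -> R -> R[i]).
Hypothesis sol : is_solution u0 u.

Definition jet_of (part : R[i] -> R) : jet R := Jet
  (fun t x => part (u (Num.max t 0) x))
  (fun t x => part (deriveC (u (Num.max t 0)) x))
  (fun t x => part (deriveC (deriveC (u (Num.max t 0))) x)).

Let m0 t : 0 <= Num.max t 0. Proof. by rewrite le_max lexx orbT. Qed.

Lemma derive1_is (f : R -> R) x : derivable f x 1 -> is_derive x 1 f (derive1 f x).
Proof. by move=> df; rewrite derive1E; exact: DeriveDef. Qed.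

Lemma periodic_derive (f f1 : R -> R) (c : R) : (forall x, is_derive x 1 f (f1 x)) ->
  (forall x, f (x + c) = f x) -> forall x, f1 (x + c) = f1 x.
Proof.
move=> df fc x; have := der_shift (df (x + c)).
rewrite (_ : (fun y => f (y + c)) = f); last exact: funext.
by move=> d; exact: der_unique d (df x).
Qed.

Lemma Re_deriveC (f : R -> R[i]) x :
  complex.Re (deriveC f x) = derive1 (fun y => complex.Re (f y)) x.
Proof. by rewrite /deriveC. Qed.

Lemma Im_deriveC (f : R -> R[i]) x :
  complex.Im (deriveC f x) = derive1 (fun y => complex.Im (f y)) x.
Proof. by rewrite /deriveC. Qed.

Lemma Re_is_derive (f : R -> R[i]) x : derivableC f x ->
  is_derive x 1 (fun y => complex.Re (f y)) (complex.Re (deriveC f x)).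
Proof. by case=> df _; rewrite Re_deriveC; exact: derive1_is df. Qed.

Lemma Im_is_derive (f : R -> R[i]) x : derivableC f x ->
  is_derive x 1 (fun y => complex.Im (f y)) (complex.Im (deriveC f x)).
Proof. by case=> _ df; rewrite Im_deriveC; exact: derive1_is df. Qed.

Lemma is_jet_Re : is_jet (jet_of (@complex.Re R)).
Proof.
have [per _ c0 d0 c1 d1 c2 _ _] := sol.
have e1 t x := Re_is_derive (d0 _ x (m0 t)).
have e2 t x := Re_is_derive (d1 _ x (m0 t)).
split.
- exact: (continuous_clamp (h := fun t x => complex.Re (u t x)) (proj1 c0)).
- exact: (continuous_clamp (h := fun t x => complex.Re (deriveC (u t) x)) (proj1 c1)).
- exact: (continuous_clamp (h := fun t x => complex.Re (deriveC (deriveC (u t)) x)) (proj1 c2)).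
- exact: e1.
- exact: e2.
- by move=> t x /=; rewrite per.
- by move=> t; apply: periodic_derive (e1 t) _ => x; rewrite per.
Qed.

Lemma is_jet_Im : is_jet (jet_of (@complex.Im R)).
Proof.
have [per _ c0 d0 c1 d1 c2 _ _] := sol.
have e1 t x := Im_is_derive (d0 _ x (m0 t)).
have e2 t x := Im_is_derive (d1 _ x (m0 t)).
split.
- exact: (continuous_clamp (h := fun t x => complex.Im (u t x)) (proj2 c0)).
- exact: (continuous_clamp (h := fun t x => complex.Im (deriveC (u t) x)) (proj2 c1)).
- exact: (continuous_clamp (h := fun t x => complex.Im (deriveC (deriveC (u t)) x)) (proj2 c2)).
- exact: e1.
- exact: e2.
- by move=> t x /=; rewrite per.
- by move=> t; apply: periodic_derive (e1 t) _ => x; rewrite per.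
Qed.

Lemma near_clamp (h : R -> R) t : 0 < t -> \forall s \near t, h s = h (Num.max s 0).
Proof.
move=> t0; near=> s; rewrite max_l//; apply/ltW; near: s; exact: lt_nbhsr.
Unshelve. all: by end_near. Qed.

Lemma solution_wave : wave (jet_of (@complex.Re R)) (jet_of (@complex.Im R)).
Proof.
have jf := is_jet_Re; have jg := is_jet_Im.
have eq t x : 0 < t ->
  is_derive t 1 (fun s => complex.Re (u s x))
    (- complex.Im (deriveC (deriveC (u t)) x) +
     2 * cos (2 * x) * (complex.Re (u t x) ^+ 2 + complex.Im (u t x) ^+ 2) * complex.Im (u t x)) /\
  is_derive t 1 (fun s => complex.Im (u s x))
    (complex.Re (deriveC (deriveC (u t)) x) -
     2 * cos (2 * x) * (complex.Re (u t x) ^+ 2 + complex.Im (u t x) ^+ 2) * complex.Re (u t x)).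
  move=> t0; have dt := sol_dert sol x t0.
  have := sol_eq sol x t0; rewrite -add_Re2_Im2.
  move: (Re_is_derive dt) (Im_is_derive dt).
  case: (deriveC (fun s => u s x) t) => ft gt; case: (deriveC (deriveC (u t)) x) => fxx gxx.
  case E : (u t x) => [a b]; rewrite /= => h1 h2 [e1 e2].
  by split; [apply: der_eq h1 _|apply: der_eq h2 _]; lra.
apply: wave_intro => //.
- move=> t x t0; have [h _] := eq t x t0.
  apply: (near_eq_is_derive (near_clamp (fun s => complex.Re (u s x)) t0)).
  by rewrite /cubic /= max_l ?(ltW t0).
- move=> t x t0; have [_ h] := eq t x t0.
  apply: (near_eq_is_derive (near_clamp (fun s => complex.Im (u s x)) t0)).
  by rewrite /cubic /= max_l ?(ltW t0).
Qed.

End Bridge.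

(** * The supremum over the torus *)

Section Supremum.
Variable R : realType.
Local Notation "2pi" := (2 * @pi R).
Implicit Types (t x y s c : R) (v : R -> R[i]).

Definition nsq (z : R[i]) : R := complex.Re z ^+ 2 + complex.Im z ^+ 2.

Lemma nsq_ge0 z : 0 <= nsq z. Proof. by rewrite addr_ge0// sqr_ge0. Qed.

Lemma nsqD (z' z : R[i]) : nsq (z' + z) =
  (complex.Re z' + complex.Re z) ^+ 2 + (complex.Im z' + complex.Im z) ^+ 2.
Proof. by case: z' => ? ?; case: z. Qed.

Lemma amplitude_ge0 (eps : R) (a b : R[i]) : 0 <= 2 * eps ^+ 2 * (nsq a + nsq b).
Proof.
have h := sqr_ge0 eps; have ha := nsq_ge0 a; have hb := nsq_ge0 b.
by apply: mulr_ge0; lra.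
Qed.

Lemma nsqB (z' z : R[i]) : nsq (z' - z) =
  (complex.Re z' - complex.Re z) ^+ 2 + (complex.Im z' - complex.Im z) ^+ 2.
Proof. by case: z' => ? ?; case: z. Qed.

Lemma Re_normc (z : R[i]) : complex.Re `|z| = Num.sqrt (nsq z).
Proof. by rewrite normc_def. Qed.

Lemma sup_torus_le v c : 0 <= c -> (forall x, 0 <= x <= 2pi -> nsq (v x) <= c ^+ 2) ->
  sup_torus v <= c.
Proof.
move=> c0 h; apply: ge_sup.
  by exists (complex.Re `|v 0|), 0 => //=; rewrite in_itv/= lexx pi2_ge0.
move=> _ [x xin <-]; have x02 : 0 <= x <= 2pi by move: xin; rewrite /= in_itv.
by rewrite Re_normc -(ger0_norm c0) -sqrtr_sqr ler_wsqrtr// h.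
Qed.

Lemma sup_torus_ge v (b c x : R) : (forall x, 0 <= x <= 2pi -> nsq (v x) <= b) ->
  0 <= x <= 2pi -> 0 <= c -> c ^+ 2 <= nsq (v x) -> c <= sup_torus v.
Proof.
move=> hb x02 c0 hc; apply: (@le_trans _ _ (complex.Re `|v x|)).
  by rewrite Re_normc -(ger0_norm c0) -sqrtr_sqr ler_wsqrtr.
apply: sup_ubound; last by exists x => //=; rewrite in_itv.
exists (Num.sqrt b) => _ [y yin <-]; have y02 : 0 <= y <= 2pi by move: yin; rewrite /= in_itv.
by rewrite Re_normc ler_wsqrtr// hb.
Qed.

Lemma sqrt_triangle (a b c d e : R) : 0 <= e -> (a - c) ^+ 2 + (b - d) ^+ 2 <= e ^+ 2 ->
  Num.sqrt (a ^+ 2 + b ^+ 2) <= Num.sqrt (c ^+ 2 + d ^+ 2) + e.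
Proof.
move=> e0 h; set r := Num.sqrt (c ^+ 2 + d ^+ 2).
have r0 : 0 <= r := sqrtr_ge0 _.
have rE : c ^+ 2 + d ^+ 2 <= r ^+ 2 by rewrite sqr_sqrtr// addr_ge0// sqr_ge0.
have re0 : 0 <= r + e by rewrite addr_ge0.
rewrite -[r + e]ger0_norm// -sqrtr_sqr ler_wsqrtr//.
have := dot_le r0 e0 rE h; rewrite ler_norml => /andP[_ hd].
have -> : a ^+ 2 + b ^+ 2 = (c ^+ 2 + d ^+ 2) + 2 * (c * (a - c) + d * (b - d))
   + ((a - c) ^+ 2 + (b - d) ^+ 2) by ring.
have -> : (r + e) ^+ 2 = r ^+ 2 + 2 * (r * e) + e ^+ 2 by ring.
lra.
Qed.

(** The bound [b] ensures that the supremum of [v] is a least upper bound. *)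
Lemma sup_torus_close v v' (b e : R) : 0 <= e -> (forall x, 0 <= x <= 2pi -> nsq (v x) <= b) ->
  (forall x, 0 <= x <= 2pi -> nsq (v' x - v x) <= e ^+ 2) ->
  sup_torus v' <= sup_torus v + e.
Proof.
move=> e0 hb h; apply: ge_sup.
  by exists (complex.Re `|v' 0|), 0 => //=; rewrite in_itv/= lexx pi2_ge0.
move=> _ [x xin <-]; have x02 : 0 <= x <= 2pi by move: xin; rewrite /= in_itv.
rewrite Re_normc.
have := h x x02; rewrite /nsq; case E : (v x) => [c d]; case: (v' x) => a a' /= hx.
apply: (le_trans (sqrt_triangle e0 hx)); rewrite lerD2r.
apply: (@sup_torus_ge _ b _ x) => //.
by rewrite E /nsq /= sqr_sqrtr// addr_ge0// sqr_ge0.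
Qed.

End Supremum.

Section Waves.
Variable R : realType.
Local Notation "2pi" := (2 * @pi R).
Implicit Types (t x y s c eps : R) (a b : R[i]) (u : R -> R -> R[i]).

Definition datum eps a b (x : R) : R[i] := eps%:C * (a * expi x + b * expi (- x)).

Local Notation jRe u := (jet_of u (@complex.Re R)).
Local Notation jIm u := (jet_of u (@complex.Im R)).
Local Notation Re := (@complex.Re R).
Local Notation Im := (@complex.Im R).

Section OneWave.
Variables (eps : R) (a b : R[i]) (u : R -> R -> R[i]).
Hypothesis sol : is_solution (datum eps a b) u.

Lemma datum_Re : trig_data (eps * (Re a + Re b)) (eps * (Im b - Im a)) (jRe u).
Proof.
move=> x; rewrite /= maxxx (sol_initial sol) /datum /expi.
by case: a => a1 a2; case: b => b1 b2; rewrite /= cosN sinN; ring.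
Qed.

Lemma datum_Im : trig_data (eps * (Im a + Im b)) (eps * (Re a - Re b)) (jIm u).
Proof.
move=> x; rewrite /= maxxx (sol_initial sol) /datum /expi.
by case: a => a1 a2; case: b => b1 b2; rewrite /= cosN sinN; ring.
Qed.

Let s := Num.sqrt (2 * eps ^+ 2 * (nsq a + nsq b)).

Let S0 : 0 <= 2 * eps ^+ 2 * (nsq a + nsq b).
Proof. exact: amplitude_ge0. Qed.

Lemma amplitude_sq : s ^+ 2 = (eps * (Re a + Re b)) ^+ 2 + (eps * (Im b - Im a)) ^+ 2 +
  (eps * (Im a + Im b)) ^+ 2 + (eps * (Re a - Re b)) ^+ 2.
Proof. by rewrite sqr_sqrtr// /nsq; ring. Qed.

Let s0 : 0 <= s. Proof. exact: sqrtr_ge0. Qed.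

Let jE t x : 0 <= t -> nsq (u t x) = j0 (jRe u) t x ^+ 2 + j0 (jIm u) t x ^+ 2.
Proof. by move=> t0; rewrite /= max_l. Qed.

Lemma solution_bounded t x : 0 <= t -> 0 <= x <= 2pi ->
  nsq (u t x) <= 2 * mass (jRe u) (jIm u) 0 + kinetic (jRe u) (jIm u) t.
Proof. by move=> t0 x02; rewrite jE//; exact: (wave_bound (solution_wave sol)). Qed.

Lemma solution_upper t : 0 <= t -> s ^+ 2 <= 1 / 8 -> sup_torus (u t) <= s + 9 * s ^+ 2.
Proof.
move=> t0 s8; apply: sup_torus_le; first by rewrite addr_ge0// mulr_ge0// sqr_ge0.
move=> x /andP[x0 _]; rewrite jE//.
exact: (trig_upper (solution_wave sol) datum_Re datum_Im s0 amplitude_sq).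
Qed.

Lemma solution_lower t c : 0 <= t -> s ^+ 2 <= 1 / 8 -> 9 * s ^+ 2 <= c ->
  c ^+ 4 <= eps ^+ 4 * nsq (a - b) ^+ 2 - eps ^+ 4 * nsq (a + b) ^+ 2 - 4000 * s ^+ 5 ->
  c - 9 * s ^+ 2 <= sup_torus (u t).
Proof.
move=> t0 s8 sc hc; have p0 := @pi_ge0 R.
apply: (sup_torus_ge (fun x => @solution_bounded t x t0) (x := pi / 2)).
- apply/andP; split; lra.
- by rewrite subr_ge0.
rewrite jE//.
apply: (trig_lower (solution_wave sol) datum_Re datum_Im s0 amplitude_sq) => //.
apply: (le_trans hc); rewrite /nsq; case: a => a1 a2; case: b => b1 b2 /=.
rewrite le_eqVlt; apply/orP; left; apply/eqP; ring.
Qed.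

(** The constants only have to be uniform on data of bounded amplitude. *)
Lemma solution_kinetic t K : 0 <= t -> s ^+ 2 <= K ->
  kinetic (jRe u) (jIm u) t <= 600 * (1 + K) ^+ 3 /\ mass (jRe u) (jIm u) 0 <= 4 * K.
Proof.
move=> t0 sK; have w := solution_wave sol.
have := kinetic_bound w t0.
rewrite (trig_mass datum_Re datum_Im amplitude_sq).
rewrite (trig_kinetic w datum_Re datum_Im amplitude_sq).
rewrite (trig_potential0 datum_Re datum_Im).
have AB := amplitude_sq.
set A := _ + (eps * (Im a + Im b)) ^+ 2; set B := _ + (eps * (Re a - Re b)) ^+ 2.
have A0 : 0 <= A by rewrite addr_ge0// sqr_ge0.
have B0 : 0 <= B by rewrite addr_ge0// sqr_ge0.
have {}AB : s ^+ 2 = A + B by rewrite AB /A /B; ring.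
move: A B A0 B0 AB => A B A0 B0 AB; move: (s ^+ 2) sK AB => S sK AB.
have pl := @pi_le R; have pg := @pi_ge2 R.
have S00 : 0 <= S by lra.
have pS : pi * S <= 16 / 5 * S by rewrite ler_wpM2r.
have pS0 : 0 <= pi * S by rewrite mulr_ge0// pi_ge0.
have hV : pi / 2 * (A ^+ 2 - B ^+ 2) <= 8 / 5 * S ^+ 2.
  have h1 : A ^+ 2 - B ^+ 2 <= S ^+ 2 by rewrite AB; nra.
  have h2 : pi / 2 * S ^+ 2 <= 8 / 5 * S ^+ 2 by rewrite ler_wpM2r ?sqr_ge0//; lra.
  apply: le_trans h2; rewrite ler_wpM2l//; lra.
have h2 : (pi * S) ^+ 2 <= (16 / 5 * S) ^+ 2 by rewrite ler_sqr ?nnegrE//; lra.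
have h3 : (pi * S) ^+ 2 * (pi * S) <= (16 / 5 * S) ^+ 2 * (16 / 5 * S).
  by apply: ler_pM => //; exact: sqr_ge0.
have K0 : 0 <= K by lra.
have S2 : S ^+ 2 <= K ^+ 2 by rewrite ler_sqr ?nnegrE.
have S3 : S ^+ 2 * S <= K ^+ 2 * K by apply: ler_pM => //; exact: sqr_ge0.
move=> hk; split; last lra.
apply: (le_trans hk).
have K2 : 0 <= K ^+ 2 := sqr_ge0 _.
have K3 : 0 <= K ^+ 2 * K by rewrite mulr_ge0.
have -> : 600 * (1 + K) ^+ 3 = 600 + 1800 * K + 1800 * K ^+ 2 + 600 * (K ^+ 2 * K) by ring.
have -> : 4 * (1 + pi * S) * (pi * S) ^+ 2 = 4 * (pi * S) ^+ 2 + 4 * ((pi * S) ^+ 2 * (pi * S)) by ring.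
move: h2 h3; rewrite exprMn; lra.
Qed.

End OneWave.

Lemma slack_le (k E : R) : 0 <= k -> 0 < E -> ((8 * k + 1) / E)^-1 * (4 * k) <= E / 2.
Proof.
move=> k0 E0; rewrite invf_div mulrAC ler_pdivrMr; last lra.
have := mulr_ge0 (ltW E0) k0; lra.
Qed.

(** Interpolating between the small [L^2] distance and the bounded kinetic
energies makes the uniform distance small: [l] is chosen first to control the
kinetic term, then [r] to control the other. *)
Lemma solution_stable eps t K e : 0 <= t -> 0 < e -> exists2 r : R, 0 < r &
  forall a b a' b' u u',
    is_solution (datum eps a b) u -> is_solution (datum eps a' b') u' ->
    2 * eps ^+ 2 * (nsq a + nsq b) <= K -> 2 * eps ^+ 2 * (nsq a' + nsq b') <= K ->
    2 * eps ^+ 2 * (nsq (a' - a) + nsq (b' - b)) <= r ->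
    sup_torus (u' t) <= sup_torus (u t) + e.
Proof.
move=> t0 e0.
pose K' := Num.max K 0.
have K0 : 0 <= K' by rewrite le_max lexx orbT.
pose k := 600 * (1 + K') ^+ 3.
have k0 : 0 <= k by apply: mulr_ge0; [lra|apply: exprn_ge0; lra].
pose q := 2 * (4 * K') + k.
pose l := (8 * k + 1) / e ^+ 2.
have e2 : 0 < e ^+ 2 by rewrite exprn_gt0.
have l0 : 0 < l by rewrite divr_gt0//; lra.
pose c := (1 + l) * (expR (8 * q * t) * pi).
have c0 : 0 < c by rewrite !mulr_gt0 ?expR_gt0 ?pi_gt0//; lra.
exists (e ^+ 2 / 2 / c); first by rewrite !divr_gt0.
move=> a b a' b' u u' sol sol' hK hK' hr.
have S0 := amplitude_ge0 eps.
have sK : Num.sqrt (2 * eps ^+ 2 * (nsq a + nsq b)) ^+ 2 <= K' by rewrite sqr_sqrtr// le_max hK.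
have sK' : Num.sqrt (2 * eps ^+ 2 * (nsq a' + nsq b')) ^+ 2 <= K' by rewrite sqr_sqrtr// le_max hK'.
have w := solution_wave sol; have w' := solution_wave sol'.
have bnd s x : 0 <= s -> 0 <= x <= 2pi -> j0 (jRe u) s x ^+ 2 + j0 (jIm u) s x ^+ 2 <= q.
  move=> hs x02; have := wave_bound w hs x02.
  have [h1 h2] := solution_kinetic sol hs sK; rewrite /q -/k in h1 *; lra.
have bnd' s x : 0 <= s -> 0 <= x <= 2pi -> j0 (jRe u') s x ^+ 2 + j0 (jIm u') s x ^+ 2 <= q.
  move=> hs x02; have := wave_bound w' hs x02.
  have [h1 h2] := solution_kinetic sol' hs sK'; rewrite /q -/k in h1 *; lra.
have [k1 _] := solution_kinetic sol t0 sK; have [k2 _] := solution_kinetic sol' t0 sK'.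
apply: (sup_torus_close (b := 2 * mass (jRe u) (jIm u) 0 + kinetic (jRe u) (jIm u) t)).
- exact: ltW.
- by move=> x x02; exact: (solution_bounded sol).
move=> x x02; have := sup_stability w' w t0 l0 bnd' bnd k2 k1 x02.
have -> : mass (jet_sub (jRe u') (jRe u)) (jet_sub (jIm u') (jIm u)) 0 =
   pi * (2 * eps ^+ 2 * (nsq (a' - a) + nsq (b' - b))).
  rewrite (trig_mass_sub (datum_Re sol') (datum_Im sol') (datum_Re sol) (datum_Im sol)).
  by rewrite !nsqB; ring.
have -> : nsq (u' t x - u t x) = (j0 (jRe u') t x - j0 (jRe u) t x) ^+ 2
    + (j0 (jIm u') t x - j0 (jIm u) t x) ^+ 2.
  by rewrite nsqB /= max_l.
move: hr; set r := 2 * eps ^+ 2 * _ => hr /le_trans; apply.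
have -> : (1 + l) * (expR (8 * q * t) * (pi * r)) = c * r by rewrite /c; ring.
have h1 : c * r <= e ^+ 2 / 2 by rewrite mulrC -ler_pdivlMr.
have h2 : l^-1 * (4 * k) <= e ^+ 2 / 2 by exact: slack_le.
by rewrite [leRHS](splitr (e ^+ 2)) lerD.
Qed.

End Waves.

(** * Measurability and Gaussian estimates *)

Section MeasurableApprox.
Context {R : realType} d (T : measurableType d).

(** If membership in [E] is stable under limits of the real data [X], then [E]
is the intersection over [n] of the union of all cells of side [1 / (n + 1)] in
the space of data that meet the image of [E]; there are countably many. *)
Lemma measurable_of_approx (k : nat) (X : 'I_k -> T -> R) (E : set T) :
  (forall i, measurable_fun setT (X i)) ->
  (forall w, (forall r : R, 0 < r -> exists2 w', E w' & forall i, `|X i w - X i w'| <= r) -> E w) ->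
  measurable E.
Proof.
move=> mX hE.
pose cell n w : {ffun 'I_k -> int} := [ffun i => Num.floor (n.+1%:R * X i w)].
have mcell n c : measurable [set w | cell n w = c].
  rewrite (_ : [set w | _] = \bigcap_(i in [set: 'I_k])
      (X i @^-1` `[(c i)%:~R / n.+1%:R, (c i + 1)%:~R / n.+1%:R[)).
    apply: fin_bigcap_measurable => // i _.
    by rewrite -[X in measurable X]setTI; exact: mX.
  have n0 : 0 < n.+1%:R :> R by rewrite ltr0n.
  have mem i w : (X i w \in `[(c i)%:~R / n.+1%:R, (c i + 1)%:~R / n.+1%:R[) <->
      Num.floor (n.+1%:R * X i w) = c i.
    rewrite in_itv/= ler_pdivrMr// ltr_pdivlMr// [_ * n.+1%:R]mulrC.
    by split=> [/floor_def|<-]; last exact: floor_itv.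
  apply/seteqP; split => w /= h.
    by move=> i _; apply/mem; rewrite -h ffunE.
  by apply/ffunP => i; rewrite ffunE; apply/mem; exact: (h i I).
pose A n := \bigcup_(c : {ffun 'I_k -> int})
  ([set w | cell n w = c] `&` [set _ | exists2 w', E w' & cell n w' = c]).
rewrite (_ : E = \bigcap_n A n).
  apply: bigcapT_measurable => n.
  apply: countable_bigcupT_measurable => // c.
  have [h|h] := pselect (exists2 w', E w' & cell n w' = c).
    by rewrite (_ : [set _ : T | exists2 w', E w' & cell n w' = c] = setT) ?setIT//; apply/seteqP; split.
  by rewrite (_ : [set _ : T | exists2 w', E w' & cell n w' = c] = set0) ?setI0//; apply/seteqP; split.
apply/seteqP; split => [w Ew n _|w Aw].
  by exists (cell n w) => //; split => //; exists w.
apply: hE => r r0.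
have [n hn] : exists n : nat, n.+1%:R^-1 <= r.
  exists (Num.Def.archi_bound r^-1).
  rewrite invf_ple ?posrE ?ltr0n//.
  have h := archi_boundP (ltW (_ : 0 < r^-1)); rewrite invr_gt0 in h.
  by rewrite (le_trans (ltW (h r0)))// ler_nat.
have [c _ [/= <- [w' Ew' cE]]] := Aw n I.
exists w' => // i; apply: le_trans hn.
have n0 : 0 < n.+1%:R :> R by rewrite ltr0n.
have /ffunP/(_ i) := cE; rewrite !ffunE.
have /andP[] := floor_itv (n.+1%:R * X i w).
have /andP[] := floor_itv (n.+1%:R * X i w'); rewrite !intrD => + + + + E'; rewrite E' => h1 h2 h3 h4.
rewrite -(ler_pM2l n0) mulfV ?gt_eqF// -{1}(gtr0_norm n0) -normrM mulrBr ler_norml.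
apply/andP; split; lra.
Qed.

End MeasurableApprox.

Section Tails.
Context {R : realType} d (T : measurableType d) (P : {measure set T -> \bar R}).
Implicit Types (X Y : T -> R).

(** Cover [{X + Y >= y}] by the [N + 1] rectangles
[{X >= j s, Y >= (N - j) s}] with [s = y / (N + 1)]; only the fraction
[N / (N + 1)] of the rate is kept. *)
Lemma tail_add X Y (c C : R) (N : nat) : measurable_fun setT X -> measurable_fun setT Y ->
  (forall w, 0 <= X w) -> (forall w, 0 <= Y w) -> 0 < c -> 0 <= C ->
  (forall a b : R, 0 <= a -> 0 <= b ->
     (P [set w | a <= X w /\ b <= Y w]%R <= (C * expR (- c * (a + b)))%:E)%E) ->
  forall y : R, 0 <= y ->
  (P [set w | y <= X w + Y w]%R <= (N.+1%:R * C * expR (- (c * (N%:R / N.+1%:R)) * y))%:E)%E.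
Proof.
move=> mX mY X0 Y0 c0 C0 h y y0.
have n0 : 0 < N.+1%:R :> R by rewrite ltr0n.
pose s := y / N.+1%:R.
have s0 : 0 <= s by rewrite divr_ge0// ltW.
have sE : N.+1%:R * s = y by rewrite mulrC divfK// gt_eqF.
have sE' : N%:R * s + s = y by rewrite -sE -natr1; ring.
pose A j := [set w | (j%:R * s <= X w)%R /\ ((N - j)%:R * s <= Y w)%R].
have mA j : measurable (A j).
  rewrite (_ : A j = X @^-1` `[j%:R * s, +oo[ `&` Y @^-1` `[(N - j)%:R * s, +oo[).
    by apply: measurableI; rewrite -[X in measurable X]setTI; [exact: mX|exact: mY].
  by apply/seteqP; split => w /=; rewrite !in_itv/= !andbT.
have mS : measurable [set w | y <= X w + Y w]%R.
  rewrite (_ : [set w | _] = (fun w => X w + Y w) @^-1` `[y, +oo[).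
    by rewrite -[X in measurable X]setTI; exact: measurable_funD.
  by apply/seteqP; split => w /=; rewrite in_itv/= andbT.
have cover : [set w | y <= X w + Y w]%R `<=` \big[setU/set0]_(j < N.+1) A j.
  move=> w /= hw; rewrite -bigcup_mkord.
  have [XN|XN] := leP (N%:R * s) (X w).
    by exists N => //=; split => //; rewrite subnn mul0r.
  have s1 : 0 < s.
    rewrite lt0r s0 andbT; apply/eqP => s00; move: XN; rewrite s00 mulr0 ltNge X0//.
  (* the index of the slab that contains [X w] *)
  pose j := Num.Def.trunc (X w / s).
  have := archimedean.Num.Theory.truncnP (X w / s); rewrite divr_ge0//.
  rewrite ler_pdivlMr// ltr_pdivrMr// -/j => /andP[j1 j2].
  have jN : (j < N)%N.
    by rewrite -(ltr_nat R) -(ltr_pM2r s1) (le_lt_trans j1).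
  exists j => /=; first exact: ltnW.
  split => //; rewrite natrB; last exact: ltnW.
  move: j2; rewrite -natr1; lra.
have mU : measurable (\big[setU/set0]_(j < N.+1) A j).
  by apply: bigsetU_measurable => j _.
apply: (@le_trans _ _ (P (\big[setU/set0]_(j < N.+1) A j))).
  by apply: le_measure => //; rewrite inE.
apply: (le_trans (Boole_inequality P _)) => [j _|]; first exact: mA.
apply: (@le_trans _ _ (\sum_(j < N.+1) (C * expR (- (c * (N%:R / N.+1%:R)) * y))%:E)%E).
  apply: lee_sum => j _.
  apply: le_trans (h _ _ _ _) _; [by rewrite mulr_ge0|by rewrite mulr_ge0|].
  rewrite lee_fin; apply: ler_wpM2l => //; rewrite ler_expR.
  rewrite -mulrDl -natrD subnKC; last by rewrite -ltnS.
  rewrite /s; rewrite le_eqVlt; apply/orP; left; apply/eqP; ring.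
by rewrite sumEFin lee_fin sumr_const card_ord -mulrA [leRHS]mulr_natl.
Qed.

End Tails.

Section Gaussian.
Variable R : realType.

Lemma measurable_sq_ge (a : R) : measurable [set x : R | a <= x ^+ 2].
Proof.
rewrite (_ : [set x | _] = (fun x : R => x ^+ 2) @^-1` `[a, +oo[).
  by rewrite -[X in measurable X]setTI; exact: measurable_funX.
by apply/seteqP; split => x /=; rewrite in_itv/= andbT.
Qed.

(** Part of the Gaussian decay is traded for a wider Gaussian density. *)
Lemma normal_pdf_split (s c : R) : 0 < s -> 0 < c < (s ^+ 2 *+ 2)^-1 ->
  exists2 s' : R, 0 < s' & forall x, normal_pdf 0 s x <=
    (normal_peak s / normal_peak s') * normal_pdf 0 s' x * expR (- c * x ^+ 2).
Proof.
move=> s0 /andP[c0 cs].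
pose v := ((s ^+ 2 *+ 2)^-1 - c)^-1.
have v0 : 0 < v by rewrite invr_gt0 subr_gt0.
pose s' := Num.sqrt (v / 2).
have s'0 : 0 < s' by rewrite sqrtr_gt0 divr_gt0.
exists s' => // x.
rewrite !normal_pdfE ?gt_eqF// /normal_fun.
have p0 : 0 < normal_peak s' by rewrite normal_peak_gt0 ?gt_eqF.
have -> : s' ^+ 2 *+ 2 = v.
  by rewrite sqr_sqrtr ?divr_ge0 ?ltW// -mulr_natr divfK.
rewrite -mulrA -[X in X * (_ * _)]/(normal_peak s / normal_peak s') -!mulrA.
rewrite ler_wpM2l ?normal_peak_ge0//.
rewrite mulrA mulrA mulVf ?gt_eqF// mul1r -expRD ler_expR subr0 invrK.
rewrite le_eqVlt; apply/orP; left; apply/eqP; ring.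
Qed.

(** The wider density of [normal_pdf_split] has total mass [1]. *)
Lemma normal_tail (s c : R) : 0 < s -> 0 < c < (s ^+ 2 *+ 2)^-1 -> exists2 C : R, 0 <= C &
  forall a : R, (normal_prob 0 s [set x | a <= x ^+ 2]%R <= (C * expR (- c * a))%:E)%E.
Proof.
move=> s0 hc; have c0 : 0 < c by case/andP: hc.
have [s' s'0 hs] := normal_pdf_split s0 hc.
set C := normal_peak s / normal_peak s' in hs.
have C0 : 0 <= C by rewrite divr_ge0// normal_peak_ge0.
exists C => // a.
have mS := measurable_sq_ge a.
rewrite /normal_prob.
apply: (@le_trans _ _ (\int[lebesgue_measure]_(x in [set x : R | a <= x ^+ 2]%R)
    ((C * expR (- c * a))%:E * (normal_pdf 0 s' x)%:E))%E).
  apply: ge0_le_integral => //.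
  - by move=> x _; rewrite lee_fin normal_pdf_ge0.
  - by apply/measurable_EFinP; apply: measurable_funTS; exact: measurable_normal_pdf.
  - apply: measurable_funeM; apply/measurable_EFinP; apply: measurable_funTS.
    exact: measurable_normal_pdf.
  - move=> x /= ax; rewrite -EFinM lee_fin (le_trans (hs x))//.
    rewrite mulrAC ler_wpM2r ?normal_pdf_ge0// ler_wpM2l// ler_expR !mulNr lerN2.
    by rewrite ler_wpM2l// ltW.
rewrite ge0_integralZl//.
- rewrite -[leRHS]mule1; apply: lee_wpmul2l; first by rewrite lee_fin mulr_ge0// expR_ge0.
  rewrite -(integral_normal_pdf 0 s'); apply: ge0_subset_integral => //.
  - by apply/measurable_EFinP; exact: measurable_normal_pdf.
  - by move=> x _; rewrite lee_fin normal_pdf_ge0.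
- by apply/measurable_EFinP; apply: measurable_funTS; exact: measurable_normal_pdf.
- by move=> x _; rewrite lee_fin normal_pdf_ge0.
- by rewrite lee_fin mulr_ge0// expR_ge0.
Qed.

Lemma normal_box (s a A : R) : 0 < s -> (forall x : R, a <= x <= a + 1 -> x ^+ 2 <= A ^+ 2) ->
  ((normal_peak s * expR (- (A ^+ 2) / (s ^+ 2 *+ 2)))%:E <= normal_prob 0 s `[a, (a + 1)%R])%E.
Proof.
move=> s0 hA; rewrite /normal_prob; set c := _ * _.
apply: (@le_trans _ _ (\int[lebesgue_measure]_(x in `[a, (a + 1)%R]) (cst c%:E x))%E).
  rewrite integral_cst//= lebesgue_measure_itv/= lte_fin ltrDl ltr01.
  by rewrite -EFinB addrAC subrr add0r mule1.
apply: ge0_le_integral => //.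
- by move=> x _; rewrite lee_fin mulr_ge0 ?normal_peak_ge0 ?expR_ge0.
- by apply/measurable_EFinP; apply: measurable_funTS; exact: measurable_normal_pdf.
move=> x /=; rewrite in_itv/= => /hA xA; rewrite lee_fin normal_pdfE ?gt_eqF// /normal_fun subr0.
rewrite ler_wpM2l ?normal_peak_ge0// ler_expR ler_wpM2r ?lerN2//.
by rewrite invr_ge0 mulrn_wge0// sqr_ge0.
Qed.

End Gaussian.

(** * The event in terms of the data *)

Section Events.
Variable R : realType.
Implicit Types (a b : R[i]).
Local Notation Re := (@complex.Re R).
Local Notation Im := (@complex.Im R).

(** In the scaling [eps = mu h], [mu = eps^(1 - delta)], [h = eps^delta]: if
[alpha] and [beta] are too small then [s < (1 - eta) z mu], and the correction
[9 s^2] does not make up for the missing [eta z mu]. *)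
Lemma rare_event_amplitude (h mu z eta : R) a b u t : 0 < h -> 0 < mu -> 0 < z ->
  0 < eta < 1 -> (z * mu) ^+ 2 <= 1 / 8 -> 9 * (z * mu) <= eta -> 0 <= t ->
  is_solution (datum (mu * h) a b) u -> z * mu <= sup_torus (u t) ->
  (1 - eta) ^+ 2 * z ^+ 2 / 2 / h ^+ 2 <= nsq a + nsq b.
Proof.
move=> h0 mu0 z0 /andP[eta0 eta1] small9 small t0 sol; apply: contraTT; rewrite -!ltNge => hlt.
set S := 2 * (mu * h) ^+ 2 * (nsq a + nsq b).
have S0 : 0 <= S := amplitude_ge0 _ _ _.
set s := Num.sqrt S; have s0 : 0 <= s := sqrtr_ge0 _.
have sE : s ^+ 2 = S by rewrite sqr_sqrtr.
have zm0 : 0 < z * mu by rewrite mulr_gt0.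
have r0 : 0 < (1 - eta) * (z * mu) by rewrite mulr_gt0// subr_gt0.
have sr : s < (1 - eta) * (z * mu).
  rewrite -ltr_sqr ?nnegrE ?(ltW r0)// sE /S.
  have h2 : 0 < h ^+ 2 by rewrite exprn_gt0.
  have m2 : 0 < mu ^+ 2 by rewrite exprn_gt0.
  move: hlt; rewrite ltr_pdivlMr// => hlt.
  rewrite (_ : 2 * _ * _ = mu ^+ 2 * (2 * ((nsq a + nsq b) * h ^+ 2))); last by ring.
  rewrite (_ : (_ * _) ^+ 2 = mu ^+ 2 * ((1 - eta) ^+ 2 * z ^+ 2)); last by ring.
  rewrite ltr_pM2l//; lra.
have rz : (1 - eta) * (z * mu) <= z * mu by rewrite ler_piMl ?(ltW zm0)//; lra.
have s8 : s ^+ 2 <= 1 / 8.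
  by apply: le_trans small9; rewrite ler_sqr ?nnegrE ?(ltW zm0)//; lra.
apply: le_lt_trans (solution_upper sol t0 s8) _; rewrite -/S -/s.
have : s ^+ 2 <= (z * mu) ^+ 2 by rewrite ler_sqr ?nnegrE ?(ltW zm0)//; lra.
have : 9 * (z * mu) * (z * mu) <= eta * (z * mu) by rewrite ler_wpM2r// ltW.
move: sr; rewrite mulrBl mul1r [(z * mu) ^+ 2]expr2.
move: (z * mu) (s ^+ 2) (s) (eta * _) => w s2 s1 v; lra.
Qed.

Lemma box_amplitude (A h z eta a1 a2 b1 b2 : R) : 0 < h <= 1 -> 0 < A ->
  h * A = z / 2 + eta -> 0 <= z / 2 + eta ->
  A <= a1 <= A + 1 -> 0 <= a2 <= 1 -> - (A + 1) <= b1 <= - A -> 0 <= b2 <= 1 ->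
  2 * h ^+ 2 * (a1 ^+ 2 + a2 ^+ 2 + b1 ^+ 2 + b2 ^+ 2) <= 4 * ((z / 2 + eta + 1) ^+ 2 + 1).
Proof.
move=> /andP[h0 h1] A0 hA ze /andP[a11 a12] /andP[a21 a22] /andP[b11 b12] /andP[b21 b22].
have e1 : a1 ^+ 2 <= (A + 1) ^+ 2 by rewrite ler_sqr ?nnegrE//; lra.
have e2 : b1 ^+ 2 <= (A + 1) ^+ 2 by rewrite -sqrrN ler_sqr ?nnegrE//; lra.
have e3 : a2 ^+ 2 <= 1 by rewrite expr_le1.
have e4 : b2 ^+ 2 <= 1 by rewrite expr_le1.
have e5 : h ^+ 2 <= 1 by rewrite expr_le1// ltW.
have e6 : (h * (A + 1)) ^+ 2 <= (z / 2 + eta + 1) ^+ 2.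
  by rewrite ler_sqr ?nnegrE ?mulr_ge0// ?(ltW h0)//; lra.
have : h ^+ 2 * (a1 ^+ 2 + a2 ^+ 2 + b1 ^+ 2 + b2 ^+ 2) <= h ^+ 2 * (2 * (A + 1) ^+ 2 + 2).
  by rewrite ler_wpM2l ?sqr_ge0//; lra.
move: e6; rewrite exprMn mulrDr; lra.
Qed.

Lemma box_sides (A a1 a2 b1 b2 : R) : 0 <= A ->
  A <= a1 <= A + 1 -> 0 <= a2 <= 1 -> - (A + 1) <= b1 <= - A -> 0 <= b2 <= 1 ->
  (2 * A) ^+ 2 <= (a1 - b1) ^+ 2 + (a2 - b2) ^+ 2 /\ (a1 + b1) ^+ 2 + (a2 + b2) ^+ 2 <= 5.
Proof.
move=> A0 /andP[a11 a12] /andP[a21 a22] /andP[b11 b12] /andP[b21 b22].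
have e1 : (2 * A) ^+ 2 <= (a1 - b1) ^+ 2 by rewrite ler_sqr ?nnegrE; lra.
have e2 : (a1 + b1) ^+ 2 <= 1.
  by rewrite -real_normK ?num_real// expr_le1// ler_norml; apply/andP; split; lra.
have e3 : (a2 + b2) ^+ 2 <= 2 ^+ 2 by rewrite ler_sqr ?nnegrE; lra.
have := sqr_ge0 (a2 - b2); split; lra.
Qed.

Lemma box_quartic (h mu z eta A lam s D E : R) : 0 < mu -> 0 <= A -> 0 <= E ->
  h * A = z / 2 + eta ->
  (z + eta) ^+ 4 + 25 * h ^+ 4 + 4000 * (lam ^+ 5 * mu) <= (z + 2 * eta) ^+ 4 ->
  s ^+ 5 <= lam ^+ 5 * mu ^+ 5 -> (2 * A) ^+ 2 <= D -> E <= 5 ->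
  ((z + eta) * mu) ^+ 4 <= (mu * h) ^+ 4 * D ^+ 2 - (mu * h) ^+ 4 * E ^+ 2 - 4000 * s ^+ 5.
Proof.
move=> mu0 A0 E0 hA hs s5 hD hE.
have m4 : 0 < mu ^+ 4 by rewrite exprn_gt0.
have h4 : 0 <= h ^+ 4 by rewrite -[4%N]/(2 * 2)%N exprM sqr_ge0.
have E2 : E ^+ 2 <= 5 ^+ 2 by rewrite ler_sqr ?nnegrE.
have D2 : ((2 * A) ^+ 2) ^+ 2 <= D ^+ 2.
  by rewrite ler_sqr ?nnegrE ?sqr_ge0// (le_trans _ hD)// sqr_ge0.
have mh : 0 <= (mu * h) ^+ 4 by rewrite exprMn mulr_ge0// ltW.
have f1 := ler_wpM2l mh E2; have f2 := ler_wpM2l mh D2.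
have f3 : (mu * h) ^+ 4 * ((2 * A) ^+ 2) ^+ 2 = mu ^+ 4 * (z + 2 * eta) ^+ 4.
  by rewrite (_ : z + 2 * eta = 2 * (h * A)); [ring|rewrite hA; field].
have f4 := ler_wpM2l (ltW m4) hs.
have f5 : (mu * h) ^+ 4 * 5 ^+ 2 = mu ^+ 4 * (25 * h ^+ 4) by ring.
have f6 : mu ^+ 4 * (4000 * (lam ^+ 5 * mu)) = 4000 * (lam ^+ 5 * mu ^+ 5) by ring.
rewrite exprMn mulrC; move: f4; rewrite !mulrDr -f3 -f5 f6.
move: f1 f2 s5; move: (_ ^+ 4 * (z + eta) ^+ 4) (_ * D ^+ 2) (_ * E ^+ 2) (lam ^+ 5 * _) (s ^+ 5).
move=> v1 v2 v3 v4 v5; lra.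
Qed.

(** With [alpha] near [A] and [beta] near [- A] the coefficient of [sin] has
modulus at least [2 eps A = (z + 2 eta) mu], that of [cos] is [O(eps)]; the
margin [2 eta] pays for the error terms. *)
Lemma sin_data_large (h mu z eta A : R) a b u t : 0 < h <= 1 -> 0 < mu -> 0 < z -> 0 < eta ->
  A = (z / 2 + eta) / h -> 0 <= t ->
  let lam2 := 4 * ((z / 2 + eta + 1) ^+ 2 + 1) in
  lam2 * mu ^+ 2 <= 1 / 8 -> 9 * lam2 * mu <= eta ->
  (z + eta) ^+ 4 + 25 * h ^+ 4 + 4000 * (Num.sqrt lam2 ^+ 5 * mu) <= (z + 2 * eta) ^+ 4 ->
  is_solution (datum (mu * h) a b) u ->
  A <= Re a <= A + 1 -> 0 <= Im a <= 1 -> - (A + 1) <= Re b <= - A -> 0 <= Im b <= 1 ->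
  z * mu <= sup_torus (u t).
Proof.
move=> /andP[h0 h1] mu0 z0 eta0 AE t0 lam2 small8 small9 hsmall sol.
case: a b sol => [a1 a2] [b1 b2] sol /= /andP[a11 a12] /andP[a21 a22] /andP[b11 b12] /andP[b21 b22].
have A0 : 0 < A by rewrite AE; apply: divr_gt0 (addr_gt0 _ eta0) h0; exact: divr_gt0.
have hA : h * A = z / 2 + eta by rewrite AE mulrC divfK// gt_eqF.
set S := 2 * (mu * h) ^+ 2 * (nsq (a1 +i* a2) + nsq (b1 +i* b2)).
set s := Num.sqrt S; have s0 : 0 <= s := sqrtr_ge0 _.
have S0 : 0 <= S := amplitude_ge0 _ _ _.
have sE : s ^+ 2 = S by rewrite sqr_sqrtr.
have m2 : 0 < mu ^+ 2 by rewrite exprn_gt0.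
have hA1 : h * (A + 1) <= z / 2 + eta + 1 by rewrite mulrDr hA mulr1 lerD2l.
have hA0 : 0 <= h * (A + 1) by rewrite mulr_ge0 ?(ltW h0) ?addr_ge0 ?(ltW A0).
have Sle : S <= lam2 * mu ^+ 2.
  rewrite (_ : S = mu ^+ 2 * (2 * h ^+ 2 * (a1 ^+ 2 + a2 ^+ 2 + b1 ^+ 2 + b2 ^+ 2))).
    rewrite mulrC ler_wpM2r ?(ltW m2)//.
    apply: (@box_amplitude A) => //; try (by apply/andP); lra.
  by rewrite /S /nsq /=; ring.
have l20 : 0 <= lam2 by rewrite /lam2 mulr_ge0 ?addr_ge0 ?sqr_ge0.
set lam := Num.sqrt lam2 in hsmall.
have lam0 : 0 <= lam := sqrtr_ge0 _.
have lamE : lam ^+ 2 = lam2 by rewrite sqr_sqrtr.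
have sl : s <= lam * mu.
  by rewrite -ler_sqr ?nnegrE ?mulr_ge0 ?(ltW mu0)// sE exprMn lamE.
have s8 : s ^+ 2 <= 1 / 8 by rewrite sE (le_trans Sle).
have s9 : 9 * s ^+ 2 <= eta * mu.
  apply: le_trans (ler_wpM2r (ltW mu0) small9); rewrite sE.
  have -> : 9 * lam2 * mu * mu = 9 * (lam2 * mu ^+ 2) by rewrite expr2 !mulrA.
  exact: ler_wpM2l (ler0n _ _) _ _ Sle.
have zm : 0 < z * mu by rewrite mulr_gt0.
have := @solution_lower _ _ _ _ _ sol t ((z + eta) * mu) t0 s8.
rewrite -/S -/s => low.
have zs : z * mu <= (z + eta) * mu - 9 * s ^+ 2 by rewrite mulrDl -addrA lerDl subr_ge0.
apply: (le_trans zs); apply: low.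
  by rewrite (le_trans s9)// ler_wpM2r ?(ltW mu0)// lerDr ltW.
have s5 : s ^+ 5 <= lam ^+ 5 * mu ^+ 5 by rewrite -exprMn lerXn2r ?nnegrE ?mulr_ge0 ?(ltW mu0).
have [D E] : (2 * A) ^+ 2 <= nsq ((a1 +i* a2) - (b1 +i* b2)) /\ nsq ((a1 +i* a2) + (b1 +i* b2)) <= 5.
  by rewrite nsqB nsqD; apply: box_sides; rewrite ?(ltW A0)//; apply/andP.
exact: (box_quartic mu0 (ltW A0) (nsq_ge0 _) hA hsmall s5 D E).
Qed.

End Events.

Section Limit.
Variable R : realType.

Lemma powR_small (p e : R) : 0 < p -> 0 < e -> \forall x \near (0:R)^'+, x `^ p < e.
Proof.
move=> p0 e0; near=> x.
have x0 : 0 < x by near: x; exact: nbhs_right_gt.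
have xe : x < e `^ p^-1 by near: x; apply: nbhs_right_lt; rewrite powR_gt0.
have -> : e = (e `^ p^-1) `^ p by rewrite -powRrM mulVf ?gt_eqF// powRr1// ltW.
by apply: gt0_ltr_powR => //; rewrite nnegrE ?powR_ge0// ltW.
Unshelve. all: by end_near. Qed.

(** Multiplicative constants disappear because [T] tends to [0]. *)
Lemma ldp_limit (P : R -> \bar R) (T : R -> R) (L : R) :
  (forall e : R, 0 < e -> \forall x \near (0:R)^'+, 0 < T x < e) ->
  (\forall x \near (0:R)^'+, P x \is a fin_num) ->
  (forall e : R, 0 < e -> exists2 C : R, 0 < C &
     \forall x \near (0:R)^'+, (P x <= (C * expR (- (L - e) / T x))%:E)%E) ->
  (forall e : R, 0 < e -> exists2 k : R, 0 < k &
     \forall x \near (0:R)^'+, ((k * expR (- (L + e) / T x))%:E <= P x)%E) ->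
  ((T x)%:E * lne (P x))%E @[x --> (0:R)^'+] --> (- L)%:E.
Proof.
move=> T0 Pfin up low.
have lnP : \forall x \near (0:R)^'+, [/\ 0 < T x, 0 < fine (P x) &
    ((T x)%:E * lne (P x))%E = (T x * ln (fine (P x)))%:E].
  have [k k0 hk] := low 1 ltr01.
  near=> x.
  have /andP[Tx _] : 0 < T x < 1 by near: x; exact: T0.
  have hx : ((k * expR (- (L + 1) / T x))%:E <= P x)%E by near: x.
  have Pfinx : P x \is a fin_num by near: x.
  have Px : 0 < fine (P x).
    rewrite -lte_fin fineK//; apply: lt_le_trans hx.
    by rewrite lte_fin mulr_gt0// expR_gt0.
  by split => //; rewrite -[in LHS](fineK Pfinx) lne_EFin.
apply: cvg_EFin.
  by apply: filterS lnP => x [_ _ ->].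
apply/cvgrPdist_le => e e0.
have e2 : 0 < e / 2 by rewrite divr_gt0.
have [C C0 hC] := up _ e2; have [k k0 hk] := low _ e2.
pose m := `|ln C| + `|ln k| + 1.
have m0 : 0 < m by rewrite ltr_wpDl// addr_ge0.
near=> x.
have [Tx Px E] : [/\ 0 < T x, 0 < fine (P x) &
    ((T x)%:E * lne (P x))%E = (T x * ln (fine (P x)))%:E] by near: x.
have /andP[_ Tm] : 0 < T x < e / 2 / m by near: x; apply: T0; rewrite divr_gt0.
have uP : (P x <= (C * expR (- (L - e / 2) / T x))%:E)%E by near: x.
have lP : ((k * expR (- (L + e / 2) / T x))%:E <= P x)%E by near: x.
have Pfinx : P x \is a fin_num by near: x.
rewrite -[P x]fineK// in uP lP.
rewrite /= E /=; move: uP lP; rewrite !lee_fin; set p := fine (P x) in Px *.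
move=> uP lP.
rewrite ltr_pdivlMr// in Tm.
have U : T x * ln p <= T x * ln C - (L - e / 2).
  have : ln p <= ln (C * expR (- (L - e / 2) / T x)).
    by rewrite ler_ln ?posrE// mulr_gt0// expR_gt0.
  rewrite lnM ?posrE ?expR_gt0// expRK => /(ler_wpM2l (ltW Tx)) /le_trans; apply.
  by rewrite mulrDr [T x * (_ / _)]mulrC divfK// gt_eqF.
have W : T x * ln k - (L + e / 2) <= T x * ln p.
  have : ln (k * expR (- (L + e / 2) / T x)) <= ln p.
    by rewrite ler_ln ?posrE// mulr_gt0// expR_gt0.
  rewrite lnM ?posrE ?expR_gt0// expRK => /(ler_wpM2l (ltW Tx)); apply: le_trans.
  by rewrite mulrDr [T x * (_ / _)]mulrC divfK// gt_eqF.
have hCm : T x * ln C <= e / 2.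
  apply: le_trans (ltW Tm); rewrite ler_wpM2l ?(ltW Tx)// /m.
  by have := ler_norm (ln C); have := normr_ge0 (ln k); lra.
have hkm : - (e / 2) <= T x * ln k.
  rewrite lerNl -mulrN; apply: le_trans (ltW Tm); rewrite ler_wpM2l ?(ltW Tx)// /m.
  by have := ler_norm (- ln k); rewrite normrN; have := normr_ge0 (ln C); lra.
rewrite ler_norml; apply/andP; split; lra.
Unshelve. all: by end_near. Qed.

End Limit.

(** * Tails and boxes for the Gaussian data *)

Section TailRate.
Context {R : realType} d (T : measurableType d) (P : {measure set T -> \bar R}).

(** The fraction of the rate lost in [tail_add] is arbitrarily small. *)
Lemma tail_add_rate (X Y : T -> R) (c0 : R) : measurable_fun setT X -> measurable_fun setT Y ->
  (forall w, 0 <= X w) -> (forall w, 0 <= Y w) ->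
  (forall c : R, 0 < c < c0 -> exists2 C : R, 0 <= C & forall a b : R, 0 <= a -> 0 <= b ->
     (P [set w | a <= X w /\ b <= Y w]%R <= (C * expR (- c * (a + b)))%:E)%E) ->
  forall c : R, 0 < c < c0 -> exists2 C : R, 0 <= C & forall y : R, 0 <= y ->
     (P [set w | y <= X w + Y w]%R <= (C * expR (- c * y))%:E)%E.
Proof.
move=> mX mY X0 Y0 H c /andP[c0' cc0].
pose c1 := (c + c0) / 2.
have c1c : c < c1 by rewrite /c1; lra.
have [C C0 hC] := H c1 ltac:(apply/andP; rewrite /c1; split; lra).
pose N := Num.Def.archi_bound (c / (c1 - c)).
have hN : c <= c1 * (N%:R / N.+1%:R).
  have : c / (c1 - c) < N%:R.
    by apply: archi_boundP; rewrite divr_ge0 ?subr_ge0 ?(ltW c0') ?(ltW c1c).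
  rewrite ltr_pdivrMr ?subr_gt0// => h.
  by rewrite mulrA ler_pdivlMr ?ltr0n// -natr1; lra.
exists (N.+1%:R * C); first by rewrite mulr_ge0.
move=> y y0; apply: le_trans (tail_add N mX mY X0 Y0 _ C0 hC y0) _; first by lra.
by rewrite lee_fin ler_wpM2l ?mulr_ge0// ler_expR ler_wpM2r// lerN2.
Qed.

End TailRate.

Section Gaussians.
Context {R : realType} d (Omega : measurableType d) (P : probability Omega R).
Variable sigma : R.
Hypothesis sigma0 : 0 < sigma.
Let s := Num.sqrt (sigma ^+ 2 / 2).

Let s0 : 0 < s. Proof. by rewrite sqrtr_gt0 divr_gt0// exprn_gt0. Qed.

Let s2 : s ^+ 2 *+ 2 = sigma ^+ 2.
Proof. by rewrite sqr_sqrtr ?divr_ge0 ?sqr_ge0// -mulr_natr divfK. Qed.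

Lemma measurable_Re (eta : Omega -> R[i]) : complex_gaussian P sigma eta ->
  measurable_fun setT (fun w => complex.Re (eta w)).
Proof. by case=> m _; exact: (measurableT_comp measurable_fst m). Qed.

Lemma measurable_Im (eta : Omega -> R[i]) : complex_gaussian P sigma eta ->
  measurable_fun setT (fun w => complex.Im (eta w)).
Proof. by case=> m _; exact: (measurableT_comp measurable_snd m). Qed.

Lemma measurable_disc (a : R) : measurable [set p : R * R | a <= p.1 ^+ 2 + p.2 ^+ 2].
Proof.
rewrite (_ : [set p | _] = (fun p : R * R => p.1 ^+ 2 + p.2 ^+ 2) @^-1` `[a, +oo[).
  rewrite -[X in measurable X]setTI.
  by apply: measurable_funD => //; apply: measurable_funX;
    [exact: measurable_fst|exact: measurable_snd].
by apply/seteqP; split => x /=; rewrite in_itv/= andbT.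
Qed.

(** The squared modulus is the sum of the squares of two independent real
Gaussians of variance [sigma^2 / 2], each with tail rate [1 / sigma^2]. *)
Lemma gaussian_tail (eta : Omega -> R[i]) : complex_gaussian P sigma eta ->
  forall c : R, 0 < c < (sigma ^+ 2)^-1 -> exists2 C : R, 0 <= C & forall y : R, 0 <= y ->
    (P [set w | y <= nsq (eta w)]%R <= (C * expR (- c * y))%:E)%E.
Proof.
move=> [_ law] c hc.
pose m2 : {measure set (measurableTypeR R * measurableTypeR R)%type -> \bar R} :=
  (normal_prob 0 s \x normal_prob 0 s)%E.
have joint (c1 : R) : 0 < c1 < (sigma ^+ 2)^-1 -> exists2 C : R, 0 <= C &
    forall a b : R, 0 <= a -> 0 <= b ->
    (m2 [set p : R * R | a <= p.1 ^+ 2 /\ b <= p.2 ^+ 2]%R <= (C * expR (- c1 * (a + b)))%:E)%E.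
  move=> hc1; have [C C0 hC] := @normal_tail R s c1 s0 ltac:(rewrite s2; exact: hc1).
  exists (C * C); first by rewrite mulr_ge0.
  move=> a b a0 b0.
  have -> : [set p : R * R | a <= p.1 ^+ 2 /\ b <= p.2 ^+ 2] =
    [set x | a <= x ^+ 2] `*` [set x | b <= x ^+ 2] by [].
  rewrite [m2 _](product_measure1E (normal_prob 0 s) (normal_prob 0 s)
    (measurable_sq_ge a) (measurable_sq_ge b)).
  apply: le_trans (lee_pmul _ _ (hC a) (hC b)) _ => //.
  rewrite -EFinM lee_fin mulrACA -expRD.
  by rewrite ler_wpM2l ?mulr_ge0// mulrDr.
have [C C0 hC] := tail_add_rate (P := m2) (measurable_funX 2 measurable_fst)
  (measurable_funX 2 measurable_snd) (fun p => sqr_ge0 p.1) (fun p => sqr_ge0 p.2) joint hc.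
exists C => // y y0; have := hC y y0.
by have -> : P [set w | y <= nsq (eta w)] = m2 _ := law _ (measurable_disc y).
Qed.

Variables (alpha beta : Omega -> R[i]).
Hypothesis halpha : complex_gaussian P sigma alpha.
Hypothesis hbeta : complex_gaussian P sigma beta.
Hypothesis hindep : independent_rvC P alpha beta.

Lemma measurable_nsq (eta : Omega -> R[i]) : complex_gaussian P sigma eta ->
  measurable_fun setT (fun w => nsq (eta w)).
Proof.
move=> h; apply: measurable_funD; apply: measurable_funX.
  exact: measurable_Re.
exact: measurable_Im.
Qed.

Lemma amplitude_tail (c : R) : 0 < c < (sigma ^+ 2)^-1 -> exists2 C : R, 0 <= C &
  forall y : R, 0 <= y ->
    (P [set w | y <= nsq (alpha w) + nsq (beta w)]%R <= (C * expR (- c * y))%:E)%E.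
Proof.
move: c; apply: tail_add_rate.
- exact: measurable_nsq.
- exact: measurable_nsq.
- by move=> w; exact: nsq_ge0.
- by move=> w; exact: nsq_ge0.
move=> c hc; have [C C0 hC] := gaussian_tail halpha hc; have [D D0 hD] := gaussian_tail hbeta hc.
exists (C * D); first by rewrite mulr_ge0.
move=> a b a0 b0; have := hindep (measurable_disc a) (measurable_disc b).
rewrite /= => ->.
apply: le_trans (lee_pmul _ _ (hC a a0) (hD b b0)) _ => //.
by rewrite -EFinM lee_fin mulrACA -expRD ler_wpM2l ?mulr_ge0// mulrDr.
Qed.

Lemma gaussian_box (eta : Omega -> R[i]) (a A : R) : complex_gaussian P sigma eta ->
  (forall x : R, a <= x <= a + 1 -> x ^+ 2 <= A ^+ 2) ->
  ((normal_peak s ^+ 2 * expR (- (A ^+ 2 + 1) / sigma ^+ 2))%:E <=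
   P [set w | (`[a, (a + 1)%R] `*` `[0%R, 1%R]) (coords (eta w))])%E.
Proof.
move=> [_ law] hA.
rewrite law; last exact: measurableX.
rewrite product_measure1E//.
have h1 := normal_box s0 hA.
have h2 : ((normal_peak s * expR (- (1 ^+ 2) / (s ^+ 2 *+ 2)))%:E <= normal_prob 0 s `[0%R, (0 + 1)%R])%E.
  by apply: normal_box => // x /andP[x0 x1]; rewrite ler_sqr ?nnegrE// -[1]add0r.
rewrite add0r in h2; rewrite s2 in h1 h2.
apply: le_trans _ (lee_pmul _ _ h1 h2); rewrite ?lee_fin ?mulr_ge0 ?normal_peak_ge0 ?expR_ge0//.
rewrite mulrACA -expRD expr1n expr2 ler_wpM2l ?mulr_ge0 ?normal_peak_ge0//.
by rewrite ler_expR -mulrDl opprD.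
Qed.

(** Data for which [p cos x + q sin x] is close to a multiple of [sin x]. *)
Definition sin_box (A : R) : set Omega := [set w |
  (`[A, (A + 1)%R] `*` `[0%R, 1%R]) (coords (alpha w)) /\
  (`[(- (A + 1))%R, (- (A + 1) + 1)%R] `*` `[0%R, 1%R]) (coords (beta w))].

Lemma sin_box_prob (A : R) : 0 <= A ->
  ((normal_peak s ^+ 4 * expR (- (2 * (A + 1) ^+ 2 + 2) / sigma ^+ 2))%:E <= P (sin_box A))%E.
Proof.
move=> A0; rewrite /sin_box hindep; try exact: measurableX.
have hA : forall x : R, A <= x <= A + 1 -> x ^+ 2 <= (A + 1) ^+ 2.
  by move=> x /andP[x1 x2]; rewrite ler_sqr ?nnegrE//; lra.
have hB : forall x : R, - (A + 1) <= x <= - (A + 1) + 1 -> x ^+ 2 <= (A + 1) ^+ 2.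
  by move=> x /andP[x1 x2]; rewrite -sqrrN ler_sqr ?nnegrE//; lra.
have h1 := gaussian_box halpha hA; have h2 := gaussian_box hbeta hB.
apply: le_trans _ (lee_pmul _ _ h1 h2);
  rewrite ?lee_fin ?mulr_ge0 ?exprn_ge0 ?normal_peak_ge0 ?expR_ge0//.
rewrite mulrACA -expRD -exprD ler_wpM2l ?exprn_ge0 ?normal_peak_ge0//.
rewrite ler_expR le_eqVlt; apply/orP; left; apply/eqP; ring.
Qed.

Lemma measurable_sin_box A : measurable (sin_box A).
Proof.
have [ma _] := halpha; have [mb _] := hbeta.
rewrite /sin_box; apply: measurableI.
  by rewrite -[X in measurable X]setTI; apply: ma => //; exact: measurableX.
by rewrite -[X in measurable X]setTI; apply: mb => //; exact: measurableX.
Qed.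

End Gaussians.

(** * The large deviation rate *)

Section EventMeasurable.
Context {R : realType} d (Omega : measurableType d).
Variables (alpha beta : Omega -> R[i]).
Hypothesis mRa : measurable_fun setT (fun w => complex.Re (alpha w)).
Hypothesis mIa : measurable_fun setT (fun w => complex.Im (alpha w)).
Hypothesis mRb : measurable_fun setT (fun w => complex.Re (beta w)).
Hypothesis mIb : measurable_fun setT (fun w => complex.Im (beta w)).

Lemma sq_close (x y r : R) : 0 <= r -> `|x - y| <= r -> (y - x) ^+ 2 <= r ^+ 2.
Proof. by move=> r0 h; rewrite -sqrrN opprB -real_normK ?num_real// ler_sqr ?nnegrE. Qed.

(** The supremum is upper semicontinuous in the four real data. *)
Lemma measurable_sup_event (eps t z : R) (u : Omega -> R -> R -> R[i]) :
  0 <= t -> (forall w, is_solution (datum eps (alpha w) (beta w)) (u w)) ->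
  measurable [set w | z <= sup_torus (u w t)].
Proof.
move=> t0 sol.
pose X (i : 'I_4) w := [:: complex.Re (alpha w); complex.Im (alpha w);
  complex.Re (beta w); complex.Im (beta w)]`_i.
apply: (@measurable_of_approx R _ _ 4 X).
  by case=> [[|[|[|[|//]]]] ?].
move=> w hw /=; apply/ler_addgt0Pr => e e0.
pose K := 2 * eps ^+ 2 * (2 * (nsq (alpha w) + nsq (beta w)) + 8).
have [r0 r00 stab] := solution_stable eps K t0 e0.
have p0 : 0 < 8 * eps ^+ 2 + 1 by have := sqr_ge0 eps; lra.
pose r := Num.min 1 (r0 / (8 * eps ^+ 2 + 1)).
have rpos : 0 < r by rewrite lt_min ltr01 divr_gt0.
have r1 : r <= 1 by rewrite ge_min lexx.
have rr0 : r * (8 * eps ^+ 2 + 1) <= r0 by rewrite -ler_pdivlMr// ge_min lexx orbT.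
have [w' zw' cl] := hw r rpos.
have c0 := sq_close (ltW rpos) (cl (@Ordinal 4 0 isT)).
have c1 := sq_close (ltW rpos) (cl (@Ordinal 4 1 isT)).
have c2 := sq_close (ltW rpos) (cl (@Ordinal 4 2 isT)).
have c3 := sq_close (ltW rpos) (cl (@Ordinal 4 3 isT)).
rewrite /X /= in c0 c1 c2 c3.
have rsq : r ^+ 2 <= r by rewrite expr2 ler_piMl// ltW.
have close : nsq (alpha w' - alpha w) + nsq (beta w' - beta w) <= 4 * r.
  by rewrite !nsqB; lra.
have e2 := sqr_ge0 eps.
apply: (le_trans zw'); apply: (stab _ _ _ _ _ _ (sol w) (sol w')).
- apply: ler_wpM2l; first lra.
  by have := nsq_ge0 (alpha w); have := nsq_ge0 (beta w); lra.
- apply: ler_wpM2l; first lra.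
  have dbl (x y : R) : y ^+ 2 <= 2 * x ^+ 2 + 2 * (y - x) ^+ 2.
    by have := sqr_ge0 (2 * x - y); lra.
  have := dbl (complex.Re (alpha w)) (complex.Re (alpha w')).
  have := dbl (complex.Im (alpha w)) (complex.Im (alpha w')).
  have := dbl (complex.Re (beta w)) (complex.Re (beta w')).
  have := dbl (complex.Im (beta w)) (complex.Im (beta w')).
  by rewrite /nsq; lra.
- have : 2 * eps ^+ 2 * (nsq (alpha w' - alpha w) + nsq (beta w' - beta w)) <= 2 * eps ^+ 2 * (4 * r).
    by apply: ler_wpM2l => //; lra.
  by move: rr0; rewrite mulrDr; lra.
Qed.

End EventMeasurable.

Section Scales.
Variable R : realType.
Implicit Types x delta : R.

Lemma scale_split x delta : 0 < x -> x = x `^ (1 - delta) * x `^ delta.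
Proof.
move=> x0; rewrite -powRD; last by apply/implyP => _; rewrite gt_eqF.
by rewrite subrK powRr1// ltW.
Qed.

Lemma scale_sq x delta : 0 < x -> x `^ (2 * delta) = (x `^ delta) ^+ 2.
Proof. by move=> x0; rewrite mulrC powRrM powR_mulrn ?powR_ge0. Qed.

Lemma sq_le_eighth x : 0 <= x -> x * 3 <= 1 -> x ^+ 2 <= 1 / 8.
Proof.
move=> x0 x3; have : x ^+ 2 <= (1 / 3) ^+ 2 by rewrite ler_sqr ?nnegrE; lra.
lra.
Qed.

Lemma le_ninth (x y : R) : x < y / 9 -> 9 * x <= y.
Proof. lra. Qed.

Lemma box_room (a b h h4 m q : R) : h4 <= h -> h < (b - a) / 50 -> 0 <= m ->
  m * (4000 * q + 1) < (b - a) / 2 -> a + 25 * h4 + 4000 * (q * m) <= b.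
Proof. move=> h1 h2 m0; rewrite mulrDr; lra. Qed.

Lemma nine_le (x y : R) : 0 <= x -> x * 3 < y / 9 -> 9 * x <= y.
Proof. lra. Qed.

Lemma cube_loss (L e eta : R) : 0 <= L -> 0 <= eta -> eta <= 1 -> 3 * L * eta <= e ->
  L - e <= (1 - eta) ^+ 3 * L.
Proof.
move=> L0 eta0 eta1 h.
have : 0 <= eta ^+ 2 * (3 - eta) * L by rewrite !mulr_ge0 ?sqr_ge0//; lra.
rewrite (_ : (1 - eta) ^+ 3 * L = L - 3 * L * eta + eta ^+ 2 * (3 - eta) * L); last by ring.
lra.
Qed.

Lemma exponent_loss (z eta h c : R) : 0 <= z -> 0 <= h -> h <= eta -> eta <= 1 ->
  eta * (4 * z + 10) <= c -> 2 * (z / 2 + eta + h) ^+ 2 + 2 * h ^+ 2 <= z ^+ 2 / 2 + c.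
Proof.
move=> z0 h0 he eta1 hc.
have eta0 : 0 <= eta by exact: le_trans he.
have b1 : (z / 2 + eta + h) ^+ 2 <= (z / 2 + 2 * eta) ^+ 2 by rewrite ler_sqr ?nnegrE; lra.
have b2 : h ^+ 2 <= eta ^+ 2 by rewrite ler_sqr ?nnegrE.
have b3 : eta ^+ 2 <= eta by rewrite expr2 ler_piMr.
have : (z / 2 + 2 * eta) ^+ 2 = z ^+ 2 / 4 + 2 * (z * eta) + 4 * eta ^+ 2 by field.
move: hc; rewrite mulrDr [eta * (4 * z)]mulrC -mulrA; lra.
Qed.

End Scales.

Theorem proposition3p2 (R : realType) (d : measure_display)
    (Omega : measurableType d) (P : probability Omega R)
    (z0 kappa delta sigma : R) (alpha beta : Omega -> R[i])
    (u : R -> Omega -> R -> R -> R[i]) (t : R -> R)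
    (hz0 : 0 < z0) (hkappa : 0 < kappa) (hdelta : 0 < delta < 1)
    (hsigma : 0 < sigma)
    (halpha : complex_gaussian P sigma alpha)
    (hbeta : complex_gaussian P sigma beta)
    (hindep : independent_rvC P alpha beta)
    (hu : forall (eps : R) (w : Omega), 0 < eps ->
       is_solution
         (fun x => eps%:C * (alpha w * expi x + beta w * expi (- x)))
         (u eps w))
    (ht0 : \forall eps \near 0^'+, 0 <= t eps)
    (ht : exists C : R, 0 < C /\
       \forall eps \near 0^'+,
         t eps <= C * eps `^ (- (5 / 2) * (1 - delta) + kappa)) :
  ((eps `^ (2 * delta))%:E *
     lne (P [set w | (z0 * eps `^ (1 - delta) <= sup_torus (u eps w (t eps)))%R]))%E
    @[eps --> 0^'+] --> (- (z0 ^+ 2 / (2 * sigma ^+ 2)))%:E.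
Proof.
have /andP[d0 d1] := hdelta.
have dd0 : 0 < 1 - delta by rewrite subr_gt0.
set L := z0 ^+ 2 / (2 * sigma ^+ 2).
have s20 : 0 < sigma ^+ 2 by rewrite exprn_gt0.
have L0 : 0 < L by rewrite divr_gt0// ?exprn_gt0// mulr_gt0.
pose E eps := [set w | z0 * eps `^ (1 - delta) <= sup_torus (u eps w (t eps))].
have mE : \forall eps \near (0:R)^'+, measurable (E eps).
  near=> eps; apply: (@measurable_sup_event R _ Omega alpha beta _ _ _ _ eps _ _ (u eps)).
  - exact: (measurable_Re halpha).
  - exact: (measurable_Im halpha).
  - exact: (measurable_Re hbeta).
  - exact: (measurable_Im hbeta).
  - by near: eps.
  - by move=> w; apply: hu; near: eps; exact: nbhs_right_gt.
apply: (@ldp_limit R (fun eps => P (E eps)) (fun eps => eps `^ (2 * delta)) L).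
- move=> e e0; near=> eps; apply/andP; split.
    by rewrite powR_gt0//; near: eps; exact: nbhs_right_gt.
  by near: eps; apply: powR_small => //; rewrite mulr_gt0.
- by apply: filterS mE => eps mEe; exact: fin_num_measure.
- move=> e e0.
  (* chosen so that [(1 - eta)^3 L >= L - e]: a factor [1 - eta] is lost in the
     rate of the tail, two in the threshold on the amplitude *)
  pose eta := Num.min (1 / 2) (e / (3 * L + 1)).
  have eta0 : 0 < eta by rewrite lt_min; apply/andP; split; rewrite ?divr_gt0//; lra.
  have eta1 : eta < 1 by rewrite gt_min; apply/orP; left; lra.
  have etae : 3 * L * eta <= e.
    have : eta * (3 * L + 1) <= e by rewrite -ler_pdivlMr ?ge_min ?lexx ?orbT//; lra.
    by move: eta0; rewrite mulrDr; lra.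
  have hc : 0 < (1 - eta) / sigma ^+ 2 < (sigma ^+ 2)^-1.
    by rewrite divr_gt0 ?subr_gt0//= ltr_pdivrMr// mulVf ?gt_eqF// gtrBl.
  have [C C0 hC] := amplitude_tail hsigma halpha hbeta hindep hc.
  exists (C + 1); first by rewrite ltr_wpDl.
  near=> eps.
  have eps0 : 0 < eps by near: eps; exact: nbhs_right_gt.
  have te : 0 <= t eps by near: eps.
  pose h := eps `^ delta; pose mu := eps `^ (1 - delta).
  have h0 : 0 < h by rewrite powR_gt0.
  have mu0 : 0 < mu by rewrite powR_gt0.
  have zm0 : 0 < z0 * mu by rewrite mulr_gt0.
  have mus : eps `^ (1 - delta) < Num.min 1 (eta / 9) / 3 / z0.
    by near: eps; apply: powR_small => //; rewrite !divr_gt0// lt_min ltr01 divr_gt0.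
  move: mus; rewrite -/mu ltr_pdivlMr// [mu * z0]mulrC ltr_pdivlMr// lt_min => /andP[mus1 mus2].
  have small8 : (z0 * mu) ^+ 2 <= 1 / 8.
    by apply: sq_le_eighth; rewrite ?(ltW zm0) ?(ltW mus1).
  have small9 : 9 * (z0 * mu) <= eta by apply: nine_le mus2; exact: ltW.
  set y := (1 - eta) ^+ 2 * z0 ^+ 2 / 2 / h ^+ 2.
  have y0 : 0 <= y.
    by do 2 (apply: divr_ge0; rewrite ?sqr_ge0//); apply: mulr_ge0; exact: sqr_ge0.
  have sub : E eps `<=` [set w | y <= nsq (alpha w) + nsq (beta w)].
    move=> w Ew.
    have sol : is_solution (datum (mu * h) (alpha w) (beta w)) (u eps w).
      by rewrite -scale_split//; exact: hu.
    by apply: (rare_event_amplitude h0 mu0 hz0 _ small8 small9 te sol) => //; apply/andP.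
  have mEe : measurable (E eps) by near: eps.
  have mA : measurable [set w | y <= nsq (alpha w) + nsq (beta w)].
    rewrite (_ : [set w | _] = (fun w => nsq (alpha w) + nsq (beta w)) @^-1` `[y, +oo[).
      rewrite -[X in measurable X]setTI; apply: measurable_funD => //;
      [exact: (measurable_nsq halpha)|exact: (measurable_nsq hbeta)].
    by apply/seteqP; split => w /=; rewrite in_itv/= andbT.
  apply: (le_trans (le_measure P _ _ sub)); rewrite ?inE//.
  apply: (le_trans (hC y y0)); rewrite lee_fin.
  apply: ler_pM; rewrite ?expR_ge0// ?lerDl// ler_expR scale_sq// -/h.
  have h20 : 0 < h ^+ 2 by rewrite exprn_gt0.
  have -> : - ((1 - eta) / sigma ^+ 2) * y = - ((1 - eta) ^+ 3 * L) / h ^+ 2.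
    by rewrite /y /L; field; rewrite !gt_eqF.
  rewrite ler_pM2r ?invr_gt0// lerN2.
  by apply: cube_loss etae; rewrite ?(ltW L0) ?(ltW eta0) ?(ltW eta1).
- move=> e e0.
  (* chosen so that the cost [2 (z0 / 2 + eta + h)^2 + 2 h^2] of the box, in units
     of [1 / (sigma^2 h^2)], stays below [sigma^2 (L + e)] *)
  pose eta := Num.min 1 (sigma ^+ 2 * e / (4 * z0 + 10)).
  have zp : 0 < 4 * z0 + 10 by lra.
  have eta0 : 0 < eta by rewrite lt_min ltr01 divr_gt0// mulr_gt0.
  have eta1 : eta <= 1 by rewrite ge_min lexx.
  have etae : eta * (4 * z0 + 10) <= sigma ^+ 2 * e by rewrite -ler_pdivlMr// ge_min lexx orbT.
  pose lam2 := 4 * ((z0 / 2 + eta + 1) ^+ 2 + 1).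
  have l20 : 0 < lam2 by have := sqr_ge0 (z0 / 2 + eta + 1); rewrite /lam2; lra.
  pose G := (z0 + 2 * eta) ^+ 4 - (z0 + eta) ^+ 4.
  have G0 : 0 < G.
    rewrite subr_gt0 ltrXn2r// ?nnegrE; lra.
  pose M := 4000 * Num.sqrt lam2 ^+ 5 + 1.
  have M0 : 0 < M by exact: ltr_wpDl (mulr_ge0 (ler0n _ _) (exprn_ge0 5 (sqrtr_ge0 _))) ltr01.
  exists (normal_peak (Num.sqrt (sigma ^+ 2 / 2)) ^+ 4).
    by rewrite exprn_gt0// normal_peak_gt0// gt_eqF// sqrtr_gt0 divr_gt0.
  near=> eps.
  have eps0 : 0 < eps by near: eps; exact: nbhs_right_gt.
  have te : 0 <= t eps by near: eps.
  pose h := eps `^ delta; pose mu := eps `^ (1 - delta).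
  have h0 : 0 < h by rewrite powR_gt0.
  have mu0 : 0 < mu by rewrite powR_gt0.
  have hs : eps `^ delta < Num.min eta (G / 50).
    by near: eps; apply: powR_small => //; rewrite lt_min eta0 divr_gt0.
  have ms1 : eps `^ (1 - delta) < Num.min 1 (G / 2 / M).
    by near: eps; apply: powR_small => //; rewrite lt_min ltr01 !divr_gt0.
  have ms2 : eps `^ (1 - delta) < Num.min (1 / 8) (eta / 9) / lam2.
    by near: eps; apply: powR_small => //; rewrite divr_gt0// lt_min !divr_gt0.
  move: hs; rewrite -/h lt_min => /andP[heta hG].
  move: ms1; rewrite -/mu lt_min ltr_pdivlMr// => /andP[mu1 muG].
  move: ms2; rewrite -/mu ltr_pdivlMr// lt_min => /andP[mu8 mu9].
  have h1 : h <= 1 by rewrite (le_trans (ltW heta)).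
  pose A := (z0 / 2 + eta) / h.
  have A0 : 0 <= A
    by exact: divr_ge0 (addr_ge0 (divr_ge0 (ltW hz0) (ler0n _ 2)) (ltW eta0)) (ltW h0).
  have small8 : lam2 * mu ^+ 2 <= 1 / 8.
    rewrite expr2 mulrA [lam2 * mu]mulrC (le_trans _ (ltW mu8))// ler_piMr ?(ltW mu1)//.
    by rewrite mulr_ge0 ?(ltW mu0) ?(ltW l20).
  have small9 : 9 * lam2 * mu <= eta by rewrite -mulrA [lam2 * mu]mulrC; exact: le_ninth.
  have h4 : h ^+ 4 <= h by rewrite -[leRHS]mulr1 exprS ler_wpM2l ?(ltW h0)// exprn_ile1// ltW.
  have small4 : (z0 + eta) ^+ 4 + 25 * h ^+ 4 + 4000 * (Num.sqrt lam2 ^+ 5 * mu)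
      <= (z0 + 2 * eta) ^+ 4.
    by apply: box_room h4 hG _ muG; exact: ltW.
  have sub : sin_box alpha beta A `<=` E eps.
    move=> w [[]] /=; rewrite !in_itv/= => ra ia [rb ib].
    have sol : is_solution (datum (mu * h) (alpha w) (beta w)) (u eps w).
      by rewrite -scale_split//; exact: hu.
    have rb' : - (A + 1) <= complex.Re (beta w) <= - A.
      by move: rb; rewrite opprD subrK.
    apply: (sin_data_large (h := h) (eta := eta) (A := A) _ mu0 hz0 _ _ te small8 small9 small4 sol) => //.
    by rewrite h0 h1.
  have mEe : measurable (E eps) by near: eps.
  have := sin_box_prob hsigma halpha hbeta hindep A0.
  move=> /le_trans /(_ (le_measure P _ _ sub)); rewrite !inE.
  move=> /(_ (measurable_sin_box halpha hbeta A) mEe); apply: le_trans.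
  rewrite lee_fin ler_wpM2l ?exprn_ge0 ?normal_peak_ge0// ler_expR scale_sq// -/h.
  rewrite !mulNr lerN2 ler_pdivrMr// mulrAC ler_pdivlMr ?exprn_gt0//.
  have -> : (L + e) * sigma ^+ 2 = z0 ^+ 2 / 2 + sigma ^+ 2 * e.
    by rewrite /L; field; rewrite gt_eqF.
  have -> : (2 * (A + 1) ^+ 2 + 2) * h ^+ 2 = 2 * (h * A + h) ^+ 2 + 2 * h ^+ 2 by ring.
  have -> : h * A = z0 / 2 + eta by rewrite mulrC divfK// gt_eqF.
  by apply: exponent_loss; rewrite ?(ltW h0) ?(ltW heta) ?(ltW hz0).
Unshelve. all: by end_near. Qed.
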